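(* Let $K$ be a number field with $r$ real places and $s$ pairs of complex places, $\mathcal{O}_K$ its maximal order and $h_K$ its class number, and let $(\mathcal{O};\mathfrak{m},\Sigma)$ be a level datum of $K$. Then the groups $\mathcal{O}_K^\times/U_{\mathfrak{m},\Sigma}(\mathcal{O})$ and $\mathrm{Cl}_{\mathfrak{m},\Sigma}(\mathcal{O})$ are finite, and $$\#\mathrm{Cl}_{\mathfrak{m},\Sigma}(\mathcal{O})=\frac{h_K}{[\mathcal{O}_K^\times:U_{\mathfrak{m},\Sigma}(\mathcal{O})]}\cdot\frac{2^{|\Sigma|}\,\#\big(\mathcal{O}_K/(\mathfrak{m}:\mathcal{O}_K)\big)^\times}{\#U_{\mathfrak{m}}\big(\mathcal{O}/(\mathfrak{m}:\mathcal{O}_K)\big)}.$$ In particular $\mathrm{rank}\,U_{\mathfrak{m},\Sigma}(\mathcal{O})=\mathrm{rank}\,\mathcal{O}_K^\times=r+s-1$.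
   Context: A level datum $(\mathcal{O};\mathfrak{m},\Sigma)$: $\mathcal O$ an order of $K$, $\mathfrak m$ a nonzero integral $\mathcal O$-ideal, $\Sigma$ a set of real embeddings of $K$. $(\mathfrak m:\mathcal O_K)=\{x\in K: x\mathcal O_K\subseteq\mathfrak m\}$. $U_{\mathfrak m,\Sigma}(\mathcal O)=\{\alpha\in\mathcal O^\times:\alpha\equiv1\pmod{\mathfrak m},\ \rho(\alpha)>0\ \forall\rho\in\Sigma\}$; $U_{\mathfrak m}(\mathcal O/(\mathfrak m:\mathcal O_K))$ is the group of units of $\mathcal O/(\mathfrak m:\mathcal O_K)$ congruent to $1$ modulo the image of $\mathfrak m$. Ray class group $\mathrm{Cl}_{\mathfrak m,\Sigma}(\mathcal O)=J^*_{\mathfrak m}(\mathcal O)/P_{\mathfrak m,\Sigma}(\mathcal O)$, where $J^*_{\mathfrak m}(\mathcal O)$ is the group of invertible fractional $\mathcal O$-ideals coprime to $\mathfrak m$ (a fractional ideal $\mathfrak a$ is coprime to $\mathfrak m$ if $\mathfrak a=(\mathfrak a_1:\mathfrak b_1)=\{x:x\mathfrak b_1\subseteq\mathfrak a_1\}$ with $\mathfrak a_1$ integral, $\mathfrak b_1$ invertible integral, $\mathfrak a_1+\mathfrak m=\mathfrak b_1+\mathfrak m=\mathcal O$), and $P_{\mathfrak m,\Sigma}(\mathcal O)=\{\alpha\mathcal O:\alpha\in K^\times,\alpha-1\in\mathfrak m\mathcal O[S_{\mathfrak m}^{-1}],\rho(\alpha)>0\ \forall\rho\in\Sigma\}$ with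 $S_{\mathfrak m}=\{a\in\mathcal O:a\mathcal O+\mathfrak m=\mathcal O\}$. *)

(* Defs.v *)
From HB Require Import structures.
From mathcomp Require Import all_boot all_order all_algebra all_field.
From mathcomp Require Import algC.
Set Implicit Arguments. Unset Strict Implicit. Unset Printing Implicit Defensive.
Import Order.TTheory GRing.Theory Num.Theory.
Local Open Scope ring_scope.

(* Generic counting: the quotient of {x | P x} by the relation E has exactly
   n classes (E is meant to be an equivalence relation on P).  With E = eq
   this says that {x | P x} has exactly n elements. *)
Definition qcard (T : Type) (P : T -> Prop) (E : T -> T -> Prop) (n : nat) :=
  exists f : 'I_n -> T,
    (forall i, P (f i)) /\ (forall i j, E (f i) (f j) -> i = j) /\
    (forall x, P x -> exists i, E x (f i)).

Section NF.
Variable K : fieldExtType rat.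

Definition kset := K -> Prop.
Definition kseteq (A B : kset) := forall x, A x <-> B x.
Definition ksubset (A B : kset) := forall x, A x -> B x.
Definition sumset (A B : kset) : kset := fun x => exists a b, A a /\ B b /\ x = a + b.
Definition prodset (A B : kset) : kset := fun x =>
  exists n (a b : 'I_n -> K), (forall i, A (a i) /\ B (b i)) /\ x = \sum_(i < n) a i * b i.
Definition colon (A B : kset) : kset := fun x => forall b, B b -> A (x * b).
Definition nonzero (A : kset) := exists x, A x /\ x <> 0.

Definition subring (O : kset) :=
  O 1 /\ (forall x y, O x -> O y -> O (x - y)) /\ (forall x y, O x -> O y -> O (x * y)).

Definition is_order (O : kset) :=
  subring O /\
  exists b : 'I_(\dim (fullv : {vspace K})) -> K,
    (forall c : 'I_(\dim (fullv : {vspace K})) -> rat,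
        \sum_i c i *: b i = 0 -> forall i, c i = 0) /\
    (forall x, O x <-> exists z : 'I_(\dim (fullv : {vspace K})) -> int,
                          x = \sum_i (z i)%:~R * b i).

Definition OK : kset := fun x =>
  exists p : {poly int}, p \is monic /\ (map_poly (fun z : int => z%:~R : K) p).[x] = 0.

Definition is_Omodule (O A : kset) :=
  A 0 /\ (forall x y, A x -> A y -> A (x + y)) /\ (forall a x, O a -> A x -> A (a * x)).
Definition integral_ideal (O A : kset) := is_Omodule O A /\ ksubset A O.
Definition frac_ideal (O A : kset) :=
  is_Omodule O A /\ nonzero A /\ exists d, d <> 0 /\ forall x, A x -> O (d * x).
Definition invertible (O A : kset) :=
  frac_ideal O A /\ exists B, frac_ideal O B /\ kseteq (prodset A B) O.
Definition principal (O : kset) (alpha : K) : kset := fun x => exists o, O o /\ x = alpha * o.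

Definition coprime_to (O m A : kset) :=
  exists A1 B1, integral_ideal O A1 /\ integral_ideal O B1 /\ invertible O B1 /\
    kseteq (sumset A1 m) O /\ kseteq (sumset B1 m) O /\ kseteq A (colon A1 B1).

Definition units (O : kset) : kset := fun x => O x /\ x <> 0 /\ O x^-1.

Definition Sm (O m : kset) : kset := fun s => O s /\ kseteq (sumset (principal O s) m) O.
Definition locS (O m : kset) : kset := fun x => exists a s, O a /\ Sm O m s /\ x = a / s.

Definition is_emb (f : K -> algC) :=
  (forall x y, f (x + y) = f x + f y) /\ (forall x y, f (x * y) = f x * f y) /\ f 1 = 1.
Definition real_emb (f : K -> algC) := is_emb f /\ forall x, f x \is Num.real.
Definition nonreal_emb (f : K -> algC) := is_emb f /\ exists x, f x \isn't Num.real.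

Definition positive_at (k : nat) (sig : 'I_k -> K -> algC) (a : K) := forall i, 0 < sig i a.

Definition Umsig (O m : kset) k (sig : 'I_k -> K -> algC) : kset := fun a =>
  units O a /\ m (a - 1) /\ positive_at sig a.

Definition Pgen (O m : kset) k (sig : 'I_k -> K -> algC) (a : K) :=
  a <> 0 /\ prodset m (locS O m) (a - 1) /\ positive_at sig a.

Definition Jstar (O m : kset) (A : kset) := invertible O A /\ coprime_to O m A.
Definition ray_equiv (O m : kset) k (sig : 'I_k -> K -> algC) (A B : kset) :=
  exists a, Pgen O m sig a /\ kseteq A (prodset (principal O a) B).

Definition class_equiv (O : kset) (A B : kset) :=
  exists a, a <> 0 /\ kseteq A (prodset (principal O a) B).

Definition mult_indep n (u : 'I_n -> K) :=
  forall e : 'I_n -> int, \prod_(i < n) u i ^ e i = 1 -> forall i, e i = 0.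
Definition group_rank (G : kset) (n : nat) :=
  (exists u : 'I_n -> K, (forall i, G (u i)) /\ mult_indep u) /\
  (forall m (u : 'I_m -> K), (forall i, G (u i)) -> mult_indep u -> (m <= n)%N).

End NF.

(* Main.v *)
(* With f = (m : O_K), the proof reduces ray classes of O to congruence classes of
   ideals of O_K modulo f. Contraction B |-> B /\ O carries the integral O_K-ideals
   coprime to f to invertible O-ideals coprime to m, multiplicatively; invertibility
   needs no prime ideals, because some power of B is generated by an element = 1 mod f.
   Every class of Cl_(m,Sigma)(O) contains such a contraction, by an approximation
   argument with idempotents of finite quotient rings, and B /\ O, B' /\ O are
   equivalent iff B = a B' with a in H, the group of positive quotients of elements of
   O that are units mod f and = 1 mod m. Writing G for the group of quotients of
   elements of O_K that are units mod f, K1 for the positive quotients of elements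
   = 1 mod f, and E for the units of O_K, one gets
     #Cl = h [G : H E],  [G : K1] = 2^|Sigma| #(O_K/f)^*,  [H : K1] = #U_m(O/f),
     [H E : H] = [E : E /\ H] = [E : U_(m,Sigma)(O)].
   The class group is finite by Hurwitz's pigeonhole argument. For the rank of E, a
   pigeonhole on the binary sizes of products of units gives the upper bound; the lower
   bound comes from units that are small at all places but one, again found by
   pigeonhole. All estimates are multiplicative, so neither logarithms nor complete
   fields are needed. *)
Require Import Defs.
From HB Require Import structures.
From mathcomp Require Import all_boot all_order all_algebra all_field.
From mathcomp Require Import perm algC.
From mathcomp Require Import boolp zify ring lra.
Set Implicit Arguments. Unset Strict Implicit. Unset Printing Implicit Defensive.
Import Order.TTheory GRing.Theory Num.Theory.
Local Open Scope ring_scope.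

(** * Counting classes *)

(** The argument rests on f being an ideal of both O and O_K: O/f is a subring of the finite ring
    O_K/f, so congruences modulo f make sense in both rings, and an element of O_K that is 1 mod f
    already lies in O. Splitting at primes is replaced by writing y = y x + y (1 - x) with 1 - x in
    f, and the Chinese remainder theorem by idempotent powers in a finite quotient. No integral
    basis of O_K is constructed: the basis is one of O, and a positive integer D with D O_K inside O
    transfers finiteness and size estimates. Signs can be corrected freely because f contains a
    positive integer, whose large multiples may be added without changing residues. Finiteness of
    the index of U_(m,Sigma)(O) does not depend on the rank computation. It follows from finiteness
    of [G : K1], which is evaluated along two chains of subgroups, one separating residues from
    signs, the other passing through H E and H. *)

Definition erel (T : Type) (P : T -> Prop) (E : T -> T -> Prop) :=
  (forall x, P x -> E x x) /\
  (forall x y, P x -> P y -> E x y -> E y x) /\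
  (forall x y z, P x -> P y -> P z -> E x y -> E y z -> E x z).

Lemma card_set_sig (T : finType) (A : {set T}) : #|{: {x | x \in A}}| = #|A|.
Proof. by rewrite card_sig; apply: eq_card. Qed.

Lemma pigeonhole_fiber (A B : finType) (f : A -> B) (N : nat) :
  (N * #|B| < #|A|)%N -> exists y, (N < #|[set x | f x == y]|)%N.
Proof.
move=> h; apply: contrapT => /forallNP hn.
suff: (#|A| <= N * #|B|)%N by rewrite leqNgt h.
rewrite -cardsT.
have -> : [set: A] = \bigcup_(y : B) [set x | f x == y].
  by apply/setP=> x; rewrite inE; apply/esym/bigcupP; exists (f x); rewrite ?inE.
apply: leq_trans (_ : \sum_(y : B) #|[set x | f x == y]| <= _)%N.
  elim/big_ind2: _ => [|A1 n1 A2 n2 h1 h2|//]; first by rewrite cards0.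
  by apply: leq_trans (leq_add h1 h2); rewrite cardsU leq_subr.
apply: leq_trans (_ : \sum_(y : B) N <= _)%N.
  by apply: leq_sum => y _; rewrite leqNgt; apply/negP/hn.
by rewrite sum_nat_const mulnC.
Qed.

Lemma pigeonhole (A B : finType) (f : A -> B) :
  (#|B| < #|A|)%N -> exists x y, x != y /\ f x = f y.
Proof.
move=> h; have /pigeonhole_fiber : (1 * #|B| < #|A|)%N by rewrite mul1n.
move=> /(_ f) [y /card_gt1P[u [v [+ + uv]]]]; rewrite !inE => /eqP hu /eqP hv.
by exists u, v; rewrite hu hv.
Qed.

Lemma pigeonhole_nat (B : finType) (f : nat -> B) : exists i j, (i < j)%N /\ f i = f j.
Proof.
have [|x [y [xy e]]] := @pigeonhole 'I_#|B|.+1 B (fun i => f i); first by rewrite card_ord.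
have : (x : nat) != y by [].
by rewrite neq_ltn => /orP[h|h]; [exists x, y | exists y, x].
Qed.

Lemma qcard_fin (T : Type) (P : T -> Prop) E (I : finType) (f : I -> T) :
  (forall i, P (f i)) -> (forall i j, E (f i) (f j) -> i = j) ->
  (forall x, P x -> exists i, E x (f i)) -> qcard P E #|I|.
Proof.
move=> h1 h2 h3; exists (fun i => f (enum_val i)); split=> //.
split=> [i j /h2 /enum_val_inj //|x /h3[i hi]].
by exists (enum_rank i); rewrite enum_rankK.
Qed.

Lemma qcard_le (T : Type) (P : T -> Prop) E n1 n2 : erel P E ->
  qcard P E n1 -> qcard P E n2 -> (n1 <= n2)%N.
Proof.
move=> [_ [hs ht]] [f [fP [fi _]]] [g [gP [_ gs]]].
have /choice[h hh] : forall i, exists j, E (f i) (g j) by move=> i; apply: gs.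
suff : injective h by move/leq_card; rewrite !card_ord.
move=> i j e; apply: fi; apply: ht (hh i) _ => //.
by rewrite e; apply: hs.
Qed.

Lemma qcard_uniq (T : Type) (P : T -> Prop) E n1 n2 : erel P E ->
  qcard P E n1 -> qcard P E n2 -> n1 = n2.
Proof. by move=> h h1 h2; apply/eqP; rewrite eqn_leq !(@qcard_le _ P E). Qed.

(** [qcard] asks for an exact system of representatives, whereas pigeonhole arguments only supply
    finitely many labels. The labelling is a relation and may split a class, so among the labels
    whose chosen elements are equivalent a single one is kept. *)
Lemma qcard_color (T : Type) (P : T -> Prop) E (I : finType) (col : T -> I -> Prop) :
  erel P E -> (forall x, P x -> exists i, col x i) ->
  (forall x y i, P x -> P y -> col x i -> col y i -> E x y) ->
  exists n, qcard P E n.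
Proof.
move=> [hr [hs ht]] hc hE.
(* The empty case is set aside because labels that do not occur receive the default element [x0]. *)
case: (pselect (exists x, P x)) => [[x0 Px0]|hn]; last first.
  by exists 0%N; exists (fun i : 'I_0 => False_rect _ (notF (ltn_ord i))); split=> [[]//|];
    split=> [[]//|x Px]; case: hn; exists x.
pose good (i : I) := `[< exists x, P x /\ col x i >].
have /choice[g hg] : forall i, exists x, P x /\ (good i -> col x i).
  move=> i; case: (boolP (good i)) => [/asboolP[x [Px cx]]|]; first by exists x.
  by exists x0.
have gc x i : P x -> col x i -> E x (g i).
  move=> Px cx; have gi : good i by apply/asboolP; exists x.
  by have [Pg cg] := hg i; apply: hE cx (cg gi).
(* canonical representative: the first color in a class *)
pose ce (i j : I) := `[< E (g i) (g j) >].
pose rep i := odflt i [pick j | ce i j].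
have Pg i : P (g i) by case: (hg i).
have repE i : E (g i) (g (rep i)).
  by rewrite /rep; case: pickP => [j /asboolP|_] //=; apply: hr.
have rep_eq i j : E (g i) (g j) -> rep i = rep j.
  move=> e; rewrite /rep.
  have eqp : ce i =1 ce j.
    move=> l; apply/asboolP/asboolP => h; last exact: ht h.
    by apply: ht h => //; apply: hs.
  rewrite (eq_pick eqp); case: pickP => //= /(_ j) /asboolP; case; exact: hr.
exists #|{: {i : I | rep i == i}}|.
apply: (@qcard_fin _ _ _ _ (fun i : {i : I | rep i == i} => g (val i))) => //.
  move=> [i hi] [j hj] /= /rep_eq; rewrite (eqP hi) (eqP hj) => e.
  exact/val_inj.
move=> x Px; have [i cx] := hc x Px.
have hx := gc _ _ Px cx.
have ri : rep (rep i) == rep i by apply/eqP/esym/rep_eq.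
by exists (@exist I (fun i => rep i == i) (rep i) ri); apply: ht hx (repE i).
Qed.

(** * Embeddings of a number field *)

Section Embeddings.
Variable K : fieldExtType rat.
Notation n := (\dim (fullv : {vspace K})).
Notation QK := (map_poly (in_alg K)).
Notation QC := (map_poly (ratr : rat -> algC)).

Lemma is_emb_rmorph (f : K -> algC) :
  is_emb f -> exists g : {rmorphism K -> algC}, f = g.
Proof.
move=> [hD [hM h1]].
have h0 : f 0 = 0 by apply: (addrI (f 0)); rewrite -hD !addr0.
have hN x : f (- x) = - f x by apply: (addrI (f x)); rewrite -hD !subrr h0.
have hB : zmod_morphism f by move=> x y; rewrite hD hN.
pose Fa := GRing.isZmodMorphism.Build _ _ f hB.
pose Fm := GRing.isMonoidMorphism.Build _ _ f (h1, hM).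
pose F : {rmorphism K -> algC} := HB.pack f Fa Fm.
by exists F.
Qed.

Lemma rmorph_is_emb (g : {rmorphism K -> algC}) : is_emb g.
Proof. by split; [exact: rmorphD|split; [exact: rmorphM|exact: rmorph1]]. Qed.

Lemma emb_alg (g : {rmorphism K -> algC}) (a : rat) : g (a%:A) = ratr a.
Proof. exact: (fmorph_eq_rat (g \o in_alg K)). Qed.

Lemma embZ (g : {rmorphism K -> algC}) (a : rat) x : g (a *: x) = ratr a * g x.
Proof. by rewrite -mulr_algl rmorphM emb_alg. Qed.

Lemma emb_poly (g : {rmorphism K -> algC}) (p : {poly rat}) x :
  g (QK p).[x] = (QC p).[g x].
Proof.
rewrite -horner_map -map_poly_comp; congr horner; apply: eq_map_poly => a.
exact: emb_alg.
Qed.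

(** In characteristic 0 the extension is separable, so one element t generates K. Here p is its
    minimal polynomial, and z lists the complex roots of p: distinct by separability, and as many as
    the degree of K. *)
Lemma primitive_element_exists :
  exists (t : K) (p : {poly rat}) (z : 'I_n -> algC),
  [/\ forall x, exists q, (QK q).[t] = x,
      forall q, (QK q).[t] = 0 -> (p %| q)%R,
      (QK p).[t] = 0,
      injective z &
      forall w, root (QC p) w <-> exists i, w = z i].
Proof.
pose t := separable_generator 1%VS (fullv : {vspace K}).
have char0 : [pchar K] =i pred0 by move=> q; rewrite (@pchar_lalg _ K); apply: (pchar_num rat).
have sepK : separable 1%VS (fullv : {vspace K}).
  by apply/separableP => x _; apply: (@pcharf0_separable _ K 1%AS).
have gen : fullv = <<1; t>>%VS :> {vspace K}.
  by apply: (@eq_adjoin_separable_generator _ _ fullv%AS 1%AS); rewrite ?subvf.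
have tsep : separable_element 1%VS t by exact: (@separable_generatorP _ K fullv%AS 1%AS).
have /polyOver1P[p hp] := minPolyOver 1%AS t.
have mp : p \is monic by rewrite -(map_monic (in_alg K)) -hp monic_minPoly.
have sz : size p = n.+1.
  by rewrite -(size_map_poly (in_alg K)) -hp size_minPoly adjoin_degreeE -gen dimv1 divn1.
have sp : separable_poly p.
  by rewrite -(separable_map (in_alg K)) -hp.
have spC : separable_poly (QC p) by rewrite separable_map.
have [rs hrs] := closed_field_poly_normal (QC p).
have mC : QC p \is monic by rewrite map_monic.
rewrite (monicP mC) scale1r in hrs.
have urs : uniq rs by rewrite -separable_prod_XsubC -hrs.
have szrs : size rs = n.
  by apply: succn_inj; rewrite -(size_prod_XsubC _ id) -hrs size_map_poly sz.
exists t, p, (fun i => rs`_i); split.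
- move=> x; have : x \in <<1; t>>%VS by rewrite -gen memvf.
  by case/Fadjoin1_polyP => q ->; exists q.
- move=> q hq; rewrite -(dvdp_map (in_alg K)) -hp; apply: (@minPoly_dvdp _ _ 1%AS).
    exact: alg_polyOver.
  exact/rootP.
- by rewrite -hp minPolyxx.
- move=> i j /eqP; rewrite nth_uniq ?szrs // => /eqP; exact: val_inj.
move=> w; rewrite hrs root_prod_XsubC; split.
  move=> /(nthP 0)[i]; rewrite szrs => hi <-; by exists (Ordinal hi).
by move=> [i ->]; rewrite mem_nth ?szrs.
Qed.

(** A root z i gives the embedding that evaluates at z i any polynomial expressing x in t; this is
    well defined because p divides the difference of two such polynomials. Conversely an embedding
    is determined by the root to which it sends t. *)
Lemma embeddings_exist : exists E : 'I_n -> {rmorphism K -> algC},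
  [/\ injective (fun i => E i : K -> algC),
      forall f, is_emb f -> exists i, f = E i &
      forall v : 'I_n -> algC, (forall x, \sum_i v i * E i x = 0) -> forall i, v i = 0].
Proof.
have [t [p [z [gen min pt zinj zroot]]]] := primitive_element_exists.
have /choice[P hP] := gen.
have key q1 q2 i : (QK q1).[t] = (QK q2).[t] -> (QC q1).[z i] = (QC q2).[z i].
  move=> e; have /dvdpP[s hs] : (p %| q1 - q2)%R.
    by apply: min; rewrite rmorphB /= hornerD hornerN e subrr.
  apply/eqP; rewrite -subr_eq0 -hornerN -hornerD -rmorphB /= hs rmorphM /= hornerM.
  by have /rootP-> : root (QC p) (z i); [apply/zroot; exists i|rewrite mulr0].
have emb i : is_emb (fun x => (QC (P x)).[z i]).
  split; [|split] => [x y|x y|].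
  - rewrite -hornerD -rmorphD; apply: key.
    by rewrite rmorphD /= hornerD !hP.
  - rewrite -hornerM -rmorphM; apply: key.
    by rewrite rmorphM /= hornerM !hP.
  - apply: (etrans (y := (QC 1).[z i])); last by rewrite rmorph1 hornerC.
    by apply: key; rewrite hP rmorph1 hornerC.
have /choice[E hE] : forall i, exists g : {rmorphism K -> algC},
    (fun x => (QC (P x)).[z i]) = g.
  by move=> i; have [g hg] := is_emb_rmorph (emb i); exists g.
have Et i : E i t = z i.
  rewrite -hE; apply: (etrans (y := (QC 'X).[z i])); last by rewrite map_polyX hornerX.
  by apply: key; rewrite hP map_polyX hornerX.
exists E; split.
- by move=> i j e; apply: zinj; rewrite -!Et e.
- move=> f /is_emb_rmorph[g ->].
  have : root (QC p) (g t) by apply/rootP; rewrite -emb_poly pt rmorph0.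
  case/zroot => i gi; exists i; apply: funext => x.
  by rewrite -(hP x) !emb_poly gi Et.
move=> v hv.
(* Testing the relation on the powers of t turns it into a Vandermonde system with distinct
   nodes. *)
pose a : 'rV[algC]_n := \row_i z i.
pose V := Vandermonde n a.
have Vu : V \in unitmx.
  rewrite unitmxE det_Vandermonde unitfE; apply/prodf_neq0 => i _.
  apply/prodf_neq0 => j ij; rewrite !mxE subr_eq0; apply/eqP => /zinj e.
  by rewrite e ltnn in ij.
have : V *m (\col_i v i) = 0.
  apply/matrixP=> j k; rewrite !mxE -[RHS](hv (t ^+ j)).
  by apply: eq_bigr => i _; rewrite !mxE rmorphXn Et mulrC.
move=> /(congr1 (mulmx (invmx V))); rewrite mulKmx // mulmx0 => /matrixP e i.
by have := e i 0; rewrite !mxE.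
Qed.

Definition emb : 'I_n -> {rmorphism K -> algC} := projT1 (cid embeddings_exist).

Lemma emb_inj i j : (emb i =1 emb j) -> i = j.
Proof.
rewrite /emb; case: (cid _) => E /= [h _ _] e; exact/h/funext.
Qed.
Lemma emb_all f : is_emb f -> exists i, f = emb i.
Proof. by rewrite /emb; case: (cid _) => E /= [_ h _]; apply: h. Qed.
Lemma emb_free (v : 'I_n -> algC) :
  (forall x, \sum_i v i * emb i x = 0) -> forall i, v i = 0.
Proof. by rewrite /emb; case: (cid _) => E /= [_ _]; apply. Qed.

Lemma degree_gt0 : (0 < n)%N.
Proof. by rewrite lt0n dimv_eq0 -subv0; apply/negP => /subvP/(_ 1 (memvf _));
  rewrite memv0 oner_eq0. Qed.

(** The reference embedding for moving equations from K to [algC]. Index 0 also makes it the chosen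
    representative of its place, which is the place left out in the unit arguments. *)
Definition emb0 : 'I_n := Ordinal degree_gt0.

Lemma emb_conj_exists i : exists j, (fun x => (emb i x)^*) = emb j.
Proof.
apply: emb_all; split; [|split] => [x y|x y|]; by rewrite ?rmorphD ?rmorphM ?rmorph1.
Qed.
Definition econj i := projT1 (cid (emb_conj_exists i)).
Lemma econjE i x : emb (econj i) x = (emb i x)^*.
Proof. by rewrite /econj; case: (cid _) => j /= <-. Qed.
Lemma econjK : involutive econj.
Proof. by move=> i; apply: emb_inj => x; rewrite !econjE conjCK. Qed.
Lemma econj_real i : (econj i == i) = `[< real_emb (emb i) >].
Proof.
apply/eqP/asboolP.
  by move=> e; split=> [|x]; [exact: rmorph_is_emb|rewrite CrealE -econjE e].
by move=> [_ h]; apply: emb_inj => x; rewrite econjE; apply: conj_Creal.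
Qed.

Lemma card_emb_qcard (P : (K -> algC) -> Prop) N : (forall f, P f -> is_emb f) ->
  qcard P (fun f g => f = g) N -> N = #|[set i | `[< P (emb i) >]]|.
Proof.
move=> hP h; apply: (@qcard_uniq _ P (fun f g => f = g)) => //.
  by split=> //; split=> [x y _ _ ->|x y z _ _ _ -> ->].
set S := [set _ | _].
rewrite -card_set_sig.
apply: (@qcard_fin _ _ _ _ (fun i : {i | i \in S} => emb (val i) : K -> algC)).
- by move=> [i] /=; rewrite inE => /asboolP.
- by move=> [i hi] [j hj] /= e; apply/val_inj/emb_inj => x /=; rewrite e.
move=> f Pf; have [i fi] := emb_all (hP f Pf).
have hi : i \in S by rewrite inE; apply/asboolP; rewrite -fi.
by exists (exist _ i hi).
Qed.

(** One embedding per archimedean place: the smaller index of each conjugate pair, together with the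
    real embeddings, which are the fixed points of [econj]. *)
Definition places := [set i : 'I_n | (i <= econj i)%N].

Lemma card_places r s : qcard (@real_emb K) (fun f g => f = g) r ->
  qcard (@nonreal_emb K) (fun f g => f = g) (2 * s) -> #|places| = (r + s)%N.
Proof.
move=> /card_emb_qcard -> => [|f []//].
move=> /card_emb_qcard; move=> /(_ (fun f h => proj1 h)) hs.
pose L := [set i : 'I_n | (i < econj i)%N].
pose R := [set i : 'I_n | (econj i < i)%N].
have LR : #|L| = #|R|.
  rewrite -(card_imset L (can_inj econjK)); congr #|pred_of_set _|; apply/setP=> i.
  apply/imsetP/idP => [[j + ->]|]; rewrite !inE ?econjK // => h.
  by exists (econj i); rewrite ?inE econjK.
have dLR : [disjoint L & R].
  rewrite -setI_eq0; apply/eqP/setP => i; rewrite !inE; lia.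
have hs' : (2 * s = #|L| + #|R|)%N.
  rewrite hs -cardsUI (_ : L :&: R = set0) ?cards0 ?addn0; last by apply/eqP; rewrite setI_eq0.
  congr #|pred_of_set _|; apply/setP=> i; rewrite !inE.
  have -> : `[< nonreal_emb (emb i) >] = (econj i != i).
    rewrite econj_real -asbool_neg; apply: asbool_equiv_eq; split.
      by move=> [_ [x hx]] [_ /(_ x)]; apply/negP.
    move=> h; split; first exact: rmorph_is_emb.
    apply: contrapT => /forallNP hx; apply: h; split; first exact: rmorph_is_emb.
    by move=> x; have := hx x => /negP; rewrite negbK.
  by rewrite -val_eqE neq_ltn orbC.
have -> : s = #|L| by lia.
set S := [set _ | _].
have -> : places = S :|: L.
  by apply/setP=> i; rewrite !inE -econj_real leq_eqVlt -val_eqE eq_sym.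
rewrite -cardsUI (_ : S :&: L = set0) ?cards0 ?addn0 //.
apply/setP=> i; rewrite !inE -econj_real -val_eqE /=; lia.
Qed.

End Embeddings.

(** * Algebraic integers and orders *)

Section Integers.
Variable K : fieldExtType rat.
Notation n := (\dim (fullv : {vspace K})).
Notation E := (@emb K).

(** Polynomials are carried along E i in one direction; in the other, [minCpoly] of an element of
    [Aint] has integer coefficients and E i is injective. The ring structure of [OK] is then
    inherited from [Aint]. *)
Lemma OK_Aint (x : K) i : OK x <-> E i x \in Aint.
Proof.
split=> [[p [mp px]]|hx].
  apply: (@root_monic_Aint (map_poly (intr : int -> algC) p)).
  - have -> : map_poly (intr : int -> algC) p = map_poly (E i) (map_poly (intr : int -> K) p).
      by rewrite -map_poly_comp; apply: eq_map_poly => z /=; rewrite rmorph_int.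
    by rewrite fmorph_root; apply/rootP.
  - exact: monic_map.
  - by apply/polyOverP => j; rewrite coef_map /= intr_int.
have /floorpP[p hp] : minCpoly (E i x) \is a polyOver Num.int by [].
exists p; split.
  rewrite monicE -(inj_eq (intr_inj (R := algC))) -lead_coef_map_inj ?rmorph0 //;
    last exact: intr_inj.
  by rewrite -hp (monicP (minCpoly_monic _)).
apply: (fmorph_inj (E i)); rewrite rmorph0 -horner_map -map_poly_comp.
have -> : map_poly (E i \o intr) p = minCpoly (E i x).
  by rewrite hp; apply: eq_map_poly => z /=; rewrite rmorph_int.
exact/rootP/root_minCpoly.
Qed.

Lemma OKP (x : K) : OK x <-> E (emb0 K) x \in Aint. Proof. exact: OK_Aint. Qed.
Lemma OK_int z : OK (z%:~R : K). Proof. by apply/OKP; rewrite rmorph_int Aint_int. Qed.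
Lemma OK_nat m : OK (m%:R : K). Proof. exact: (OK_int m). Qed.
Lemma OK0 : OK (0 : K). Proof. exact: (OK_nat 0). Qed.
Lemma OK1 : OK (1 : K). Proof. exact: (OK_nat 1). Qed.
Lemma OKD (x y : K) : OK x -> OK y -> OK (x + y).
Proof. by rewrite !OKP rmorphD => hx hy; apply: rpredD. Qed.
Lemma OKN (x : K) : OK x -> OK (- x).
Proof. by rewrite !OKP rmorphN => hx; rewrite rpredN. Qed.
Lemma OKB (x y : K) : OK x -> OK y -> OK (x - y).
Proof. by move=> hx hy; apply: OKD => //; apply: OKN. Qed.
Lemma OKM (x y : K) : OK x -> OK y -> OK (x * y).
Proof. by rewrite !OKP rmorphM => hx hy; apply: rpredM. Qed.
Lemma OK_subring : subring (@OK K).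
Proof. by split; [exact: OK1|split; [exact: OKB|exact: OKM]]. Qed.

Definition nrm (x : K) : algC := \prod_i E i x.

Lemma nrmM x y : nrm (x * y) = nrm x * nrm y.
Proof. by rewrite /nrm -big_split; apply: eq_bigr => i _; rewrite /= rmorphM. Qed.
Lemma nrm1 : nrm 1 = 1.
Proof. by rewrite /nrm big1 // => i _; rewrite rmorph1. Qed.
Lemma nrm_eq0 x : (nrm x == 0) = (x == 0).
Proof.
apply/idP/idP => [|/eqP ->].
  by rewrite /nrm prodf_seq_eq0 => /hasP[i _ /=]; rewrite fmorph_eq0.
by rewrite /nrm (bigD1 (emb0 K)) //= rmorph0 mul0r.
Qed.

(* The determinant trick, in the form of a characteristic polynomial. *)
Lemma OK_of_module m (v : 'I_m -> K) (Z : 'I_m -> 'I_m -> int) (x : K) :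
  (exists i, v i != 0) ->
  (forall j, x * v j = \sum_k (Z j k)%:~R * v k) -> OK x.
Proof.
move=> [i0 hi0] hx.
pose A : 'M[int]_m := \matrix_(k, j) Z j k.
exists (char_poly A); split; first exact: char_poly_monic.
rewrite (map_char_poly (intr : {rmorphism int -> K})).
apply/rootP; rewrite -eigenvalue_root_char.
apply/eigenvalueP; exists (\row_k v k); last first.
  by apply/eqP => /rowP/(_ i0); rewrite !mxE => e; rewrite e eqxx in hi0.
by apply/rowP => j; rewrite !mxE hx; apply: eq_bigr => k _; rewrite !mxE mulrC.
Qed.

Section Basis.
Variable b : 'I_n -> K.
Hypothesis b_free : forall c : 'I_n -> rat, \sum_i c i *: b i = 0 -> forall i, c i = 0.

Let X := [tuple b i | i < n].
Lemma basis_tuple_free : free X.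
Proof.
apply/freeP => c h; apply: b_free; rewrite -[RHS]h.
by apply: eq_bigr => i _; rewrite -tnth_nth tnth_mktuple.
Qed.
Definition coordinate j x := coord X j x.
Lemma coordinateE x : x = \sum_j coordinate j x *: b j.
Proof.
have bX : basis_of fullv X.
  by rewrite basisEfree basis_tuple_free subvf size_tuple leqnn.
rewrite {1}(coord_basis bX (memvf x)).
by apply: eq_bigr => i _; rewrite -tnth_nth tnth_mktuple.
Qed.
Lemma coordinate_sum c j : coordinate j (\sum_i c i *: b i) = c j.
Proof.
rewrite -[RHS](coord_sum_free c j basis_tuple_free); congr coord.
by apply: eq_bigr => i _; rewrite -tnth_nth tnth_mktuple.
Qed.
Lemma coordinateB j x y : coordinate j (x - y) = coordinate j x - coordinate j y.
Proof. exact: linearB. Qed.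

Lemma coordinate_natM j N x : coordinate j (N%:R * x) = N%:R * coordinate j x.
Proof. by rewrite !mulr_natl; exact: linearMn. Qed.
Lemma coordinate_intM j z x : coordinate j (z%:~R * x) = z%:~R * coordinate j x.
Proof. by rewrite !mulrzl; exact: raddfMz. Qed.

Definition emb_matrix : 'M[algC]_n := \matrix_(i, j) E i (b j).
(** A row killed by this matrix is a linear relation between the embeddings on a basis, hence on all
    of K, and [emb_free] forbids it. *)
Lemma emb_matrix_unit : emb_matrix \in unitmx.
Proof.
rewrite -row_free_unit; apply: inj_row_free => v hv; apply/rowP => i; rewrite !mxE.
apply: (@emb_free K (fun i => v 0 i)) => x.
rewrite (coordinateE x); under eq_bigr do rewrite rmorph_sum mulr_sumr.
rewrite exchange_big big1 // => j _ /=.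
under eq_bigr => k _ do rewrite embZ mulrCA.
rewrite -mulr_sumr; move/rowP: hv => /(_ j); rewrite !mxE.
by under eq_bigr => k _ do rewrite mxE; move=> ->; rewrite mulr0.
Qed.

Lemma emb_coordinate i x : E i x = \sum_j ratr (coordinate j x) * E i (b j).
Proof. by rewrite {1}(coordinateE x) rmorph_sum; apply: eq_bigr => j _; rewrite embZ. Qed.

Lemma coordinate_emb j x : ratr (coordinate j x) = \sum_i invmx emb_matrix j i * E i x.
Proof.
have : (\col_i E i x) = emb_matrix *m (\col_j ratr (coordinate j x)).
  by apply/colP => i; rewrite !mxE emb_coordinate; apply: eq_bigr => k _; rewrite !mxE mulrC.
move=> /(congr1 (mulmx (invmx emb_matrix))); rewrite mulKmx ?emb_matrix_unit // => /colP/(_ j).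
by rewrite !mxE => <-; apply: eq_bigr => i _; rewrite mxE.
Qed.

Definition mulmat x : 'M[rat]_n := \matrix_(k, j) coordinate k (x * b j).
(** The embedding matrix diagonalizes multiplication by x, with the conjugates of x as eigenvalues.
    Rationality of norm and trace follows. *)
Lemma mulmatE x : diag_mx (\row_i E i x) *m emb_matrix = emb_matrix *m map_mx ratr (mulmat x).
Proof.
apply/matrixP => i j; rewrite mul_diag_mx !mxE -rmorphM emb_coordinate.
by apply: eq_bigr => k _; rewrite !mxE mulrC.
Qed.
Lemma nrm_det x : nrm x = ratr (\det (mulmat x)).
Proof.
have := congr1 determinant (mulmatE x); rewrite !det_mulmx det_diag mulrC det_map_mx.
have W0 : \det emb_matrix != 0 by rewrite -unitfE -unitmxE emb_matrix_unit.
move=> /(mulfI W0) <-; rewrite /nrm.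
by apply: eq_bigr => i _; rewrite mxE.
Qed.
Lemma trace_rat x : \sum_i E i x = ratr (\tr (mulmat x)).
Proof.
have e : diag_mx (\row_i E i x) = emb_matrix *m (map_mx ratr (mulmat x) *m invmx emb_matrix).
  by rewrite mulmxA -mulmatE mulmxK ?emb_matrix_unit.
have := congr1 mxtrace e; rewrite mxtrace_mulC mulmxKV ?emb_matrix_unit // mxtrace_diag.
rewrite trace_map_mx => <-.
by apply: eq_bigr => i _; rewrite mxE.
Qed.

End Basis.

Lemma Crat_ratr a : (ratr a : algC) \in Crat.
Proof. by apply/CratP; exists a. Qed.

Lemma basis_exists : exists b : 'I_n -> K,
  forall c : 'I_n -> rat, \sum_i c i *: b i = 0 -> forall i, c i = 0.
Proof.
exists (fun i => (vbasis (fullv : {vspace K}))`_i).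
by apply/freeP; exact: (basis_free (vbasisP _)).
Qed.

Lemma nrm_int x : OK x -> exists z : int, nrm x = z%:~R.
Proof.
move=> hx; have [b hb] := basis_exists.
apply/intrP/Cint_rat_Aint; first by rewrite (nrm_det hb) Crat_ratr.
by apply: rpred_prod => i _; apply/OK_Aint.
Qed.

(** For nonzero x the quotient is, under [emb0], the product of the conjugates of x at the other
    embeddings. *)
Lemma OK_div_nrm x z : OK x -> nrm x = z%:~R -> OK (z%:~R / x).
Proof.
move=> hx hz; have [->|x0] := eqVneq x 0; first by rewrite invr0 mulr0; exact: OK0.
apply/OKP; rewrite rmorphM fmorphV rmorph_int -hz /nrm (bigD1 (emb0 K)) //=.
rewrite mulrAC mulfV ?fmorph_eq0 // mul1r.
by apply: rpred_prod => i _; apply/OK_Aint.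
Qed.

Lemma nrm_ge1 x : OK x -> x != 0 -> 1 <= `|nrm x|.
Proof.
move=> /nrm_int[z hz]; rewrite -nrm_eq0 hz => h.
by rewrite norm_intr_ge1 // ?intr_int // -hz.
Qed.

Lemma unit_nrm x : units (@OK K) x -> `|nrm x| = 1.
Proof.
move=> [hx [/eqP x0 hi]]; apply/eqP; rewrite eq_le nrm_ge1 // andbT.
have := nrm_ge1 hi; rewrite invr_eq0 => /(_ x0) h.
have : `|nrm x| * `|nrm x^-1| = 1 by rewrite -normrM -nrmM mulfV // nrm1 normr1.
move=> e; rewrite -e -[leLHS]mulr1; apply: ler_wpM2l => //.
Qed.

(** y divides its norm and the norm divides C!, so x / y = 1 + w (C! / y). Residues modulo C! thus
    settle divisibility among all elements of norm at most C. *)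
Lemma OK_frac_of_color x y C : OK x -> OK y -> y != 0 ->
  `|nrm y| <= C%:R -> (exists w, OK w /\ x - y = (C`!)%:R * w) -> OK (x / y).
Proof.
move=> hx hy y0 hC [w [hw e]].
have [z hz] := nrm_int hy.
have z0 : z != 0 by rewrite -(intr_eq0 algC) -hz nrm_eq0.
have /dvdnP[q hq] : (`|z|%N %| C`!)%N.
  apply: dvdn_fact; rewrite absz_gt0 z0 /=.
  by rewrite hz -intr_norm -abszE -pmulrn ler_nat in hC.
have -> : x / y = 1 + w * ((C`!)%:R / y).
  by rewrite -[x](subrK y) e; field; rewrite y0.
apply: OKD; first exact: OK1.
apply: OKM => //; rewrite hq natrM -mulrA; apply: OKM; first exact: OK_nat.
rewrite pmulrn abszEsign rmorphM -mulrA rmorphXn rmorphN1.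
apply: OKM; last exact: OK_div_nrm.
by rewrite -(rmorphN1 intr) -rmorphXn; exact: OK_int.
Qed.

Lemma natK_neq0 N : (0 < N)%N -> (N%:R : K) != 0.
Proof. by move=> h; rewrite -(fmorph_eq0 (E (emb0 K))) rmorph_nat pnatr_eq0 -lt0n. Qed.

End Integers.

Section Subring.
Variables (K : fieldExtType rat) (R : kset K).
Hypothesis hR : subring R.

Lemma sr1 : R 1. Proof. by case: hR. Qed.
Lemma srB x y : R x -> R y -> R (x - y). Proof. by case: hR => _ [h _]; apply: h. Qed.
Lemma srM x y : R x -> R y -> R (x * y). Proof. by case: hR => _ [_ h]; apply: h. Qed.
Lemma sr0 : R 0. Proof. by rewrite -(subrr 1); apply: srB; exact: sr1. Qed.
Lemma srN x : R x -> R (- x). Proof. by rewrite -sub0r; apply: srB; exact: sr0. Qed.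
Lemma srD x y : R x -> R y -> R (x + y).
Proof. by move=> hx hy; rewrite -[y]opprK; apply: srB => //; apply: srN. Qed.
Lemma sr_nat m : R m%:R.
Proof. by elim: m => [|m h]; [exact: sr0|rewrite mulrS; apply: srD => //; exact: sr1]. Qed.
Lemma sr_int z : R z%:~R.
Proof. by case: z => m; [exact: sr_nat|rewrite NegzE mulrNz; apply/srN/sr_nat]. Qed.
Lemma srX x m : R x -> R (x ^+ m).
Proof. by move=> hx; elim: m => [|m h]; [exact: sr1|rewrite exprS; apply: srM]. Qed.
Lemma sr_sum (I : finType) (P : pred I) (F : I -> K) :
  (forall i, P i -> R (F i)) -> R (\sum_(i | P i) F i).
Proof. by move=> h; elim/big_ind: _ => //; [exact: sr0|exact: srD]. Qed.
End Subring.


Section Order.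
Variable K : fieldExtType rat.
Notation n := (\dim (fullv : {vspace K})).
Notation E := (@emb K).
Variables (O : kset K) (b : 'I_n -> K).
Hypothesis hO : subring O.
Hypothesis b_free : forall c : 'I_n -> rat, \sum_i c i *: b i = 0 -> forall i, c i = 0.
Hypothesis b_span : forall x, O x <-> exists z : 'I_n -> int, x = \sum_i (z i)%:~R * b i.
Let c := coordinate b.

Lemma int_comb (z : 'I_n -> int) :
  \sum_i (z i)%:~R * b i = \sum_i ((z i)%:~R : rat) *: b i.
Proof. by apply: eq_bigr => i _; rewrite mulrzl scaler_int. Qed.

Lemma O_coordinate x : O x <-> forall j, c j x \is a Num.int.
Proof.
rewrite b_span; split=> [[z ->] j|h].
  by rewrite int_comb /c coordinate_sum // intr_int.
exists (fun j => Num.floor (c j x)); rewrite int_comb {1}(coordinateE b_free x).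
by apply: eq_bigr => j _; rewrite (floorK (h j)).
Qed.

Lemma O_basis j : O (b j).
Proof.
apply/O_coordinate => i.
have -> : b j = \sum_k ((k == j)%:R : rat) *: b k.
  by rewrite (bigD1 j) //= eqxx scale1r big1 ?addr0 // => k /negPf->; rewrite scale0r.
by rewrite /c coordinate_sum // natr_int.
Qed.

Lemma O_sub_OK x : O x -> OK x.
Proof.
move=> hx.
have /choice[Z hZ] : forall j, exists z : 'I_n -> int, x * b j = \sum_i (z i)%:~R * b i.
  by move=> j; apply/b_span; apply: (srM hO) => //; exact: O_basis.
apply: (@OK_of_module K n b Z) => //.
apply: contrapT => /forallNP h; have /b_span[z] := sr1 hO; rewrite big1 => [/eqP|i _].
  by rewrite oner_eq0.
by have /negP := h i; rewrite negbK => /eqP->; rewrite mulr0.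
Qed.

Lemma clear_den x : exists D, (0 < D)%N /\ O (D%:R * x).
Proof.
pose D := (\prod_j `|denq (c j x)|)%N.
exists D; split.
  by rewrite /D; apply: prodn_gt0 => j; rewrite absz_gt0 denq_neq0.
apply/O_coordinate => j; rewrite /c coordinate_natM /D (bigD1 j) //= natrM mulrAC;
  apply: rpredM; last exact: natr_int.
rewrite pmulrn abszE gtr0_norm ?denq_gt0 // mulrC -numqE; exact: intr_int.
Qed.

(** D is the absolute discriminant of O, the square of det w up to sign. The coordinates of x arise
    from its conjugates through the inverse of w; one factor det w turns this inverse into the
    adjugate, with algebraic integer entries, and the second makes the multiplier rational. *)
Lemma order_index : exists D, (0 < D)%N /\ forall x, OK x -> O (D%:R * x).
Proof.
pose w := emb_matrix b.
have wA i j : w i j \in Aint by rewrite mxE; apply/OK_Aint/O_sub_OK/O_basis.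
have detA m (A : 'M[algC]_m) : (forall i j, A i j \in Aint) -> \det A \in Aint.
  by move=> h; apply: rpred_sum => s _; rewrite rpredMsign; apply: rpred_prod => i _.
have d0 : \det w != 0 by rewrite -unitfE -unitmxE emb_matrix_unit.
have /intrP[z hz] : \det w ^+ 2 \is a Num.int.
  apply: Cint_rat_Aint; last by apply: rpredX; exact: detA.
  (* The square is the determinant of the trace form on the basis, hence rational. *)
  have -> : \det w ^+ 2 = \det (w^T *m w) by rewrite det_mulmx det_tr expr2.
  have -> : w^T *m w = map_mx ratr (\matrix_(j, k) \tr (mulmat b (b j * b k))).
    apply/matrixP => j k; rewrite !mxE -trace_rat //.
    by apply: eq_bigr => i _; rewrite !mxE rmorphM.
  by rewrite det_map_mx Crat_ratr.
exists `|z|%N; split.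
  rewrite absz_gt0; apply: contraNneq d0 => z0.
  by rewrite -[_ == 0](expf_eq0 _ 2) hz z0.
move=> x hx.
suff h : O (z%:~R * x).
  rewrite pmulrn abszEsign rmorphM -mulrA rmorphXn rmorphN1.
  by apply: srM => //; rewrite -(rmorphN1 intr) -rmorphXn; exact: sr_int.
apply/O_coordinate => j; rewrite /c coordinate_intM.
have : ratr (z%:~R * coordinate b j x) \is a (@Num.int algC).
  apply: Cint_rat_Aint; first exact: Crat_ratr.
  rewrite rmorphM /= rmorph_int -hz (coordinate_emb b_free) expr2 -mulrA mulr_sumr.
  apply: rpredM; first exact: detA.
  apply: rpred_sum => i _; rewrite mulrA; apply: rpredM; last exact/OK_Aint.
  rewrite /invmx emb_matrix_unit // mxE mulrA mulfV // mul1r mxE /cofactor rpredMsign.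
  by apply: detA => i' j'; rewrite !mxE; apply/OK_Aint/O_sub_OK/O_basis.
case/intrP => y; rewrite -[RHS]ratr_int => /fmorph_inj ->; exact: intr_int.
Qed.

Lemma coordinate_bound : exists C : nat, (0 < C)%N /\ forall x (B : algC), (forall i,
  `|E i x| <= B) ->
  forall j, `|ratr (c j x)| <= C%:R * B :> algC.
Proof.
pose S : algC := \sum_i \sum_j `|invmx (emb_matrix b) i j|.
have S0 : 0 <= S by apply: sumr_ge0 => i _; apply: sumr_ge0.
exists (Num.bound S).+1; split=> // x B hB j.
have B0 : 0 <= B := le_trans (normr_ge0 _) (hB (emb0 K)).
apply: (@le_trans _ _ (S * B)); last first.
  apply: ler_wpM2r => //; apply: le_trans (ltW (archi_boundP S0)) _.
  by rewrite ler_nat.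
rewrite (coordinate_emb b_free); apply: le_trans (ler_norm_sum _ _ _) _.
apply: (@le_trans _ _ (\sum_k `|invmx (emb_matrix b) j k| * B)).
  by apply: ler_sum => k _; rewrite normrM ler_wpM2l.
rewrite -mulr_suml ler_wpM2r // /S [leRHS](bigD1 j) //= lerDl.
by apply: sumr_ge0 => i _; apply: sumr_ge0.
Qed.

Lemma emb_bound : exists C : nat, (0 < C)%N /\ forall x (B : algC), 
  (forall j, `|ratr (c j x)| <= B :> algC) -> forall i, `|E i x| <= C%:R * B.
Proof.
pose S : algC := \sum_i \sum_j `|E i (b j)|.
have S0 : 0 <= S by apply: sumr_ge0 => i _; apply: sumr_ge0.
exists (Num.bound S).+1; split=> // x B hB i.
have B0 : 0 <= B := le_trans (normr_ge0 _) (hB (emb0 K)).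
apply: (@le_trans _ _ (S * B)); last first.
  apply: ler_wpM2r => //; apply: le_trans (ltW (archi_boundP S0)) _.
  by rewrite ler_nat.
rewrite (emb_coordinate b_free); apply: le_trans (ler_norm_sum _ _ _) _.
apply: (@le_trans _ _ (\sum_j `|E i (b j)| * B)).
  by apply: ler_sum => k _; rewrite normrM mulrC ler_wpM2l.
rewrite -mulr_suml ler_wpM2r // /S [leRHS](bigD1 i) //= lerDl.
by apply: sumr_ge0 => ? _; apply: sumr_ge0.
Qed.

(** The label of x records the coordinates of D x modulo D N, where D O_K lies in O. Equal labels
    put D (x - y) in D N O, and D cancels. *)
Lemma OK_quotient_color (N : nat) : (0 < N)%N ->
  exists (I : finType) (col : K -> I), forall x y, OK x -> OK y -> col x = col y ->
    exists w, O w /\ x - y = N%:R * w.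
Proof.
move=> N0; have [D [D0 hD]] := order_index.
pose q j x := Num.floor (c j (D%:R * x)).
pose M := (D * N)%N.
have M0 : (0 < M)%N by rewrite muln_gt0 D0.
pose r j x : 'I_M.-1.+1 := inord `|(q j x %% M%:Z)%Z|%N.
exists {ffun 'I_n -> 'I_M.-1.+1}, (fun x => [ffun j => r j x]) => x y hx hy e.
have hq j u : OK u -> (q j u)%:~R = c j (D%:R * u).
  by move=> /hD/O_coordinate h; rewrite (floorK (h j)).
have dv j : (M%:Z %| q j x - q j y)%Z.
  rewrite -eqz_mod_dvd; have /ffunP/(_ j) := e; rewrite !ffunE => /(congr1 val) /=.
  have Mz : M%:Z != 0 by rewrite -lt0n.
  have lt z : (`|(z %% M%:Z)%Z|%N < M.-1.+1)%N.
    by rewrite prednK // -ltz_nat gez0_abs ?modz_ge0 // ltz_pmod.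
  rewrite !inordK // => /(congr1 Posz); rewrite !gez0_abs ?modz_ge0 // => ->.
  by rewrite eqxx.
have /choice[z hz] : forall j, exists z, q j x - q j y = z * M%:Z.
  by move=> j; have /dvdzP[z hz] := dv j; exists z.
exists (\sum_j (z j)%:~R * b j); split; first by apply/b_span; exists z.
apply: (mulfI (natK_neq0 K D0)); rewrite mulrA -natrM -/M.
rewrite [LHS](coordinateE b_free) int_comb mulr_sumr; apply: eq_bigr => j _.
rewrite mulrBr coordinateB -/(c j _) -/(c j _) -!hq // -rmorphB hz rmorphM.
by rewrite mulrC -scalerA [RHS]mulr_natl scaler_nat.
Qed.

Lemma inord_shift_inj (l : nat) (x y : int) : (absz x <= l)%N -> (absz y <= l)%N ->
  inord (absz (x + l%:Z)) = inord (absz (y + l%:Z)) :> 'I_(l + l).+1 -> x = y.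
Proof. by move=> h1 h2 /(congr1 val) /=; rewrite !inordK; lia. Qed.

Lemma bounded_finite (B : nat) : exists N : nat,
  forall (I : finType) (u : I -> K), injective u ->
  (forall i, OK (u i) /\ forall j, `|E j (u i)| <= B%:R) -> (#|I| <= N)%N.
Proof.
have [D [D0 hD]] := order_index; have [C [C0 hC]] := coordinate_bound.
pose L := (C * (D * B))%N.
exists #|{ffun 'I_n -> 'I_(L + L).+1}| => I u inj hu.
have hb i j : exists z : int, c j (D%:R * u i) = z%:~R /\ (`|z| <= L)%N.
  have [h1 h2] := hu i; have /O_coordinate/(_ j)/intrP[z hz] := hD _ h1.
  exists z; split=> //.
  have := hC (D%:R * u i) (D * B)%:R; rewrite -natrM -/L => h.
  have /h/(_ j) : forall k, `|E k (D%:R * u i)| <= (D * B)%:R.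
    by move=> k; rewrite rmorphM rmorph_nat normrM normr_nat natrM ler_wpM2l.
  by rewrite hz ratr_int -intr_norm -abszE -pmulrn ler_nat.
have /choice[z hz] : forall ij : I * 'I_n, exists z : int,
    c ij.2 (D%:R * u ij.1) = z%:~R /\ (`|z| <= L)%N by move=> [i j]; exact: hb.
pose f i : {ffun 'I_n -> 'I_(L + L).+1} := [ffun j => inord (absz (z (i, j) + L%:Z))].
have : injective f; last exact: leq_card.
move=> i i' /ffunP e; apply: inj.
apply: (mulfI (natK_neq0 K D0));
  rewrite (coordinateE b_free (_ * u i)) (coordinateE b_free (_ * u i')).
apply: eq_bigr => j _; congr (_ *: _).
have [h1 h2] := hz (i, j); have [h3 h4] := hz (i', j).
rewrite -/(c j _) -/(c j _) h1 h3; congr (_%:~R).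
by have := e j; rewrite !ffunE; apply: inord_shift_inj.
Qed.

End Order.

(** * Modules over a subring, and approximation modulo an ideal *)

Section Modules.
Variable K : fieldExtType rat.
Implicit Types (A B C R f m : kset K) (x y a c e : K).

Lemma kset_eq A B : kseteq A B -> A = B. Proof. by move=> h; apply/predeqP. Qed.

Lemma prod_mem A B a b : A a -> B b -> prodset A B (a * b).
Proof.
move=> ha hb; exists 1%N, (fun=> a), (fun=> b); split=> [//|].
by rewrite big_ord1.
Qed.
Lemma prod_0 A B : prodset A B 0.
Proof.
exists 0%N, (fun=> 0), (fun=> 0); split=> [[]//|].
by rewrite big_ord0.
Qed.
Lemma prod_D A B x y : prodset A B x -> prodset A B y -> prodset A B (x + y).
Proof.
move=> [n1 [a1 [b1 [h1 ->]]]] [n2 [a2 [b2 [h2 ->]]]].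
pose g T (u : 'I_n1 -> T) (v : 'I_n2 -> T) (i : 'I_(n1 + n2)) :=
  match split i with inl j => u j | inr j => v j end.
exists (n1 + n2)%N, (g K a1 a2), (g K b1 b2); split.
  by move=> i; rewrite /g; case: (split i) => j.
rewrite big_split_ord /=; congr (_ + _); apply: eq_bigr => i _.
  by rewrite /g (unsplitK (inl i)).
by rewrite /g (unsplitK (inr i)).
Qed.
Lemma prod_ind A B (P : K -> Prop) : P 0 -> (forall x y, P x -> P y -> P (x + y)) ->
  (forall a b, A a -> B b -> P (a * b)) -> forall x, prodset A B x -> P x.
Proof.
move=> h0 hD hM x [n [a [b [h ->]]]].
by elim/big_ind: _ => // i _; have [? ?] := h i; apply: hM.
Qed.

Lemma prod_sub A B A' B' : ksubset A A' -> ksubset B B' ->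
  ksubset (prodset A B) (prodset A' B').
Proof.
move=> hA hB; apply: prod_ind; [exact: prod_0|exact: prod_D|].
by move=> a b /hA ha /hB hb; apply: prod_mem.
Qed.
Lemma prodC A B : prodset A B = prodset B A.
Proof.
apply: kset_eq => x; split; move: x; apply: prod_ind;
  try exact: prod_0; try exact: prod_D; by move=> a b ha hb; rewrite mulrC; apply: prod_mem.
Qed.
Lemma prod_sub3 A B C : ksubset (prodset (prodset A B) C) (prodset A (prodset B C)).
Proof.
apply: prod_ind; [exact: prod_0|exact: prod_D|move=> x c hx hc].
move: x hx; apply: prod_ind.
- rewrite mul0r; exact: prod_0.
- by move=> x y hx hy; rewrite mulrDl; apply: prod_D.
- by move=> a b ha hb; rewrite -mulrA; apply: prod_mem => //; apply: prod_mem.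
Qed.
Lemma prodA A B C : prodset A (prodset B C) = prodset (prodset A B) C.
Proof.
apply: kset_eq => x; split; last exact: prod_sub3.
rewrite prodC (prodC B) (prodC (prodset A B)) (prodC A); exact: prod_sub3.
Qed.
Lemma prodCA A B C : prodset A (prodset B C) = prodset B (prodset A C).
Proof. by rewrite !prodA (prodC A). Qed.
Lemma prodACA A B C D :
  prodset (prodset A B) (prodset C D) = prodset (prodset A C) (prodset B D).
Proof. by rewrite -!prodA (prodCA B). Qed.

Section OverRing.
Variable R : kset K.
Hypothesis hR : subring R.
Notation module := (is_Omodule R).

Lemma mod0 A : module A -> A 0. Proof. by case. Qed.
Lemma modD A x y : module A -> A x -> A y -> A (x + y).
Proof. by case=> _ [h _]; apply: h. Qed.
Lemma modZ A a x : module A -> R a -> A x -> A (a * x).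
Proof. by case=> _ [_ h]; apply: h. Qed.
Lemma modZr A a x : module A -> R a -> A x -> A (x * a).
Proof. by rewrite mulrC; apply: modZ. Qed.
Lemma modN A x : module A -> A x -> A (- x).
Proof. by move=> hA hx; rewrite -mulN1r; apply: modZ => //; apply: srN => //; exact: sr1. Qed.
Lemma modB A x y : module A -> A x -> A y -> A (x - y).
Proof. by move=> hA hx hy; apply: modD => //; apply: modN. Qed.

Lemma mod_self : module R.
Proof. by split; [exact: sr0|split=> [x y|x y]; [exact: srD|exact: srM]]. Qed.

Lemma prod_mod A B : module A -> module (prodset A B).
Proof.
move=> hA; split; [exact: prod_0|split; first exact: prod_D].
move=> a x ha; move: x; apply: prod_ind.
- rewrite mulr0; exact: prod_0.
- by move=> x y hx hy; rewrite mulrDr; apply: prod_D.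
- by move=> x y hx hy; rewrite mulrA; apply: prod_mem => //; apply: modZ.
Qed.

Lemma prod_le A B C : module C -> (forall a b, A a -> B b -> C (a * b)) ->
  ksubset (prodset A B) C.
Proof. by move=> hC h; apply: prod_ind => //; [exact: mod0|move=> x y; exact: modD]. Qed.

Lemma prod_1l A : module A -> prodset R A = A.
Proof.
move=> hA; apply: kset_eq => x; split; first by apply: prod_le => // a b; apply: modZ.
by move=> hx; rewrite -[x]mul1r; apply: prod_mem => //; exact: sr1.
Qed.
Lemma prod_1r A : module A -> prodset A R = A.
Proof. by rewrite prodC; apply: prod_1l. Qed.

Definition scale a A : kset K := fun x => exists y, A y /\ x = a * y.

Lemma scaleP a A x : a != 0 -> scale a A x <-> A (a^-1 * x).
Proof.
move=> a0; split=> [[y [hy ->]]|h]; first by rewrite mulKf.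
by exists (a^-1 * x); rewrite mulVKf.
Qed.
Lemma scale_mod a A : module A -> module (scale a A).
Proof.
move=> hA; split; first by exists 0; rewrite mulr0; split=> //; apply: mod0.
split=> [_ _ [x [hx ->]] [y [hy ->]]|c _ hc [x [hx ->]]].
  by exists (x + y); rewrite mulrDr; split=> //; apply: modD.
by exists (c * x); rewrite mulrCA; split=> //; apply: modZ.
Qed.
Lemma scale_scale a c A : scale a (scale c A) = scale (a * c) A.
Proof.
apply: kset_eq => x; split=> [[_ [[y [hy ->]] ->]]|[y [hy ->]]].
  by exists y; rewrite mulrA.
by exists (c * y); rewrite -mulrA; split=> //; exists y.
Qed.
Lemma scale1 A : scale 1 A = A.
Proof. by apply: kset_eq => x; rewrite scaleP ?oner_eq0 // invr1 mul1r. Qed.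
Lemma scaleVK a A : a != 0 -> scale a^-1 (scale a A) = A.
Proof. by move=> a0; rewrite scale_scale mulVf // scale1. Qed.
Lemma prod_scale a A B : prodset (scale a A) B = scale a (prodset A B).
Proof.
apply: kset_eq => x; split.
  move: x; apply: prod_ind.
  - by exists 0; rewrite mulr0; split=> //; exact: prod_0.
  - by move=> _ _ [x [hx ->]] [y [hy ->]]; exists (x + y); rewrite mulrDr; split=> //;
    apply: prod_D.
  - by move=> _ y [x [hx ->]] hy; exists (x * y); rewrite mulrA; split=> //; apply: prod_mem.
move=> [y [hy ->]]; move: y hy; apply: prod_ind.
- by rewrite mulr0; exact: prod_0.
- by move=> y z hy hz; rewrite mulrDr; apply: prod_D.
- by move=> y z hy hz; rewrite mulrA; apply: prod_mem => //; exists y.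
Qed.
Lemma prod_scaler a A B : prodset A (scale a B) = scale a (prodset A B).
Proof. by rewrite prodC prod_scale prodC. Qed.

Lemma prod_principal a A : module A -> prodset (principal R a) A = scale a A.
Proof. by move=> hA; rewrite -{2}(prod_1l hA) -prod_scale. Qed.

(** Fractionality of the factors is automatic: a nonzero element of one is a common denominator for
    the other. *)
Lemma invertibleI A B : module A -> module B -> prodset A B = R -> invertible R A.
Proof.
have nz C D : module C -> prodset C D = R -> nonzero C.
  move=> hC e; apply: contrapT => h.
  have : R 1 by exact: sr1.
  rewrite -e => h1; suff : (1 : K) = 0 by apply/eqP; rewrite oner_eq0.
  move: (1 : K) h1; apply: prod_ind => // [x y -> ->|a b ha hb]; first by rewrite addr0.
  by have [->|/eqP a0] := eqVneq a 0; [rewrite mul0r|case: h; exists a].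
have fr C D : module C -> module D -> prodset C D = R -> frac_ideal R C.
  move=> hC hD e; split=> //; split; first exact: nz e.
  have [d [hd d0]] := nz D C hD (etrans (prodC _ _) e).
  by exists d; split=> // x hx; rewrite -e mulrC; apply: prod_mem.
move=> hA hB e; split; first exact: fr e.
exists B; split; first by apply: fr (etrans (prodC _ _) e).
by rewrite e.
Qed.

Lemma invertible_mod A : invertible R A -> module A. Proof. by case=> [[]]. Qed.

Lemma invertibleE A : invertible R A -> exists B, module B /\ prodset A B = R.
Proof. by move=> [_ [B [[hB _] /kset_eq e]]]; exists B. Qed.


Lemma invertible_prod A B : invertible R A -> invertible R B -> invertible R (prodset A B).
Proof.
move=> iA iB; have hA := invertible_mod iA; have hB := invertible_mod iB.
have [A' [hA' eA]] := invertibleE iA; have [B' [hB' eB]] := invertibleE iB.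
apply: (@invertibleI _ (prodset A' B')); try exact: prod_mod.
by rewrite prodACA eA eB prod_1l //; exact: mod_self.
Qed.

Lemma invertible_scale a A : a != 0 -> invertible R A -> invertible R (scale a A).
Proof.
move=> a0 iA; have hA := invertible_mod iA; have [A' [hA' eA]] := invertibleE iA.
apply: (@invertibleI _ (scale a^-1 A')); try exact: scale_mod.
by rewrite prod_scale prod_scaler scale_scale mulfV // scale1.
Qed.

Lemma invertible_1 : invertible R R.
Proof. by apply: (@invertibleI _ R); rewrite ?prod_1l //; exact: mod_self. Qed.


(** Links the colon in the coprimality condition to the inverse ideal: writing 1 as a sum of
    products b b' exhibits x as the sum of the (x b) b'. *)
Lemma colon_prod A B B' : module A -> module B -> module B' -> prodset B B' = R ->
  colon A B = prodset A B'.
Proof.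
move=> hA hB hB' e; apply: kset_eq => x; split.
  move=> h; rewrite -[x]mulr1.
  have : prodset B B' 1 by rewrite e; exact: sr1.
  move: (1 : K); apply: prod_ind.
  - rewrite mulr0; exact: prod_0.
  - by move=> y z hy hz; rewrite mulrDr; apply: prod_D.
  - by move=> y z hy hz; rewrite mulrA; apply: prod_mem => //; apply: h.
move=> hx y hy.
have : prodset (prodset A B') B (x * y) by apply: prod_mem.
by rewrite -prodA (prodC B') e prod_1r.
Qed.

Definition finquot f := exists (I : finType) (col : K -> I),
  forall x y, R x -> R y -> col x = col y -> f (x - y).

(** Modulo f the powers of x are eventually periodic, with preperiod and period at most the number
    of labels. The factorial of that number is beyond every preperiod and divisible by every period,
    so one exponent serves all x. *)
Lemma idempotent_power f : integral_ideal R f -> finquot f ->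
  exists N, (0 < N)%N /\ forall x, R x -> f (x ^+ N * x ^+ N - x ^+ N).
Proof.
move=> [hf _] [I [col hcol]].
exists #|I|`!; split; first exact: fact_gt0.
move=> x hx.
have [|i [j [ij]]] := @pigeonhole 'I_#|I|.+1 I (fun i => col (x ^+ i)).
  by rewrite card_ord.
wlog lij : i j ij / (i < j)%N.
  move=> h e; have : (i : nat) != j by [].
  by rewrite neq_ltn => /orP[l|l]; [apply: h l e|apply: h l (esym e); rewrite eq_sym].
move=> /esym/(hcol _ _ (srX hR j hx) (srX hR i hx)) hij.
have step t : f (x ^+ (i + t * (j - i)) - x ^+ i).
  elim: t => [|t IH]; first by rewrite mul0n addn0 subrr; exact: mod0.
  have -> : x ^+ (i + t.+1 * (j - i)) - x ^+ i =
     x ^+ (t * (j - i)) * (x ^+ j - x ^+ i) + (x ^+ (i + t * (j - i)) - x ^+ i).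
    rewrite mulrBr -!exprD.
    have -> : (t * (j - i) + j = i + t.+1 * (j - i))%N by rewrite mulSn; lia.
    by rewrite (addnC _ i) addrA subrK.
  by apply: modD => //; apply: modZ => //; apply: srX.
have iN : (i <= #|I|`!)%N.
  by apply: leq_trans (fact_geq _); have := ltn_ord i; rewrite ltnS.
have /dvdnP[t ht] : (j - i %| #|I|`!)%N.
  apply: dvdn_fact; rewrite subn_gt0 lij /=.
  by have := ltn_ord j; rewrite ltnS => h; apply: leq_trans h; apply: leq_subr.
have := modZ hf (srX hR (#|I|`! - i) hx) (step t).
by rewrite -ht mulrBr -!exprD addnA subnK.
Qed.

(* A and A' are inverse to each other. Modulo f, the elements x of R generated by
   products a1 c1 (a1 in A, c1 in A') are handled one at a time: e is an idempotent
   attained as a c, and 1 - e is made to kill a power of x. As 1 is a sum of such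
   products, in the end e = 1. *)
Lemma moving f m A A' a0 c0 : integral_ideal R f -> finquot f ->
  module A -> module A' -> prodset A A' = R -> module m ->
  A a0 -> A' c0 -> m (a0 * c0 - 1) ->
  exists a c, [/\ A a, A' c, prodset m A (a - a0) & f (a * c - 1)].
Proof.
move=> idf fin hA hA' hAA' hm Aa0 Ac0 m0.
have [N [N0 hN]] := idempotent_power idf fin.
have [hf fR] := idf.
have AA' a c : A a -> A' c -> R (a * c) by move=> ha hc; rewrite -hAA'; apply: prod_mem.
(* The invariant: e is idempotent modulo f and represented by a c, its complement lies in m, and a
   has moved from a0 only within m A. *)
pose state a c e := [/\ A a, A' c, R e & f (a * c - e)] /\
  [/\ f (e * e - e), m (1 - e) & prodset m A (a - a0)].
(* The new complement is a multiple of the old one, so whatever has been killed earlier stays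
   killed. *)
pose P x := R x /\ forall a c e, state a c e -> exists a' c' e' t M,
  [/\ state a' c' e', R t, 1 - e' = t * (1 - e) & f ((1 - e') * x ^+ M)].
have R1 := sr1 hR.
suff PP : forall x, prodset A A' x -> P x.
  have [|_ h] := PP 1; first by rewrite hAA'.
  (* The starting idempotent is the N-th power of a0 c0; it is 1 mod m since a0 c0 is. The surplus N
     - 1 factors go into c, so that a0 itself is unchanged. *)
  pose x0 := a0 * c0; have Rx0 : R x0 by apply: AA'.
  have st0 : state a0 (c0 * x0 ^+ N.-1) (x0 ^+ N).
    have e : a0 * (c0 * x0 ^+ N.-1) = x0 ^+ N by rewrite mulrA -/x0 -exprS prednK.
    split; split=> //.
    - by apply: modZr => //; apply: srX.
    - exact: srX.
    - by rewrite e subrr; apply: mod0.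
    - exact: hN.
    - rewrite -opprB; apply: modN => //.
      rewrite -(expr1n _ N) subrXX; apply: modZr => //.
      by apply: sr_sum => // i _; apply: srM => //; apply: srX.
    - by rewrite subrr; apply: prod_0.
  have [a [c [e [t [M [[[h1 h2 h3 h4] [h5 h6 h7]] _ _ h8]]]]]] := h _ _ _ st0.
  exists a, c; split=> //; rewrite expr1n mulr1 in h8.
  have -> : a * c - 1 = (a * c - e) - (1 - e) by ring.
  exact: modB.
apply: prod_ind.
- split; first exact: sr0.
  move=> a c e st; exists a, c, e, 1, 1%N; rewrite mul1r mulr0; split=> //; exact: mod0.
- move=> x y [Rx hx] [Ry hy]; split; first exact: srD.
  move=> a c e /hx[a1 [c1 [e1 [t1 [M1 [s1 Rt1 E1 f1]]]]]].
  have [a2 [c2 [e2 [t2 [M2 [s2 Rt2 E2 f2]]]]]] := hy _ _ _ s1.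
  exists a2, c2, e2, (t2 * t1), (M1 + M2)%N; split=> //; first exact: srM.
    by rewrite E2 E1 mulrA.
  have f1' : f ((1 - e2) * x ^+ M1) by rewrite E2 -mulrA; apply: modZ.
  (* In the binomial expansion of (x + y)^(M1 + M2) every term contains x^M1 or y^M2. *)
  rewrite exprDn mulr_sumr; elim/big_ind: _ => [|u v|i _]; [exact: mod0|exact: modD|].
  rewrite -mulr_natr mulrA; apply: modZr => //; first exact: sr_nat.
  have [hi|hi] := leqP M2 i.
    have -> : i = (M2 + (i - M2))%N :> nat by rewrite subnKC.
    rewrite [y ^+ (M2 + _)]exprD.
    rewrite [X in f X](_ : _ = (x ^+ (M1 + M2 - (M2 + (i - M2))) * y ^+ (i - M2)) *
      ((1 - e2) * y ^+ M2)); last by ring.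
    by apply: modZ => //; apply: srM => //; apply: srX.
  have -> : (M1 + M2 - i = M1 + (M2 - i))%N by rewrite addnBA // ltnW.
  rewrite exprD.
  rewrite [X in f X](_ : _ = (x ^+ (M2 - i) * y ^+ i) * ((1 - e2) * x ^+ M1)); last by ring.
  by apply: modZ => //; apply: srM => //; apply: srX.
move=> a1 c1 Aa1 Ac1; set x := a1 * c1; have Rx : R x by apply: AA'.
split=> // a c e [[Aa Ac Re h1] [h2 h3 h4]].
pose e1 := x ^+ N; pose y1 := x ^+ N.-1.
have Re1 : R e1 by apply: srX.
have Ry1 : R y1 by apply: srX.
have Re' : R (1 - e) by apply: srB.
have xy1 : x * y1 = e1 by rewrite -exprS prednK.
have he1 : f (e1 * e1 - e1) by exact: hN.
(* On the part cut out by e the old pair is kept; on the complement the pair a1, c1 is used,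
   adjusted so that its product is the idempotent x^N. The new complement is (1 - e) (1 - x^N). *)
pose a2 := e * a + (1 - e) * e1 * a1.
pose c2 := e * c + (1 - e) * y1 * c1.
pose e2 := e + (1 - e) * e1.
have E2 : 1 - e2 = (1 - e1) * (1 - e) by rewrite /e2; ring.
exists a2, c2, e2, (1 - e1), N; split=> //; last first.
- rewrite E2 -/e1.
  rewrite [X in f X](_ : _ = - (1 - e) * (e1 * e1 - e1)); last by ring.
  by apply: modZ => //; apply: srN.
- exact: srB.
- split; split.
  + by apply: modD => //; apply: modZ => //; apply: srM.
  + by apply: modD => //; apply: modZ => //; apply: srM.
  + by apply: srD => //; apply: srM.
  + have -> : a2 * c2 - e2 = (e * e) * (a * c - e) + (e + 1) * (e * e - e)
       - (y1 * (a * c1) + e1 * (a1 * c)) * (e * e - e)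
       + (1 - e) * (1 - e) * (e1 * e1 - e1) + e1 * (e * e - e).
      rewrite /a2 /c2 /e2 -xy1 /x; ring.
    have Rac1 := AA' _ _ Aa Ac1; have Ra1c := AA' _ _ Aa1 Ac.
    apply: (modD hf); last by apply: (modZ hf).
    apply: (modD hf); last by apply: (modZ hf) => //; apply: srM.
    apply: (modB hf); last by apply: (modZ hf) => //; apply: srD => //; apply: srM.
    by apply: (modD hf); apply: (modZ hf) => //; [apply: srM|apply: srD].
  + have -> : e2 * e2 - e2 = (1 - e1) * (1 - e1) * (e * e - e) + (1 - e) * (e1 * e1 - e1).
      by rewrite /e2; ring.
    by apply: modD => //; apply: modZ => //; apply: srM => //; apply: srB.
  + by rewrite E2; apply: modZ => //; apply: srB.
  + have -> : a2 - a0 = (a - a0) + (1 - e) * (e1 * a1 - a) by rewrite /a2; ring.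
    apply: prod_D => //; apply: prod_mem => //; apply: modB => //; exact: modZ.
Qed.
End OverRing.
End Modules.

(** * Finiteness of the class group *)

Section FiniteModules.
Variable K : fieldExtType rat.

Lemma OK_of_finite_module (J : finType) (v : J -> K) (Z : J -> J -> int) (x : K) :
  (exists i, v i != 0) ->
  (forall j, x * v j = \sum_k (Z j k)%:~R * v k) -> OK x.
Proof.
move=> [i0 hi0] hx.
apply: (@OK_of_module K #|J| (v \o enum_val) (fun j k => Z (enum_val j) (enum_val k))).
  by exists (enum_rank i0); rewrite /= enum_rankK.
by move=> j; rewrite /= hx (reindex _ (onW_bij _ (@enum_val_bij J))).
Qed.

(** Modulo C the matrix is the identity: the identity permutation contributes a product of factors 1
    mod C, and any other permutation moves some index and so picks up an entry in C. *)
Lemma one_sub_det (C : kset K) m (M : 'M[K]_m) : integral_ideal (@OK K) C ->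
  (forall i j, C (M i j)) -> C (1 - \det (1%:M - M)).
Proof.
move=> [hC CO] hM; have hR := OK_subring K.
have DM x y : C (1 - x) -> C (1 - y) -> C (1 - x * y).
  move=> hx hy; have -> : 1 - x * y = (1 - x) + (1 - y) - (1 - x) * (1 - y) by ring.
  by apply: (modB hR) => //; [apply: (modD hC)|apply: (modZ hC) => //; apply: CO].
have entry i j : C ((1%:M - M) i j - (i == j)%:R).
  by rewrite !mxE addrAC subrr sub0r; apply: (modN hR).
have entryO i j : OK ((1%:M - M) i j).
  rewrite -[X in OK X](subrK (i == j)%:R); apply: OKD; first exact: CO.
  exact: OK_nat.
rewrite /determinant (bigD1 (1%g : {perm 'I_m})) //= opprD addrA.
apply: (modB hR) => //.
  rewrite odd_perm1 expr0 mul1r; elim/big_ind: _ => //.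
  - by rewrite subrr; apply: (mod0 hC).
  - move=> i _; rewrite perm1 -opprB; apply: (modN hR) => //.
    by have := entry i i; rewrite eqxx.
elim/big_ind: _ => [|x y|s s1]; [exact: (mod0 hC)|exact: (modD hC)|].
apply: (modZ hC); first by apply: (srX hR); apply: (srN hR); exact: (sr1 hR).
have [i hi] : exists i, s i != i.
  apply: contrapT => /forallNP h; move/negP: s1; apply; apply/eqP/permP => i.
  by rewrite perm1; apply/eqP; have /negP := h i; rewrite negbK.
rewrite (bigD1 i) //=; apply: (modZr hC).
  by elim/big_ind: _ => [|x y|j _]; [exact: OK1|exact: OKM|exact: entryO].
by have := entry i (s i); rewrite eq_sym (negPf hi) subr0.
Qed.

End FiniteModules.

Section ClassNumber.
Variable K : fieldExtType rat.
Notation n := (\dim (fullv : {vspace K})).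
Notation E := (@emb K).
Variables (O : kset K) (b : 'I_n -> K).
Hypothesis hO : subring O.
Hypothesis b_free : forall c : 'I_n -> rat, \sum_i c i *: b i = 0 -> forall i, c i = 0.
Hypothesis b_span : forall x, O x <-> exists z : 'I_n -> int, x = \sum_i (z i)%:~R * b i.
Let hR := OK_subring K.
Let OsubOK := O_sub_OK hO b_free b_span.

Lemma nrm_le (x : K) (B : algC) : (forall i, `|E i x| <= B) -> `|nrm x| <= B ^+ n.
Proof.
move=> h; rewrite /nrm normr_prod.
apply: (@le_trans _ _ (\prod_(i < n) B)); last by rewrite prodr_const card_ord.
by apply: ler_prod => i _; rewrite normr_ge0 h.
Qed.

(** The fractional parts of the coordinates of t g, for L^n + 1 values of t, fall into L^n boxes of
    side 1 / L. A coincidence gives a difference whose conjugates are at most C / L, and L = C + 1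
    makes this less than 1. *)
Lemma hurwitz : exists M, (0 < M)%N /\ forall g : K, exists t w,
  [/\ (0 < t <= M)%N, O w & `|nrm (t%:R * g - w)| < 1].
Proof.
have [C [C0 hC]] := emb_bound b_free.
pose L := C.+1.
exists (L ^ n)%N; split; first by rewrite expn_gt0.
move=> g.
pose q (t : nat) j : rat := coordinate b j (t%:R * g).
pose fr t j : rat := q t j - (Num.floor (q t j))%:~R.
have fr_itv t j : 0 <= fr t j < 1.
  have /andP[h1] := floor_itv (q t j); rewrite rmorphD rmorph1 => h2.
  by rewrite subr_ge0 h1 ltrBlDl.
have L0 : 0 < L%:R :> rat by rewrite ltr0n.
have Lfr_ge t j : 0 <= L%:R * fr t j by rewrite mulr_ge0 // ; case/andP: (fr_itv t j).
have lt t j : (Num.truncn (L%:R * fr t j) < L)%N.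
  rewrite truncn_lt_nat // -[ltRHS]mulr1 ltr_pM2l //.
  by case/andP: (fr_itv t j).
pose f (t : 'I_(L ^ n).+1) : {ffun 'I_n -> 'I_L} := [ffun j => Ordinal (lt t j)].
have [|t1 [t2 [t12]]] := @pigeonhole _ _ f.
  by rewrite card_ord card_ffun !card_ord.
wlog l : t1 t2 t12 / (t1 < t2)%N.
  move=> h e; have : (t1 : nat) != t2 by [].
  by rewrite neq_ltn => /orP[l|l]; [apply: h l e|apply: h l (esym e); rewrite eq_sym].
move=> /ffunP e.
exists (t2 - t1)%N, (\sum_j (Num.floor (q t2 j) - Num.floor (q t1 j))%:~R * b j); split.
- rewrite subn_gt0 l /=; apply: leq_trans (leq_subr _ _) _.
  by have := ltn_ord t2; rewrite ltnS.
- by apply/b_span; eexists.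
set x := _ - _.
have hx j : `|ratr (coordinate b j x)| <= (L%:R)^-1 :> algC.
  have -> : coordinate b j x = fr t2 j - fr t1 j.
    rewrite /x coordinateB (int_comb b) coordinate_sum // natrB ?(ltnW l) // mulrBl coordinateB.
    rewrite rmorphB /fr /q; ring.
  rewrite -ratr_norm -(ratr_nat algC L) -fmorphV ler_rat.
  rewrite -[leRHS]mul1r ler_pdivlMr // -[X in _ * X]gtr0_norm // -normrM mulrC mulrBr.
  have := e j; rewrite !ffunE => /(congr1 val) /= tr.
  have /andP[h1 h2] := truncn_itv (Lfr_ge t1 j).
  have /andP[h3 h4] := truncn_itv (Lfr_ge t2 j).
  rewrite -tr -natr1 in h3 h4; rewrite -natr1 in h2.
  rewrite ler_norml; lra.
have hE i : `|E i x| <= C%:R / L%:R by apply: hC.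
apply: le_lt_trans (nrm_le hE) _.
have L0' : 0 < L%:R :> algC by rewrite ltr0n.
rewrite exprn_ilt1; first by rewrite -lt0n degree_gt0.
  by rewrite divr_ge0 // ler0n.
by rewrite ltr_pdivrMr // mul1r ltr_nat.
Qed.

Lemma frac_ideal_mod (R A : kset K) : frac_ideal R A -> is_Omodule R A.
Proof. by case. Qed.

(** Let [be] be a nonzero element of A of least norm. For x in A, [hurwitz] gives t x - w be in A of
    smaller norm, hence zero, so t clears the denominator of x / be. Scaling by M! / be therefore
    lands in O_K and sends [be] to M!. *)
Lemma class_bound : exists T, (0 < T)%N /\ forall A : kset K, frac_ideal (@OK K) A ->
  exists g, [/\ g != 0, ksubset (scale g A) (@OK K) & scale g A T%:R].
Proof.
have [M [M0 hM]] := hurwitz.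
exists M`!; split; first exact: fact_gt0.
move=> A [hA [[a0 [Aa0 /eqP a00]] [d [/eqP d0 hd]]]].
pose P k := `[< exists x, [/\ A x, x != 0 & `|nrm (d * x)| = k%:R] >].
have exP x : A x -> x != 0 -> exists k, `|nrm (d * x)| = k%:R /\ P k.
  move=> hx x0; have [z hz] := nrm_int (hd _ hx).
  exists `|z|%N; rewrite hz -intr_norm -abszE -pmulrn; split=> //.
  by apply/asboolP; exists x; split=> //; rewrite hz -intr_norm -abszE -pmulrn.
have exPk : exists k, P k by have [k [_ h]] := exP _ Aa0 a00; exists k.
case: (ex_minnP exPk) => k /asboolP[be [Abe be0 hbe]] kmin.
have key x : A x -> OK (M`!%:R / be * x).
  move=> hx; have [t [w [/andP[t0 tM] hw lt1]]] := hM (x / be).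
  have hw' : OK w by exact: (OsubOK hw).
  have Ay : A (t%:R * x - w * be).
    apply: (modB hR) => //; apply: (modZ hA) => //; exact: OK_nat.
  have [y0|y0] := eqVneq (t%:R * x - w * be) 0; last first.
    have [l [hl /kmin kl]] := exP _ Ay y0.
    have : `|nrm (d * be)| <= `|nrm (d * (t%:R * x - w * be))| by rewrite hbe hl ler_nat.
    have -> : d * (t%:R * x - w * be) = (d * be) * (t%:R * (x / be) - w).
      by field.
    rewrite [nrm (d * be * _)]nrmM normrM -[leLHS]mulr1 ler_pM2l ?normr_gt0 ?nrm_eq0 ?mulf_neq0 //.
    by move=> /(lt_le_trans lt1); rewrite ltxx.
  have /dvdnP[q ->] : (t %| M`!)%N by apply: dvdn_fact; rewrite t0.
  have -> : (q * t)%:R / be * x = q%:R * w.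
    have e : t%:R * x = w * be by apply/eqP; rewrite -subr_eq0 y0.
    by rewrite natrM -[LHS]mulrA -mulrA (mulrCA t%:R) e [be^-1 * _]mulrC mulfK.
  apply: OKM => //; exact: OK_nat.
exists (M`!%:R / be); split.
- by rewrite mulf_neq0 ?invr_eq0 // natK_neq0 // fact_gt0.
- by move=> _ [y [hy ->]]; apply: key.
- by exists be; split=> //; rewrite divfK.
Qed.

(** A scaled ideal between T O_K and O_K is recovered from the set of residues modulo T that it
    meets. The label is a relation because the scaling factor g is not canonical. *)
Lemma class_color : exists (I : finType) (col : kset K -> I -> Prop),
  (forall A, frac_ideal (@OK K) A -> exists i, col A i) /\
  (forall A B i, frac_ideal (@OK K) A -> frac_ideal (@OK K) B -> col A i -> col B i ->
     exists a, a != 0 /\ A = scale a B).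
Proof.
have [T [T0 hT]] := class_bound.
have [I [col hcol]] := OK_quotient_color hO b_free b_span T0.
pose good g A := [/\ g != 0, ksubset (scale g A) (@OK K) & scale g A T%:R].
pose cset (A : kset K) : {set I} := [set i | `[< exists x, A x /\ col x = i >]].
exists {set I}, (fun A S => exists g, good g A /\ S = cset (scale g A)); split.
  by move=> A /hT[g hg]; exists (cset (scale g A)), g.
have sub A B g h : frac_ideal (@OK K) B -> good g A -> good h B ->
    cset (scale g A) = cset (scale h B) -> ksubset (scale g A) (scale h B).
  move=> /frac_ideal_mod hB [g0 gO gT] [h0 hO' hT'] /setP e x hx.
  have := e (col x); rewrite !inE => e'.
  have : `[< exists x', scale h B x' /\ col x' = col x >].
    by rewrite -e'; apply/asboolP; exists x.
  move=> /asboolP[y [hy ey]].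
  have [w [hw exy]] := hcol x y (gO _ hx) (hO' _ hy) (esym ey).
  have hS := @scale_mod _ (@OK K) h B hB.
  rewrite -(subrK y x) exy; apply: (modD hS) => //; apply: (modZr hS) => //.
  exact: (OsubOK hw).
move=> A B S fA fB [g [hg ->]] [h [hh e]].
have eS : scale g A = scale h B.
  by apply: kset_eq => x; split; apply: sub.
case: hg hh => g0 _ _ [h0 _ _].
exists (g^-1 * h); split; first by rewrite mulf_neq0 ?invr_eq0.
by rewrite -scale_scale -eS scaleVK.
Qed.

(** After scaling, generators are one representative of each residue that occurs (0 for the others)
    and the multiples by T of the basis of O. *)
Lemma frac_ideal_generators (A : kset K) : frac_ideal (@OK K) A ->
  exists (J : finType) (v : J -> K), [/\ forall j, A (v j), exists j, v j != 0 &
    forall x, A x -> exists z : J -> int, x = \sum_j (z j)%:~R * v j].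
Proof.
have [T [T0 hT]] := class_bound.
have [I [col hcol]] := OK_quotient_color hO b_free b_span T0.
move=> fA; have [g [g0 gO gT]] := hT A fA.
have hA := frac_ideal_mod fA; have hS := @scale_mod _ (@OK K) g A hA.
have /choice[rep hrep] : forall i, exists x, scale g A x /\
    ((exists y, scale g A y /\ col y = i) -> col x = i).
  move=> i; case: (pselect (exists y, scale g A y /\ col y = i)) => [[y [hy e]]|h].
    by exists y.
  by exists 0; split=> [|//]; exact: (mod0 hS).
pose v (s : I + 'I_n) := g^-1 * match s with inl i => rep i | inr j => T%:R * b j end.
have bO j : OK (b j) by apply: OsubOK; exact: (O_basis b_free b_span).
have span x : A x -> exists z : I + 'I_n -> int, x = \sum_j (z j)%:~R * v j.
  move=> hx; have hgx : scale g A (g * x) by exists x.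
  have [h1 h2] := hrep (col (g * x)).
  have [w [/b_span[z ew] e]] := hcol (g * x) (rep (col (g * x))) (gO _ hgx) (gO _ h1)
    (esym (h2 (ex_intro _ _ (conj hgx erefl)))).
  exists (fun s => match s with inl i => (i == col (g * x))%:R | inr j => z j end).
  rewrite big_sumType /= (bigD1 (col (g * x))) //= eqxx big1; last first.
    by move=> i /negPf->; rewrite mul0r.
  apply: (mulfI g0); rewrite addr0 mul1r mulrDr mulVKf // mulr_sumr.
  rewrite -[LHS](subrK (rep (col (g * x)))) addrC e ew mulr_sumr; congr (_ + _).
  by apply: eq_bigr => j _; rewrite [in RHS]mulrCA mulVKf // mulrCA.
exists (I + 'I_n)%type, v; split=> //.
  move=> s; suff : scale g A (g * v s) by move/(scaleP _ _ g0); rewrite mulKf.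
  by rewrite /v mulVKf //; case: s => [i|j]; [case: (hrep i)|apply: (modZr hS)].
have [a [/span[z e] /eqP a0]] : nonzero A by case: fA => _ [].
apply: contrapT => /forallNP h; case/eqP: a0; rewrite e big1 // => j _.
by have /negP := h j; rewrite negbK => /eqP->; rewrite mulr0.
Qed.

Lemma frac_ideal_prod (A B : kset K) : frac_ideal (@OK K) A -> frac_ideal (@OK K) B ->
  frac_ideal (@OK K) (prodset A B).
Proof.
move=> [hA [[a [Aa a0]] [d [d0 hd]]]] [hB [[c [Bc c0]] [e [e0 he]]]].
split; first exact: prod_mod.
split; first by exists (a * c); split; [exact: prod_mem|apply/eqP; rewrite mulf_neq0 //; apply/eqP].
exists (d * e); split; first by apply/eqP; rewrite mulf_neq0 //; apply/eqP.
apply: prod_ind => [|x y|x y hx hy].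
- by rewrite mulr0; exact: OK0.
- by rewrite mulrDr; exact: OKD.
- by rewrite mulrACA; apply: OKM; [apply: hd|apply: he].
Qed.

(* Multiplication by C fixing a finitely generated A forces C = OK: integrality gives
   C inside OK, and the determinant trick gives 1 in C. *)
Lemma prod_fixed (A C : kset K) : frac_ideal (@OK K) A -> is_Omodule (@OK K) C ->
  prodset C A = A -> C = @OK K.
Proof.
move=> fA hC e; have [J [v [vA v0 vspan]]] := frac_ideal_generators fA.
have CO : ksubset C (@OK K).
  move=> x hx.
  have /choice[Z hZ] : forall j, exists z : J -> int, x * v j = \sum_k (z k)%:~R * v k.
    by move=> j; apply: vspan; rewrite -e; apply: prod_mem.
  exact: OK_of_finite_module v0 hZ.
have /choice[M hM] : forall j, exists u : J -> K, (forall k, C (u k)) /\ v j = \sum_k u k * v k.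
  move=> j; have : prodset C A (v j) by rewrite e.
  move: (v j); apply: prod_ind => [|x y [u [hu ->]] [w [hw ->]]|c x hc /vspan[z ->]].
  - exists (fun=> 0); split=> [k|]; first exact: (mod0 hC).
    by rewrite big1 // => k _; rewrite mul0r.
  - exists (fun k => u k + w k); split=> [k|]; first exact: (modD hC).
    by rewrite -big_split; apply: eq_bigr => k _; rewrite mulrDl.
  - exists (fun k => (z k)%:~R * c); split=> [k|]; first by apply: (modZ hC) => //; exact: OK_int.
    by rewrite mulr_sumr; apply: eq_bigr => k _; rewrite mulrA (mulrC c).
pose m := #|J|; pose N : 'M[K]_m := \matrix_(k, j) M (enum_val j) (enum_val k).
have det0 : \det (1%:M - N) = 0.
  apply/eqP/det0P; exists (\row_j v (enum_val j)).
    have [j hj] := v0; apply/eqP => /rowP/(_ (enum_rank j)); rewrite !mxE enum_rankK.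
    exact/eqP.
  rewrite mulmxBr mulmx1; apply/eqP; rewrite subr_eq0; apply/eqP/rowP => j.
  rewrite !mxE (hM (enum_val j)).2 (reindex _ (onW_bij _ (@enum_val_bij J))).
  by apply: eq_bigr => k _; rewrite !mxE mulrC.
have : C (1 - \det (1%:M - N)).
  by apply: one_sub_det => // i j; rewrite mxE; case: (hM (enum_val j)).
rewrite det0 subr0 => C1; apply: kset_eq => x; split; first exact: CO.
by move=> hx; rewrite -[x]mulr1; apply: (modZ hC).
Qed.

Lemma frac_ideal_OK : frac_ideal (@OK K) (@OK K).
Proof.
split; first exact: (mod_self hR).
split; first by exists 1; split; [exact: OK1|apply/eqP; rewrite oner_eq0].
by exists 1; split=> [|x]; [apply/eqP; rewrite oner_eq0|rewrite mul1r].
Qed.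

Definition ideal_power (A : kset K) i := iter i (prodset A) (@OK K).

Lemma frac_ideal_power (A : kset K) i : frac_ideal (@OK K) A ->
  frac_ideal (@OK K) (ideal_power A i).
Proof. by move=> fA; elim: i => [|i IH]; [exact: frac_ideal_OK|exact: frac_ideal_prod]. Qed.

Lemma ideal_powerD (A : kset K) i j : frac_ideal (@OK K) A ->
  ideal_power A (i + j)%N = prodset (ideal_power A i) (ideal_power A j).
Proof.
move=> fA; elim: i => [|i IH].
  by rewrite (prod_1l hR) //; exact: (frac_ideal_mod (frac_ideal_power _ fA)).
by rewrite addSn /ideal_power /= -/(ideal_power _ _) IH prodA.
Qed.

(** Two powers of A lie in one class, say A^i = a A^j with i < j. Then a A^(j - i) fixes A^i under
    multiplication, so it is O_K by [prod_fixed], which cancels without assuming invertibility. *)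
Lemma power_principal (A : kset K) : frac_ideal (@OK K) A ->
  exists N a, [/\ (0 < N)%N, a != 0 & ideal_power A N = scale a (@OK K)].
Proof.
move=> fA; have fp i := frac_ideal_power i fA.
have [I [col [ex same]]] := class_color.
have /choice[c hc] : forall i, exists k, col (ideal_power A i) k by move=> i; apply: ex.
have [i [j [ij e]]] := pigeonhole_nat c.
have [a [a0 ea]] : exists a, a != 0 /\ ideal_power A i = scale a (ideal_power A j).
  by apply: (same _ _ (c i)) => //; rewrite e.
exists (j - i)%N, a^-1; rewrite subn_gt0 ij invr_eq0; split=> //.
have <- : scale a (ideal_power A (j - i)%N) = @OK K; last by rewrite scaleVK.
apply: (@prod_fixed (ideal_power A i)) => //; first by apply: scale_mod;
  exact: (frac_ideal_mod (fp _)).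
by rewrite prod_scale -ideal_powerD // subnK ?(ltnW ij).
Qed.

Lemma frac_ideal_invertible (A : kset K) : frac_ideal (@OK K) A ->
  invertible (@OK K) A.
Proof.
move=> fA; have [[|N] [a [// _ a0 e]]] := power_principal fA.
apply: (invertibleI hR (frac_ideal_mod fA) (B := scale a^-1 (ideal_power A N))).
  by apply: scale_mod; exact: (frac_ideal_mod (frac_ideal_power _ fA)).
by rewrite prod_scaler (e : prodset A (ideal_power A N) = _) scaleVK.
Qed.

Lemma class_equivE (A B : kset K) : is_Omodule (@OK K) B ->
  class_equiv (@OK K) A B <-> exists a, a != 0 /\ A = scale a B.
Proof.
move=> hB; split=> [[a [/eqP a0 /kset_eq]]|[a [/eqP a0 ->]]].
  by rewrite (prod_principal hR) // => ->; exists a.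
by exists a; split=> //; rewrite (prod_principal hR).
Qed.

Lemma class_erel : erel (invertible (@OK K)) (class_equiv (@OK K)).
Proof.
split; [|split].
- move=> A /(invertible_mod) hA; apply/(class_equivE _ hA); exists 1.
  by rewrite oner_eq0 scale1.
- move=> A B /(invertible_mod) hA /(invertible_mod) hB /(class_equivE _ hB)[a [a0 ->]].
  apply/class_equivE; first exact: scale_mod.
  by exists a^-1; rewrite invr_eq0 scaleVK.
- move=> A B C _ /(invertible_mod) hB /(invertible_mod) hC.
  move=> /(class_equivE _ hB)[a [a0 ->]] /(class_equivE _ hC)[c [c0 ->]].
  apply/(class_equivE _ hC); exists (a * c); rewrite scale_scale mulf_neq0 //.
Qed.

Lemma class_number_finite : exists h, qcard (invertible (@OK K)) (class_equiv (@OK K)) h.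
Proof.
have [I [col [ex same]]] := class_color.
apply: (@qcard_color _ _ _ I col class_erel) => [A [fA _]|A B i [fA iA] [fB iB] cA cB].
  exact: ex.
by apply/class_equivE; [exact: frac_ideal_mod|apply: same cA cB].
Qed.

End ClassNumber.

(** * Units: upper bound for the rank *)

Section UnitGroup.
Variable K : fieldExtType rat.
Notation U := (units (@OK K)).
Lemma units1 : U 1.
Proof. by split; [exact: OK1|split; [apply/eqP; rewrite oner_eq0|rewrite invr1; exact: OK1]]. Qed.
Lemma unitsM x y : U x -> U y -> U (x * y).
Proof.
move=> [hx [/eqP x0 hx']] [hy [/eqP y0 hy']]; split; first exact: OKM.
by split; [apply/eqP; rewrite mulf_neq0|rewrite invfM; exact: OKM].
Qed.
Lemma unitsV x : U x -> U x^-1.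
Proof.
by move=> [hx [/eqP x0 hx']]; split=> //; rewrite invrK; split=> //; apply/eqP; rewrite invr_eq0.
Qed.
Lemma unitsX x m : U x -> U (x ^+ m).
Proof. by move=> h; elim: m => [|m IH]; [exact: units1|rewrite exprS; apply: unitsM]. Qed.
Lemma units_prod (I : finType) (F : I -> K) : (forall i, U (F i)) -> U (\prod_i F i).
Proof. by move=> h; elim/big_ind: _ => // [|x y]; [exact: units1|exact: unitsM]. Qed.
Lemma units_neq0 x : U x -> x != 0. Proof. by move=> [_ [/eqP]]. Qed.
End UnitGroup.

Section UnitRank.
Variable K : fieldExtType rat.
Notation n := (\dim (fullv : {vspace K})).
Notation E := (@emb K).
Notation cj := (@econj K).
Variables (O : kset K) (b : 'I_n -> K).
Hypothesis hO : subring O.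
Hypothesis b_free : forall c : 'I_n -> rat, \sum_i c i *: b i = 0 -> forall i, c i = 0.
Hypothesis b_span : forall x, O x <-> exists z : 'I_n -> int, x = \sum_i (z i)%:~R * b i.
Let OsubOK := O_sub_OK hO b_free b_span.

Lemma norm_econj i x : `|E (cj i) x| = `|E i x|.
Proof. by rewrite econjE norm_conjC. Qed.

Lemma places_rep i : i \in places K \/ cj i \in places K.
Proof. by rewrite !inE econjK; case: (leqP i (cj i)) => h; [left|right; apply: ltnW]. Qed.

Lemma emb0_place : emb0 K \in places K. Proof. by rewrite inE. Qed.

Lemma place_conj i j : i \in places K -> j \in places K -> i = cj j -> i = j.
Proof.
rewrite !inE => hi hj e; rewrite e econjK in hi; rewrite e.
by apply: val_inj; apply/eqP; rewrite eqn_leq hi hj.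
Qed.

Definition trlog (y : algC) : nat := trunc_log 2 (Num.truncn y).
Lemma trlogP (y : algC) (L : nat) : 1 <= y -> y <= 2%:R ^+ L ->
  [/\ 2%:R ^+ trlog y <= y, y < 2%:R ^+ (trlog y).+1 & (trlog y <= L)%N].
Proof.
move=> y1 yL; have y0 : 0 <= y := le_trans ler01 y1.
have t0 : (0 < Num.truncn y)%N by rewrite truncn_gt0.
have /andP[h1 h2] := trunc_log_bounds (isT : (1 < 2)%N) t0.
have /andP[h3 h4] := truncn_itv y0.
have h5 : 2%:R ^+ trlog y <= y by apply: le_trans h3; rewrite -natrX ler_nat.
split=> //; first by apply: lt_le_trans h4 _; rewrite -natrX ler_nat.
have : 2%:R ^+ trlog y <= 2%:R ^+ L :> algC := le_trans h5 yL.
by rewrite -!natrX ler_nat leq_exp2l.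
Qed.

Lemma unit_prod1 x : units (@OK K) x -> \prod_i `|E i x| = 1.
Proof. by move=> /unit_nrm; rewrite /nrm normr_prod. Qed.

(* The product formula bounds the remaining absolute value. *)
Lemma unit_last_bound x : units (@OK K) x ->
  (forall i, i != emb0 K -> i \in places K -> 2%:R^-1 <= `|E i x| <= 2%:R) ->
  forall i, `|E i x| <= (2 ^ n)%N%:R.
Proof.
move=> ux h.
have n0 := degree_gt0 K.
have one2 : 2%:R <= (2 ^ n)%N%:R :> algC.
  by rewrite ler_nat -{1}(expn1 2) leq_exp2l.
have i2 : 2%:R^-1 <= 1 :> algC by rewrite invf_le1 ?ltr0n // ler1n.
have hh i : i != emb0 K -> i != cj (emb0 K) -> 2%:R^-1 <= `|E i x| <= 2%:R.
  move=> i0 i1; have [hi|hi] := places_rep i; first exact: h.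
  rewrite -norm_econj; apply: h => //; apply: contraNneq i1 => <-.
  by rewrite econjK.
suff h0 : `|E (emb0 K) x| <= (2 ^ n)%N%:R.
  move=> i; have [->//|i0] := eqVneq i (emb0 K).
  have [->|i1] := eqVneq i (cj (emb0 K)); first by rewrite norm_econj.
  by apply: le_trans one2; case/andP: (hh i i0 i1).
set z := `|E (emb0 K) x|.
have [z1|z1] := real_leP (normr_real (E (emb0 K) x)) (@real1 algC).
  by apply: le_trans z1 _; apply: le_trans one2; rewrite ler1n.
have := unit_prod1 ux; rewrite (bigD1 (emb0 K)) //= -/z => e.
have : (2%:R^-1) ^+ n <= \prod_(i < n | i != emb0 K) `|E i x|.
  apply: (@le_trans _ _ (\prod_(i < n | i != emb0 K) 2%:R^-1)).
    rewrite prodr_const; apply: ler_wiXn2l => //; first by rewrite invr_ge0 ler0n.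
    by rewrite -[X in (_ <= X)%N](card_ord n) max_card.
  apply: ler_prod => i i0; rewrite invr_ge0 ler0n /=.
  have [->|i1] := eqVneq i (cj (emb0 K)); last by case/andP: (hh i i0 i1).
  by rewrite norm_econj; apply: le_trans i2 (ltW z1).
have z0 : 0 < z := lt_trans ltr01 z1.
rewrite -(ler_pM2l z0) e exprVn ler_pdivrMr ?exprn_gt0 ?ltr0n //.
by rewrite mul1r natrX.
Qed.

(** Suppose m is at least the number of places. Among the Q^m products with exponents below Q, more
    than Bd share their binary sizes at all places but one. Dividing them by one of their number
    gives distinct units whose conjugates are bounded, the omitted place being controlled by the
    product formula, and there are at most Bd of those. *)
Lemma units_rank_upper m (u : 'I_m -> K) :
  (forall i, units (@OK K) (u i)) -> mult_indep u -> (m <= #|places K| - 1)%N.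
Proof.
move=> hu ind; rewrite leqNgt; apply/negP => hm.
pose P1 := places K :\ emb0 K.
have cP1 : #|P1| = (#|places K| - 1)%N
  by rewrite (cardsD1 (emb0 K) (places K)) emb0_place add1n subn1.
have [Bd hBd] := bounded_finite hO b_free b_span (2 ^ n)%N.
pose S : algC := \sum_i \sum_j (`|E j (u i)| + `|E j (u i)^-1|).
have S0 : 0 <= S by apply: sumr_ge0 => i _; apply: sumr_ge0 => j _; apply: addr_ge0.
pose A := Num.bound S.
have SA : S <= 2%:R ^+ A.
  apply: le_trans (ltW (archi_boundP S0)) _.
  by rewrite -natrX ler_nat ltnW // ltn_expl.
have hA i j : `|E j (u i)| <= 2%:R ^+ A /\ `|E j (u i)^-1| <= 2%:R ^+ A.
  have : `|E j (u i)| + `|E j (u i)^-1| <= S.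
    rewrite /S (bigD1 i) //= (bigD1 j) //= -addrA lerDl addr_ge0 //.
      by apply: sumr_ge0 => *; apply: addr_ge0.
    by apply: sumr_ge0 => i' _; apply: sumr_ge0 => *; apply: addr_ge0.
  by move=> h; split; apply: le_trans SA; apply: le_trans h; rewrite ?lerDl ?lerDr.
pose t1 := #|P1|.
(* Sizes range over 2 L + 1 values with L = A m Q, and 2 L + 1 is at most (2 A m + 1) Q. This Q
   makes Bd (2 L + 1)^t1 smaller than Q^(t1 + 1). *)
pose Q := (Bd * (2 * (A * m) + 1) ^ t1).+1.
pose L := (A * m * Q)%N.
have cnt : (Bd * (2 * L + 1) ^ t1 < Q ^ m)%N.
  apply: (@leq_trans (Q ^ t1.+1)); last by rewrite leq_pexp2l // /t1 cP1.
  rewrite expnS; apply: (@leq_ltn_trans (Bd * (2 * (A * m) + 1) ^ t1 * Q ^ t1)).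
    rewrite -mulnA -expnMn leq_mul2l; apply/orP; right.
    suff h : (2 * L + 1 <= (2 * (A * m) + 1) * Q)%N by elim: (t1) => // t IH;
      rewrite !expnS leq_mul.
    by rewrite /L mulnDl mul1n mulnA leq_add2l.
  by rewrite ltn_pmul2r // expn_gt0.
pose x (e : {ffun 'I_m -> 'I_Q}) := \prod_i u i ^+ e i.
have ux e : units (@OK K) (x e) by apply: units_prod => i; apply: unitsX.
have xinj : injective x.
  move=> e e' exx; apply/ffunP => i; apply: val_inj => /=.
  have : \prod_i u i ^ ((e i)%:Z - (e' i)%:Z) = 1.
    have -> : \prod_i u i ^ ((e i)%:Z - (e' i)%:Z) = x e / x e'.
      rewrite /x -prodf_div; apply: eq_bigr => j _.
      by rewrite expfzDr ?(units_neq0 (hu j)) // -exprnN.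
    by rewrite exx mulfV // units_neq0.
  by move=> /ind/(_ i)/eqP; rewrite subr_eq0 => /eqP[].
have hx e j : `|E j (x e)| <= 2%:R ^+ L /\ `|E j (x e)^-1| <= 2%:R ^+ L.
  have powle (w : 'I_m -> K) : (forall i, `|E j (w i)| <= 2%:R ^+ A) ->
      `|E j (\prod_i w i ^+ e i)| <= 2%:R ^+ L.
    move=> hw; rewrite rmorph_prod normr_prod.
    apply: (@le_trans _ _ (\prod_(i < m) 2%:R ^+ (A * Q))).
      apply: ler_prod => i _; rewrite normr_ge0 /= rmorphXn normrX.
      apply: (@le_trans _ _ ((2%:R ^+ A) ^+ e i)).
        by apply: lerXn2r => //; rewrite nnegrE ?normr_ge0 // exprn_ge0 // ler0n.
      rewrite -exprM; apply: ler_weXn2l; first by rewrite ler1n.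
      by rewrite leq_mul2l ltnW ?orbT.
    by rewrite prodr_const card_ord -exprM /L mulnAC.
  split; first by apply: powle => i; case: (hA i j).
  rewrite /x -prodfV; under eq_bigr do rewrite -exprVn.
  by apply: powle => i; case: (hA i j).
(* The factor 2^L brings every absolute value up to at least 1, where [trlog] measures it
   faithfully. *)
pose y e j : algC := 2%:R ^+ L * `|E j (x e)|.
have y1 e j : 1 <= y e j.
  have [_] := hx e j; rewrite fmorphV normfV /y.
  by rewrite -[leLHS]mul1r ler_pdivrMr // normr_gt0 fmorph_eq0 (units_neq0 (ux e)).
have y2 e j : y e j <= 2%:R ^+ (2 * L).
  have [h _] := hx e j; rewrite mul2n -addnn exprD /y.
  by apply: ler_wpM2l => //; rewrite exprn_ge0 // ler0n.
have lt e j : (trlog (y e j) < 2 * L + 1)%N.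
  by rewrite addn1 ltnS; case: (trlogP (y1 e j) (y2 e j)).
pose f e : {ffun {j | j \in P1} -> 'I_(2 * L + 1)} := [ffun j => Ordinal (lt e (val j))].
have [|v hv] := @pigeonhole_fiber _ _ f Bd.
  by rewrite !card_ffun !card_ord card_set_sig.
have [e0 he0] : exists e0, e0 \in [set e | f e == v].
  by apply/set0Pn; rewrite -card_gt0; apply: leq_ltn_trans hv.
suff : (#|{: {e | e \in [set e | f e == v]}}| <= Bd)%N.
  by rewrite card_set_sig leqNgt hv.
apply: (hBd _ (fun e : {e | e \in [set e | f e == v]} => x (val e) / x e0)).
  move=> [e he] [e' he'] /= /(mulIf _) eq; apply/val_inj/xinj/eq.
  by rewrite invr_eq0 units_neq0.
move=> [e he] /=.
have uq : units (@OK K) (x e / x e0) by apply: unitsM => //; apply: unitsV.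
split; first by case: uq.
apply: unit_last_bound => // i i0 iP.
have iP1 : i \in P1 by rewrite in_setD1 i0.
have eqlog : trlog (y e i) = trlog (y e0 i).
  move: he he0; rewrite !inE => /eqP <- /eqP /ffunP /(_ (exist _ i iP1)).
  by rewrite !ffunE => /(congr1 val) /= ->.
have [h1 h2 _] := trlogP (y1 e i) (y2 e i).
have [h3 h4 _] := trlogP (y1 e0 i) (y2 e0 i).
rewrite eqlog in h1 h2; set k := trlog _ in h1 h2 h3 h4.
have y0pos e' : 0 < y e' i := lt_le_trans ltr01 (y1 e' i).
have -> : `|E i (x e / x e0)| = y e i / y e0 i.
  rewrite rmorphM fmorphV normrM normfV /y invfM mulrACA mulfV ?mul1r //.
  by rewrite expf_neq0 // pnatr_eq0.
rewrite exprS in h2 h4.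
apply/andP; split.
  rewrite ler_pdivlMr // ler_pdivrMl ?ltr0n //.
  by apply: le_trans (ltW h4) _; rewrite ler_pM2l ?ltr0n.
rewrite ler_pdivrMr //; apply: le_trans (ltW h2) _.
by rewrite ler_pM2l ?ltr0n.
Qed.

End UnitRank.

(** * Units: construction of independent units *)

Section UnitConstruction.
Variable K : fieldExtType rat.
Notation n := (\dim (fullv : {vspace K})).
Notation E := (@emb K).
Notation cj := (@econj K).
Variables (O : kset K) (b : 'I_n -> K).
Hypothesis hO : subring O.
Hypothesis b_free : forall c : 'I_n -> rat, \sum_i c i *: b i = 0 -> forall i, c i = 0.
Hypothesis b_span : forall x, O x <-> exists z : 'I_n -> int, x = \sum_i (z i)%:~R * b i.
Let OsubOK := O_sub_OK hO b_free b_span.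

(* One real coordinate per embedding: a conjugate pair contributes a real and an
   imaginary part. *)
Definition rcoord (i : 'I_n) (x : K) : algC :=
  if (i <= cj i)%N then 'Re (E i x) else 'Im (E i x).

Lemma rcoordB i x y : rcoord i (x - y) = rcoord i x - rcoord i y.
Proof. by rewrite /rcoord; case: ifP => _; rewrite rmorphB raddfB. Qed.

Lemma rcoord_real i x : rcoord i x \is Num.real.
Proof. by rewrite /rcoord; case: ifP => _; rewrite ?Creal_Re ?Creal_Im. Qed.

Lemma rcoord_le i x : `|rcoord i x| <= `|E i x|.
Proof.
rewrite /rcoord; case: ifP => _; first exact: (leif_normC_Re_Creal _).1.
rewrite -normrN -ReMil; apply: le_trans (leif_normC_Re_Creal _).1 _.
by rewrite normrM normCi mul1r.
Qed.

Lemma le_rcoord i x : `|E i x| <= `|rcoord i x| + `|rcoord (cj i) x|.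
Proof.
have h z : `|z| <= `|'Re z| + `|'Im z| :> algC.
  by rewrite {1}(Crect z); apply: le_trans (ler_normD _ _) _; rewrite normrM normCi mul1r.
apply: le_trans (h _) _; rewrite /rcoord econjK.
have [l|l|e] := ltngtP i (cj i).
- by rewrite econjE Im_conj normrN.
- by rewrite econjE Re_conj addrC.
have <- : i = cj i by apply: val_inj.
rewrite lerD2l.
have : E i x \is Num.real.
  by rewrite CrealE -econjE; have <- : i = cj i by apply: val_inj.
by move=> /Creal_ImP ->; rewrite normr0.
Qed.

(** Needed because the absolute value at i is controlled by the real coordinates at i and at its
    conjugate together. *)
Definition conj_closed (T : {set 'I_n}) := forall i, i \in T -> cj i \in T.

(** A form of Minkowski's theorem by pigeonhole. With M = Q^#T there are (M + 1)^n integer vectors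
    and only M^n boxes for the real coordinates on T. A coincidence gives x of size about Q^(-k0) on
    T and M elsewhere, and these cancel in the norm. *)
Lemma small_element : exists C : nat, (0 < C)%N /\
  forall (T : {set 'I_n}) (Q : nat), conj_closed T -> (0 < Q)%N -> (0 < #|~: T|)%N ->
  exists x, [/\ O x, x != 0, forall i, i \in T -> `|E i x| <= C%:R / Q%:R
    & `|nrm x| <= C%:R].
Proof.
have [C1 [C0 hC]] := emb_bound b_free.
have n0 := degree_gt0 K.
exists ((8 * C1) ^ n)%N; split; first by rewrite expn_gt0 muln_gt0 C0.
move=> T Q cT Q0; set k0 := #|~: T| => k00.
have Tk : (#|T| + k0 = n)%N by rewrite /k0 cardsC card_ord.
pose M := (Q ^ #|T|)%N.
have M0 : (0 < M)%N by rewrite expn_gt0 Q0.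
pose y (a : {ffun 'I_n -> 'I_M.+1}) := \sum_j ((a j)%:Z)%:~R * b j.
have yc a j : coordinate b j (y a) = (a j)%:R by rewrite /y int_comb coordinate_sum.
have yE a i : `|E i (y a)| <= C1%:R * M%:R.
  by apply: hC => j; rewrite yc ratr_nat normr_nat ler_nat -ltnS.
(* w is the inverse box width. The factor 4, rather than 2, keeps the scaled coordinates at most Q^n
   / 2, hence strictly below Q^n. *)
pose w : algC := Q%:R ^+ k0 / (4 * C1)%N%:R.
have w0 : 0 < w by rewrite divr_gt0 ?exprn_gt0 ?ltr0n ?muln_gt0.
pose v a i : algC := (rcoord i (y a) + C1%:R * M%:R) * w.
have v0 a i : 0 <= v a i.
  apply: mulr_ge0; last exact: ltW.
  have := le_trans (rcoord_le i (y a)) (yE a i).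
  by rewrite real_ler_norml ?rcoord_real // => /andP[h _]; rewrite -lerBlDr sub0r.
have C1R : 0 < C1%:R :> algC by rewrite ltr0n.
have MR : 0 < M%:R :> algC by rewrite ltr0n.
have QR : 0 < Q%:R :> algC by rewrite ltr0n.
have QM : Q%:R ^+ n = M%:R * Q%:R ^+ k0 :> algC by rewrite natrX -exprD Tk.
have vlt a i : v a i < (Q ^ n)%N%:R.
  have h : rcoord i (y a) + C1%:R * M%:R <= 2%:R * (C1%:R * M%:R).
    have := le_trans (rcoord_le i (y a)) (yE a i).
    by rewrite real_ler_norml ?rcoord_real // => /andP[_ h]; rewrite [leRHS]mulr_natl mulr2n lerD2r.
  apply: (@le_lt_trans _ _ (2%:R * (C1%:R * M%:R) * w)); first by rewrite ler_pM2r.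
  have -> : 2%:R * (C1%:R * M%:R) * w = Q%:R ^+ n / 2%:R.
    rewrite QM /w natrM; move: (C1%:R) (M%:R) (Q%:R ^+ k0) C1R => c1 M' q c1_gt0.
    by field; rewrite gt_eqF.
  rewrite natrX ltr_pdivrMr ?ltr0n // -[ltLHS]mulr1 ltr_pM2l ?exprn_gt0 //.
  by rewrite ltr1n.
have lt a i : (Num.truncn (v a i) < Q ^ n)%N by rewrite truncn_lt_nat.
pose f a : {ffun {i | i \in T} -> 'I_(Q ^ n)} := [ffun i => Ordinal (lt a (val i))].
have [|a1 [a2 [a12 /ffunP e]]] := @pigeonhole _ _ f.
  rewrite !card_ffun card_set_sig !card_ord -expnM mulnC expnM -/M.
  by rewrite ltn_exp2r.
pose x := y a1 - y a2.
have Ox : O x by apply: srB => //; apply/b_span; eexists.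
have x0 : x != 0.
  apply: contraNneq a12 => hx; apply/eqP/ffunP => j; apply/val_inj/eqP.
  have := congr1 (coordinate b j) (subr0_eq hx); rewrite !yc => /eqP.
  by rewrite eqr_nat.
have C8 : (8 * C1)%N%:R = 2%:R * (4 * C1)%N%:R :> algC by rewrite -natrM mulnA.
have xT i : i \in T -> `|E i x| <= (8 * C1)%N%:R / Q%:R ^+ k0.
  have half j : j \in T -> `|rcoord j x| <= (4 * C1)%N%:R / Q%:R ^+ k0.
    move=> jT; have := e (exist _ j jT); rewrite !ffunE => /(congr1 val) /= tr.
    have -> : (4 * C1)%N%:R / Q%:R ^+ k0 = w^-1 :> algC by rewrite invf_div.
    rewrite -[leRHS]mul1r ler_pdivlMr // -[X in _ * X]gtr0_norm // -normrM.
    have -> : rcoord j x * w = v a1 j - v a2 j by rewrite /v rcoordB; ring.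
    have /andP[h1 h2] := truncn_itv (v0 a1 j).
    have /andP[h3 h4] := truncn_itv (v0 a2 j).
    rewrite -tr -natr1 in h3 h4; rewrite -natr1 in h2.
    rewrite real_ler_norml; last by rewrite rpredB // ger0_real.
    set t := (Num.truncn _)%:R in h1 h2 h3 h4.
    have -> : -1 = t - (t + 1) by ring.
    have {2}-> : 1 = (t + 1) - t :> algC by ring.
    by apply/andP; split; apply: lerB => //; apply: ltW.
  move=> iT; apply: le_trans (le_rcoord _ _) _.
  by rewrite C8 -mulrA mulr_natl mulr2n; apply: lerD; apply: half => //; apply: cT.
have xE i : `|E i x| <= (8 * C1)%N%:R * M%:R.
  apply: (@le_trans _ _ (C1%:R * M%:R)); last by rewrite ler_pM2r // ler_nat leq_pmull.
  apply: hC => j; rewrite coordinateB !yc rmorphB /= !ratr_nat.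
  rewrite real_ler_norml; last by rewrite rpredB // realn.
  have leM (c : 'I_M.+1) : c%:R <= M%:R :> algC by rewrite ler_nat -ltnS.
  by apply/andP; split; [rewrite -sub0r|rewrite -[leRHS]subr0]; apply: lerB; rewrite ?ler0n.
have h8 : (8 * C1 <= (8 * C1) ^ n)%N.
  by rewrite -{1}(expn1 (8 * C1)) leq_pexp2l // muln_gt0 C0.
exists x; split=> //.
  move=> i /xT h; apply: le_trans h _.
  apply: ler_pM; rewrite ?ler0n ?invr_ge0 ?exprn_ge0 ?ler0n ?ler_nat //.
  rewrite lef_pV2 ?posrE ?exprn_gt0 // -{1}(expr1 Q%:R).
  by apply: ler_weXn2l => //; rewrite ler1n.
rewrite /nrm normr_prod (bigID (mem T)) /=.
apply: (@le_trans _ _ (((8 * C1)%N%:R / Q%:R ^+ k0) ^+ #|T| * ((8 * C1)%N%:R * M%:R) ^+ k0)).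
  have pr (P : pred 'I_n) (B : algC) : (forall i, P i -> `|E i x| <= B) ->
      \prod_(i | P i) `|E i x| <= B ^+ #|P|.
    by move=> h; rewrite -prodr_const; apply: ler_prod => i hi; rewrite normr_ge0 h.
  apply: ler_pM; rewrite ?prodr_ge0 //; first exact: pr xT.
  have -> : k0 = #|[pred i | i \notin T]| by apply: eq_card => i; rewrite !inE.
  by apply: pr => i _; apply: xE.
have -> : ((8 * C1)%N%:R / Q%:R ^+ k0) ^+ #|T| * ((8 * C1)%N%:R * M%:R) ^+ k0 =
    (8 * C1)%N%:R ^+ (#|T| + k0) * (M%:R ^+ k0 / (Q%:R ^+ k0) ^+ #|T|) :> algC.
  by rewrite expr_div_n exprMn exprD -!mulrA; congr (_ * _); rewrite mulrCA; congr (_ * _);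
    exact: mulrC.
rewrite Tk natrX -[leRHS]mulr1 ler_pM2l ?exprn_gt0 ?ltr0n ?muln_gt0 //.
by rewrite /M natrX -!exprM mulnC mulfV // expf_neq0 // gt_eqF.
Qed.

(** Iterating [small_element] gives elements of norm at most C that decrease strictly on T. Two of
    them agree modulo C!, so each divides the other and their quotient is a unit. *)
Lemma shrinking_unit (T : {set 'I_n}) : conj_closed T -> (0 < #|~: T|)%N ->
  exists u, units (@OK K) u /\ forall i, i \in T -> `|E i u| < 1.
Proof.
move=> cT k0; have [C [C0 hC]] := small_element.
pose good x := [/\ O x, x != 0 & `|nrm x| <= C%:R].
have /choice[g hg] : forall x, exists x', O x -> x != 0 ->
    good x' /\ forall i, i \in T -> `|E i x'| < `|E i x|.
  move=> x; case: (pselect (O x /\ x != 0)) => [[Ox x0]|h]; last first.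
    by exists 0 => ? ?; case: h.
  (* Any Q above S satisfies C / Q < |E i x| for every i. *)
  pose S : algC := \sum_i C%:R / `|E i x|.
  have S0 : 0 <= S by apply: sumr_ge0 => i _; rewrite divr_ge0 ?ler0n.
  have [|y [Oy y0 yT yN]] := hC T (Num.bound S).+1 cT isT; first by [].
  exists y => _ _; split=> // i /yT h; apply: le_lt_trans h _.
  have Ei : 0 < `|E i x| by rewrite normr_gt0 fmorph_eq0.
  rewrite ltr_pdivrMr ?ltr0n // mulrC -ltr_pdivrMr //.
  apply: (@le_lt_trans _ _ S).
    by rewrite /S (bigD1 i) //= lerDl; apply: sumr_ge0 => j _; rewrite divr_ge0 ?ler0n.
  by apply: lt_le_trans (archi_boundP S0) _; rewrite ler_nat.
pose a i := iter i g 1.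
have ga i : good (a i).
  elim: i => [|i [h1 h2 _]] /=; last by case: (hg _ h1 h2).
  by split; [exact: sr1|exact: oner_neq0|rewrite nrm1 normr1 ler1n].
have dec i j : i \in T -> `|E i (a j.+1)| < `|E i (a j)|.
  by move=> iT; have [h1 h2 _] := ga j; case: (hg _ h1 h2) => _; apply.
have declt i j l : i \in T -> (j < l)%N -> `|E i (a l)| < `|E i (a j)|.
  move=> iT; elim: l => // l IH; rewrite ltnS leq_eqVlt => /orP[/eqP->|/IH h]; first exact: dec.
  exact: lt_trans (dec i l iT) h.
have [I [col hcol]] := OK_quotient_color hO b_free b_span (fact_gt0 C).
have [i [j [ij e]]] := pigeonhole_nat (fun i => col (a i)).
have [Oi i0 Ni] := ga i; have [Oj j0 Nj] := ga j.
have quo p q : good (a p) -> good (a q) -> col (a p) = col (a q) -> OK (a p / a q).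
  move=> [/OsubOK h1 h2 h3] [/OsubOK h4 h5 h6] h; apply: (OK_frac_of_color h1 h4 h5 h6).
  by have [w [/OsubOK Ow ew]] := hcol _ _ h1 h4 h; exists w.
exists (a j / a i); split.
  split; first exact: quo.
  by rewrite invf_div; split; [apply/eqP; rewrite mulf_neq0 ?invr_eq0|apply: quo].
move=> l lT; rewrite rmorphM fmorphV normrM normfV ltr_pdivrMr ?mul1r ?normr_gt0 ?fmorph_eq0 //.
exact: declt.
Qed.

(** The unit u k is small away from the place p k, so by the product formula it is large there. In a
    relation with some positive exponent, the product of absolute values over the places with
    positive exponents exceeds 1, a contradiction. *)
Lemma units_rank_lower : exists u : 'I_(#|places K| - 1) -> K,
  (forall i, units (@OK K) (u i)) /\ mult_indep u.
Proof.
pose P1 := places K :\ emb0 K.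
have cP1 : #|P1| = (#|places K| - 1)%N.
  by rewrite (cardsD1 (emb0 K) (places K)) emb0_place add1n subn1.
rewrite -cP1; pose p (k : 'I_#|P1|) : 'I_n := enum_val k.
have pP k : p k \in places K by have := enum_valP k; rewrite in_setD1 => /andP[].
have p0 k : p k != emb0 K by have := enum_valP k; rewrite in_setD1 => /andP[].
have pinj : injective p by exact: enum_val_inj.
have /choice[u hu] : forall k, exists u, units (@OK K) u /\
    forall i, i != p k -> i != cj (p k) -> `|E i u| < 1.
  move=> k; have [|| u [hu h]] := @shrinking_unit (~: [set p k; cj (p k)]).
  - move=> i; rewrite !inE !negb_or => /andP[h1 h2]; apply/andP; split.
      by apply: contraNneq h2 => <-; rewrite econjK.
    by rewrite (can_eq (@econjK K)).
  - by rewrite setCK card_gt0; apply/set0Pn; exists (p k); rewrite !inE eqxx.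
  by exists u; split=> // i h1 h2; apply: h; rewrite !inE negb_or h1.
exists u; split=> [i|]; first by case: (hu i).
have u0 k : u k != 0 by apply: units_neq0; case: (hu k).
(* Inverting a relation negates its exponents, so excluding positive ones is enough. *)
suff pos e : \prod_i u i ^ e i = 1 -> forall k, e k <= 0.
  move=> e he k; apply/eqP; rewrite eq_le pos // andTb -oppr_le0.
  apply: (pos (fun i => - e i)).
  transitivity (\prod_i u i ^ e i)^-1; last by rewrite he invr1.
  by rewrite -prodfV; apply: eq_bigr => i _; rewrite invr_expz.
move=> he k1; rewrite leNgt; apply/negP => ek1.
pose P := [set i | [exists k, (0 < e k) && ((i == p k) || (i == cj (p k)))]].
have inP i : reflect (exists k, 0 < e k /\ (i = p k \/ i = cj (p k))) (i \in P).
  rewrite inE; apply: (iffP existsP) => [[k /andP[h /orP[/eqP h'|/eqP h']]]|[k [h [h'|h']]]].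
  - by exists k; split=> //; left.
  - by exists k; split=> //; right.
  - by exists k; rewrite h h' eqxx.
  - by exists k; rewrite h h' eqxx orbT.
pose N x : algC := \prod_(i in P) `|E i x|.
have NM x y : N (x * y) = N x * N y.
  by rewrite /N -big_split; apply: eq_bigr => i _; rewrite /= rmorphM normrM.
have N1 : N 1 = 1 by rewrite /N big1 // => i _; rewrite rmorph1 normr1.
have Ngt0 x : x != 0 -> 0 < N x.
  by move=> x0; apply: prodr_gt0 => i _; rewrite normr_gt0 fmorph_eq0.
have NX x m : N (x ^+ m) = N x ^+ m.
  by elim: m => [|m IH]; [rewrite N1|rewrite !exprS NM IH].
have Nlt1 (S : {set 'I_n}) x (j : 'I_n) : j \in S -> (forall i, i \in S -> `|E i x| < 1) ->
    \prod_(i in S) `|E i x| < 1.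
  move=> jS h; rewrite (bigD1 j) //=; apply: le_lt_trans (h j jS).
  rewrite -[leRHS]mulr1 ler_wpM2l //.
  by apply: prodr_ile1 => i /andP[iS _]; rewrite normr_ge0 ltW ?h.
(* For a positive exponent the complement of P carries only absolute values below 1, and it is
   nonempty since it contains [emb0]; P must therefore carry a product above 1. *)
have big k : 0 < e k -> 1 < N (u k).
  move=> ek; have [uk hk] := hu k.
  have := unit_prod1 uk; rewrite (bigID (mem P)) /= -/(N _) => e1.
  have lt1 : \prod_(i in ~: P) `|E i (u k)| < 1.
    apply: (Nlt1 _ _ (emb0 K)).
      rewrite in_setC; apply/negP => /inP[k' [_ [h|h]]]; first by move/eqP: (p0 k'); rewrite -h.
      by move/eqP: (p0 k'); apply; apply: esym; exact: (place_conj (emb0_place K) (pP k') h).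
    move=> i; rewrite in_setC => hi; apply: hk; apply: contraNneq hi => ->; apply/inP; exists k.
      by split=> //; left.
    by split=> //; right.
  rewrite (eq_bigl (fun i => i \in ~: P)) in e1; last by move=> i; rewrite in_setC.
  rewrite -e1 -[ltRHS]mulr1 ltr_pM2l //; exact: Ngt0 (u0 k).
(* For a nonpositive exponent p k and its conjugate lie outside P, so every factor over P is below
   1. *)
have small k : e k <= 0 -> N (u k) < 1.
  move=> ek; have [uk hk] := hu k; apply: (Nlt1 _ _ (p k1)).
    by apply/inP; exists k1; split=> //; left.
  move=> i /inP[k' [ek' ik']].
  have kk' : k != k' by apply: contraTneq ek => ->; rewrite -ltNge.
  have pk : p k' <> p k by move=> /pinj h; rewrite h eqxx in kk'.
  apply: hk; apply/eqP => h; apply: pk; rewrite h in ik'.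
    by case: ik' => [//|ik']; rewrite (place_conj (pP k) (pP k') ik').
  case: ik' => [ik'|/(can_inj (@econjK K)) //].
  by rewrite (place_conj (pP k') (pP k) (esym ik')).
have NZ k : 1 <= N (u k ^ e k) /\ (0 < e k -> 1 < N (u k ^ e k)).
  have [ek|ek] := leP (e k) 0; last first.
    have h := big k ek; case: (e k) ek => // m m0.
    rewrite -exprnP NX; split=> [|_]; first by rewrite exprn_ege1 // ltW.
    by rewrite exprn_egt1 // -lt0n.
  split=> //; have h := small k ek; case: (e k) ek => [m|m _].
    by case: m => // _; rewrite expr0z N1.
  have -> : N (u k ^ Negz m) = (N (u k) ^+ m.+1)^-1.
    have x0 : N (u k) ^+ m.+1 != 0 by rewrite expf_neq0 // gt_eqF // Ngt0 ?u0.
    apply: (mulIf x0).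
    rewrite (mulVf x0).
    rewrite -NX -NM NegzE -exprnN.
    by rewrite mulVf ?N1 // expf_neq0 ?u0.
  by rewrite invf_ge1 ?exprn_gt0 ?Ngt0 ?u0 // exprn_ile1 // ltW // Ngt0 ?u0.
have : N (\prod_i u i ^ e i) = \prod_i N (u i ^ e i).
  by apply: (big_morph N NM N1).
rewrite he N1 (bigD1 k1) //= => h.
have : 1 < N (u k1 ^ e k1) * \prod_(i < #|P1| | i != k1) N (u i ^ e i).
  have [_ /(_ ek1) h1] := NZ k1; apply: lt_le_trans h1 _.
  rewrite -[leLHS]mulr1 ler_pM2l; last by apply: Ngt0; rewrite expfz_eq0 negb_and u0 orbT.
  elim/big_ind: _ => // [p1 p2 h2 h3|i _]; last by case: (NZ i).
  by rewrite -[1]mul1r; apply: ler_pM; rewrite ?ler01.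
by rewrite -h ltxx.
Qed.

End UnitConstruction.

(** * Indices of multiplicative groups *)

Lemma qcard_adjust (T : Type) (P Q : T -> Prop) E n : erel P E -> qcard P E n ->
  (forall x, P x -> exists y, [/\ P y, Q y & E x y]) ->
  exists f : 'I_n -> T, [/\ forall i, P (f i), forall i, Q (f i),
    forall i j, E (f i) (f j) -> i = j & forall x, P x -> exists i, E x (f i)].
Proof.
move=> [hr [hs ht]] [f [fP [fi fs]]] hQ.
have /choice[g hg] : forall i, exists y, [/\ P y, Q y & E (f i) y] by move=> i; apply: hQ.
have Pg i : P (g i) by case: (hg i).
have Eg i : E (f i) (g i) by case: (hg i).
exists g; split=> // [i|i j e|x Px]; first by case: (hg i).
  apply: fi; apply: (ht _ (g i)) => //; apply: (ht _ (g j)) => //; exact: hs.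
by have [i e] := fs x Px; exists i; apply: ht e (Eg i).
Qed.

Lemma qcard_coarsen (T : Type) (P P' : T -> Prop) (E E' : T -> T -> Prop) n :
  erel P E -> erel P' E' -> qcard P E n -> (forall x, P' x -> P x) ->
  (forall x y, P' x -> P' y -> E x y -> E' x y) -> exists n', qcard P' E' n'.
Proof.
move=> [hr [hs ht]] he' [f [fP [_ fs]]] hP hE.
apply: (@qcard_color _ P' E' 'I_n (fun x i => E x (f i)) he') => [x /hP /fs //|x y i Px Py ex ey].
by apply: hE => //; apply: ht ex (hs _ _ _ _ ey) => //; apply: hP.
Qed.

Section MultiplicativeGroups.
Variable K : fieldExtType rat.

Definition mgroup (G : kset K) :=
  (forall x, G x -> x != 0) /\ G 1 /\ (forall x y, G x -> G y -> G (x / y)).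

Section Group.
Variable G : kset K.
Hypothesis hG : mgroup G.
Lemma mg_neq0 x : G x -> x != 0. Proof. by case: hG => h _; apply: h. Qed.
Lemma mg1 : G 1. Proof. by case: hG => _ []. Qed.
Lemma mg_div x y : G x -> G y -> G (x / y). Proof. by case: hG => _ [_ h]; apply: h. Qed.
Lemma mgV x : G x -> G x^-1. Proof. by rewrite -[x^-1]mul1r; apply: mg_div; exact: mg1. Qed.
Lemma mgM x y : G x -> G y -> G (x * y).
Proof. by move=> hx /mgV hy; rewrite -[y]invrK; apply: mg_div. Qed.
End Group.

Lemma mgroup_erel (G H : kset K) : (forall x, G x -> x != 0) -> mgroup H ->
  erel G (fun x y => H (x / y)).
Proof.
move=> G0 hH; split; [|split].
- by move=> x /G0 x0; rewrite mulfV //; exact: mg1.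
- by move=> x y _ _ /(mgV hH); rewrite invf_div.
- move=> x y z _ /G0 y0 _ h1 h2; have := mgM hH h1 h2.
  by rewrite mulrA divfK.
Qed.

Lemma qcard_tower (G H1 H2 : kset K) n1 n2 : mgroup G -> mgroup H1 -> mgroup H2 ->
  ksubset H1 G -> ksubset H2 H1 ->
  qcard G (fun x y => H1 (x / y)) n1 -> qcard H1 (fun x y => H2 (x / y)) n2 ->
  qcard G (fun x y => H2 (x / y)) (n1 * n2).
Proof.
move=> hG h1 h2 s1 s2 [g [gG [gi gs]]] [h [hH [hi hs]]].
have -> : (n1 * n2)%N = #|{: 'I_n1 * 'I_n2}| by rewrite card_prod !card_ord.
have g0 i : g i != 0 by apply: (mg_neq0 hG).
have h0 i : h i != 0 by apply: (mg_neq0 h1).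
apply: (@qcard_fin _ _ _ _ (fun ij : 'I_n1 * 'I_n2 => g ij.1 * h ij.2)) => /=.
- by move=> ij; apply: (mgM hG) => //; apply: s1.
- move=> [i j] [i' j'] /= e.
  have ii : i = i'.
    apply: gi; have -> : g i / g i' = (g i * h j / (g i' * h j')) / (h j / h j').
      by field; rewrite !h0 g0.
    by apply: (mg_div h1); [exact: s2|exact: (mg_div h1)].
  rewrite -ii in e *; congr pair; apply: hi.
  suff <- : g i * h j / (g i * h j') = h j / h j' by [].
  by field; rewrite h0 g0.
move=> x Gx; have [i hxi] := gs x Gx; have [j hj] := hs _ hxi.
by exists (i, j); rewrite /= invfM mulrA.
Qed.

(** Nonvanishing is required of numerator and denominator because S may contain 0: [onep f] does
    when f is all of O_K. *)
Definition quot (S : kset K) : kset K := fun x =>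
  exists z w, [/\ S z, S w, z != 0, w != 0 & x = z / w].

Lemma quot_in (S : kset K) x : S 1 -> S x -> x != 0 -> quot S x.
Proof. by move=> S1 Sx x0; exists x, 1; rewrite oner_neq0 divr1. Qed.

Lemma quot_mgroup (S : kset K) : S 1 -> (forall x y, S x -> S y -> S (x * y)) ->
  mgroup (quot S).
Proof.
move=> S1 SM; split; [|split].
- by move=> x [z [w [_ _ z0 w0 ->]]]; rewrite mulf_neq0 ?invr_eq0.
- by apply: quot_in; rewrite ?oner_neq0.
- move=> x y [z [w [Sz Sw z0 w0 ->]]] [z' [w' [Sz' Sw' z0' w0' ->]]].
  exists (z * w'), (w * z'); split; try exact: SM; try exact: mulf_neq0.
  by rewrite invf_div mulrACA -invfM.
Qed.

Lemma quot_sub (S S' : kset K) : ksubset S S' -> ksubset (quot S) (quot S').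
Proof. by move=> h x [z [w [/h ? /h ? ? ? ?]]]; exists z, w. Qed.

Lemma mgroupI (G : kset K) (P : kset K) : mgroup G -> P 1 ->
  (forall x y, x != 0 -> y != 0 -> P x -> P y -> P (x / y)) -> mgroup (fun x => G x /\ P x).
Proof.
move=> hG P1 PM; split; [|split].
- by move=> x [/(mg_neq0 hG)].
- by split=> //; exact: mg1.
- move=> x y [gx px] [gy py]; split; first exact: mg_div.
  by apply: PM => //; apply: (mg_neq0 hG).
Qed.
End MultiplicativeGroups.

(** * Positivity at real embeddings and its adjustment by large integers *)

Section Positivity.
Variable K : fieldExtType rat.
Variables (j : nat) (sg : 'I_j -> K -> algC).
Hypothesis sg_real : forall i, real_emb (sg i).

Lemma sgE i : exists g : {rmorphism K -> algC}, sg i = g.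
Proof. by apply: is_emb_rmorph; case: (sg_real i). Qed.

Lemma sg_Creal i x : sg i x \is Num.real. Proof. by case: (sg_real i). Qed.

Lemma pos1 : positive_at sg 1.
Proof. by move=> i; have [g ->] := sgE i; rewrite rmorph1 ltr01. Qed.
Lemma pos_div x y : positive_at sg x -> positive_at sg y -> positive_at sg (x / y).
Proof.
move=> hx hy i; have := hx i; have := hy i; have [g ->] := sgE i.
by rewrite fmorph_div => *; apply: divr_gt0.
Qed.
Lemma pos_sqr x : x != 0 -> positive_at sg (x ^+ 2).
Proof.
move=> x0 i; have := sg_Creal i x; have [g ->] := sgE i => xr.
by rewrite rmorphXn /= real_exprn_even_gt0 //= fmorph_eq0.
Qed.
Lemma pos_mgroup (G : kset K) : mgroup G -> mgroup (fun x => G x /\ positive_at sg x).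
Proof.
by move=> hG; apply: mgroupI => // [|x y _ _]; [exact: pos1|exact: pos_div].
Qed.

(** With N in f, the shift makes x nonzero and positive without changing it modulo f. The term at
    [emb0] secures nonvanishing even when no sign is prescribed. *)
Lemma large_shift x : exists t : nat, forall N, (0 < N)%N ->
  x + (N * t)%N%:R != 0 /\ positive_at sg (x + (N * t)%N%:R).
Proof.
pose S : algC := `|emb (emb0 K) x| + \sum_i `|sg i x|.
have S0 : 0 <= S by rewrite addr_ge0 // sumr_ge0.
have hS := archi_boundP S0; set t := Num.bound S in hS.
exists t => N N0.
have tN : t%:R <= (N * t)%N%:R :> algC by rewrite ler_nat leq_pmull.
split.
  apply/eqP => /(congr1 (emb (emb0 K))) /eqP; rewrite rmorphD rmorph_nat rmorph0 addr_eq0.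
  move=> /eqP e; have : `|emb (emb0 K) x| < t%:R.
    by apply: le_lt_trans hS; rewrite lerDl sumr_ge0.
  by rewrite e normrN normr_nat => /lt_le_trans/(_ tN); rewrite ltxx.
move=> i; have [g hg] := sgE i; have xr := sg_Creal i x; rewrite hg in xr *.
rewrite rmorphD rmorph_nat /= -[X in _ < X]opprK opprD oppr_gt0 subr_lt0.
apply: le_lt_trans (_ : `|g x| < _).
  by rewrite -normrN; apply: real_ler_norm; rewrite rpredN.
apply: lt_le_trans tN; apply: le_lt_trans hS.
rewrite /S (bigD1 i) //= hg addrCA lerDl addr_ge0 // sumr_ge0 //.
Qed.
End Positivity.

(** * Independence of the signs at distinct real embeddings *)

Section SignPatterns.
Variable K : fieldExtType rat.
Variables (k : nat) (sig : 'I_k -> K -> algC).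
Hypothesis sig_real : forall i, real_emb (sig i).
Hypothesis sig_inj : injective sig.

(** A large multiple N t of a generator has conjugates more than 2 apart from the one at i0. With z
    the integer part of the latter, N t - z is in [0, 1) at i0 and exceeds 1 in absolute value
    elsewhere; squaring and subtracting 1 gives the signs. *)
Lemma single_negative i0 : exists y, sig i0 y < 0 /\ forall i, i != i0 -> 0 < sig i y.
Proof.
have [t [_ [_ [gen _ _ _ _]]]] := primitive_element_exists K.
have sep i j : sig i t = sig j t -> i = j.
  move=> e; apply: sig_inj; apply: funext => x; have [q <-] := gen x.
  have [g hg] := sgE sig_real i; have [g' hg'] := sgE sig_real j.
  by rewrite hg hg' in e *; rewrite !emb_poly e.
pose S : algC := \sum_i 2%:R / `|sig i t - sig i0 t|.
have S0 : 0 <= S by apply: sumr_ge0 => i _; rewrite divr_ge0 ?ler0n.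
pose N := (Num.bound S).+1.
have NS : S < N%:R by apply: lt_trans (archi_boundP S0) _; rewrite ltr_nat.
pose z := Num.floor (N%:R * sig i0 t).
have Nr i : N%:R * sig i t \is Num.real by rewrite rpredM ?realn // sg_Creal.
have /andP[z1 z2] := real_floor_itv (Nr i0).
rewrite rmorphD rmorph1 /= -/z in z1 z2.
exists ((N%:R * t - z%:~R) ^+ 2 - 1).
have hy i : sig i ((N%:R * t - z%:~R) ^+ 2 - 1) = (N%:R * sig i t - z%:~R) ^+ 2 - 1.
  have [g ->] := sgE sig_real i.
  by rewrite rmorphB rmorph1 rmorphXn rmorphB rmorphM rmorph_nat rmorph_int.
split=> [|i ii0].
  rewrite hy subr_lt0 exprn_ilt1 //; first by rewrite subr_ge0.
  by rewrite ltrBlDl.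
rewrite hy subr_gt0.
have d0 : 0 < `|sig i t - sig i0 t|.
  rewrite normr_gt0 subr_eq0; apply: contraNneq ii0 => /sep ->; exact: eqxx.
have big : 2%:R < `|N%:R * sig i t - N%:R * sig i0 t|.
  rewrite -mulrBr normrM normr_nat -ltr_pdivrMr //; apply: le_lt_trans NS.
  rewrite /S (bigD1 i) //= lerDl sumr_ge0 // => *; by rewrite divr_ge0 ?ler0n.
have xr : N%:R * sig i t - z%:~R \is Num.real by rewrite rpredB ?Nr // realz.
rewrite -real_normK // exprn_egt1 //.
have tri : `|N%:R * sig i t - N%:R * sig i0 t| <=
    `|N%:R * sig i t - z%:~R| + `|z%:~R - N%:R * sig i0 t| by rewrite ler_distD.
have small : `|z%:~R - N%:R * sig i0 t| <= 1.
  rewrite distrC ger0_norm ?subr_ge0 //; apply: ltW; by rewrite ltrBlDl.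
have := lt_le_trans big (le_trans tri (lerD (lexx _) small)).
by rewrite -ltrBlDr; have -> : 2%:R - 1 = 1 :> algC by ring.
Qed.

Lemma sign_pattern (s : {ffun 'I_k -> bool}) :
  exists y, y != 0 /\ forall i, if s i then sig i y < 0 else 0 < sig i y.
Proof.
have /choice[y hy] := single_negative.
have y0 i : y i != 0.
  have [g hg] := sgE sig_real i; have [+ _] := hy i; rewrite hg.
  by apply: contraTneq => ->; rewrite rmorph0 ltxx.
exists (\prod_(i | s i) y i); split.
  by apply/prodf_neq0 => i _.
move=> i; have [g hg] := sgE sig_real i.
have gpos (P : pred 'I_k) : (forall l, P l -> l != i) -> 0 < g (\prod_(l | P l) y l).
  move=> hP; rewrite rmorph_prod; apply: prodr_gt0 => l /hP li.
  by have [_] := hy l; move=> /(_ i); rewrite hg eq_sym => /(_ li).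
rewrite hg; case: ifP => si.
  rewrite (bigD1 i) //= rmorphM pmulr_llt0; last by apply: gpos => l /andP[].
  by have [+ _] := hy i; rewrite hg.
by apply: gpos => l sl; apply: contraTneq sl => ->; rewrite si.
Qed.
End SignPatterns.

(** * Residue classes modulo f as quotients of groups of fractions *)

Section UnitsModulo.
Variable K : fieldExtType rat.
Variables (f : kset K) (N0 : nat).
Hypothesis hf : is_Omodule (@OK K) f.
Hypothesis fOK : ksubset f (@OK K).
Hypothesis N0_gt0 : (0 < N0)%N.
Hypothesis fN0 : f N0%:R.
Let hR := OK_subring K.

Definition onep : kset K := fun x => f (x - 1).
(** The preimage in R of the units of R/f that are 1 modulo M. The pair (O, m) gives U_m(O/f);
    taking M = R imposes no congruence and gives all units of O_K/f when R is O_K. *)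
Definition umod (R M : kset K) : kset K := fun x =>
  R x /\ (exists y, R y /\ f (x * y - 1)) /\ M (x - 1).

Lemma fN0M t : f (N0 * t)%N%:R.
Proof. by rewrite natrM; apply: (modZr hf) => //; exact: OK_nat. Qed.

Lemma f_sym x y : f (x - y) -> f (y - x).
Proof. by move=> h; rewrite -opprB; apply: (modN hR). Qed.

Lemma onep_OK x : onep x -> OK x.
Proof. by move=> /fOK h; rewrite -(subrK 1 x); apply: OKD => //; exact: OK1. Qed.

Lemma onep1 : onep 1. Proof. by rewrite /onep subrr; exact: (mod0 hf). Qed.

Lemma onepM x y : onep x -> onep y -> onep (x * y).
Proof.
move=> hx hy; rewrite /onep; have -> : x * y - 1 = (x - 1) * y + (y - 1) by ring.
by apply: (modD hf) => //; apply: (modZr hf) => //; exact: onep_OK.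
Qed.

(** Some power of x is idempotent modulo f, and an invertible idempotent is 1. *)
Lemma onep_power x y : OK x -> OK y -> f (x * y - 1) -> finquot (@OK K) f ->
  exists P, (0 < P)%N /\ onep (x ^+ P).
Proof.
move=> hx hy h fin.
have [P [P0 hP]] := @idempotent_power K (@OK K) hR f (conj hf fOK) fin.
exists P; split=> //; rewrite /onep.
have h1 : f ((x * y) ^+ P - 1).
  rewrite -(expr1n _ P) subrXX; apply: (modZr hf) => //.
  apply: (sr_sum hR) => i _; apply: OKM; last by rewrite expr1n; exact: OK1.
  by apply: (srX hR); exact: OKM.
have -> : x ^+ P - 1 = y ^+ P * (x ^+ P * x ^+ P - x ^+ P)
    - (x ^+ P - 1) * ((x * y) ^+ P - 1) by rewrite exprMn; ring.
apply: (modB hR) => //; first by apply: (modZ hf); [apply: (srX hR)|apply: hP].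
by apply: (modZ hf) => //; apply: OKB; [apply: (srX hR)|exact: OK1].
Qed.

Section Umod.
Variables (R M : kset K).
Hypothesis hRR : subring R.
Hypothesis R_OK : ksubset R (@OK K).
Hypothesis hM : is_Omodule R M.
Hypothesis fM : ksubset f M.
Hypothesis MR : ksubset M R.
Let S := umod R M.

Lemma umodM x y : S x -> S y -> S (x * y).
Proof.
move=> [Rx [[x' [Rx' fx]] mx]] [Ry [[y' [Ry' fy]] my]].
split; first exact: srM; split.
  exists (x' * y'); split; first exact: srM.
  have -> : x * y * (x' * y') - 1 = (x * x' - 1) * (y * y') + (y * y' - 1) by ring.
  by apply: (modD hf) => //; apply: (modZr hf) => //; apply: OKM; apply: R_OK.
have -> : x * y - 1 = (x - 1) * y + (y - 1) by ring.
by apply: (modD hM) => //; apply: (modZr hM).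
Qed.

Lemma onep_umod x : onep x -> S x.
Proof.
move=> h; have mx := fM h.
have Rx : R x by rewrite -(subrK 1 x); apply: (srD hRR); [exact: MR|exact: sr1].
by split=> //; split=> //; exists 1; split; [exact: sr1|rewrite mulr1].
Qed.

Lemma umod1 : S 1. Proof. exact: onep_umod onep1. Qed.

Lemma umod_shift x y : S x -> f y -> S (x + y).
Proof.
move=> [Rx [[x' [Rx' fx]] mx]] fy; split; first by apply: (srD hRR) => //; apply/MR/fM.
split; last by rewrite addrAC; apply: (modD hM) => //; exact: fM.
exists x'; split=> //; rewrite mulrDl addrAC; apply: (modD hf) => //.
by apply: (modZr hf) => //; exact: R_OK.
Qed.

Lemma umod_inv x : S x -> exists y, [/\ S y, y != 0 & f (x * y - 1)].
Proof.
move=> [Rx [[x' [Rx' fx]] mx]].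
have Sx' : S x'.
  split=> //; split; first by exists x; rewrite mulrC.
  have -> : x' - 1 = (x * x' - 1) - (x - 1) * x' by ring.
  by apply: (modB hRR) => //; [exact: fM|exact: (modZr hM)].
(* The family of signs is empty; only nonvanishing of the inverse is wanted. *)
have [t /(_ N0 N0_gt0)[h0 _]] :=
  @large_shift K 0 (fun _ => emb (emb0 K)) (fun i => False_rect _ (notF (ltn_ord i))) x'.
exists (x' + (N0 * t)%N%:R); split=> //; first by apply: umod_shift => //; exact: fN0M.
rewrite mulrDr addrAC; apply: (modD hf) => //; apply: (modZ hf); last exact: fN0M.
exact: R_OK.
Qed.

Lemma quot_umod_mgroup : mgroup (quot S).
Proof. by apply: quot_mgroup; [exact: umod1|exact: umodM]. Qed.
Lemma onep_mgroup : mgroup (quot onep).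
Proof. by apply: quot_mgroup; [exact: onep1|exact: onepM]. Qed.
Lemma quot_onep_sub : ksubset (quot onep) (quot S).
Proof. exact: quot_sub onep_umod. Qed.

Lemma congr_erel : erel S (fun x y => f (x - y)).
Proof.
split; [|split].
- by move=> x _; rewrite subrr; exact: (mod0 hf).
- by move=> x y _ _; exact: f_sym.
- move=> x y z _ _ _ h1 h2; have -> : x - z = (x - y) + (y - z) by ring.
  exact: (modD hf).
Qed.

Lemma umod_quot_congr x y : S x -> S y -> quot onep (x / y) -> y != 0 -> f (x - y).
Proof.
move=> [/R_OK Rx _] [/R_OK Ry _] [z [w [hz hw z0 w0 e]]] y0.
have e' : x * w = y * z by rewrite -[x](divfK y0) e; field.
have -> : x - y = y * (z - 1) - x * (w - 1) by rewrite !mulrBr e'; ring.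
by apply: (modB hR) => //; apply: (modZ hf).
Qed.

Lemma umod_congr_quot x y : S x -> S y -> x != 0 -> y != 0 -> f (x - y) -> quot onep (x / y).
Proof.
move=> Sx Sy x0 y0 h; have [y' [Sy' y0' hy']] := umod_inv Sy.
have y'OK : OK y' by apply: R_OK; case: Sy'.
exists (x * y'), (y * y'); split; rewrite ?mulf_neq0 //; last by rewrite -mulf_div mulfV // mulr1.
rewrite /onep; have -> : x * y' - 1 = (x - y) * y' + (y * y' - 1) by ring.
by apply: (modD hf) => //; apply: (modZr hf).
Qed.

Lemma quot_umod_rep x : quot S x -> exists y, [/\ S y, y != 0 & quot onep (x / y)].
Proof.
move=> [z [w [Sz Sw z0 w0 ->]]]; have [w' [Sw' w0' hw]] := umod_inv Sw.
exists (z * w'); split; [exact: umodM|exact: mulf_neq0|].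
have -> : z / w / (z * w') = (w * w')^-1 by field; rewrite w0 w0' z0.
by apply: (mgV onep_mgroup); apply: quot_in; [exact: onep1| |exact: mulf_neq0].
Qed.

(** Residue representatives can be made nonzero and positive by adding multiples of N0, so imposing
    the signs on both groups leaves the index equal to the number of residues. An empty family of
    signs gives the version without positivity. *)
Lemma index_onep j (sg : 'I_j -> K -> algC) a : (forall i, real_emb (sg i)) ->
  qcard S (fun x y => f (x - y)) a ->
  qcard (fun x => quot S x /\ positive_at sg x)
    (fun x y => quot onep (x / y) /\ positive_at sg (x / y)) a.
Proof.
move=> sgr /(qcard_adjust (Q := fun x => x != 0 /\ positive_at sg x) congr_erel)[].
  move=> x Sx; have [t /(_ N0 N0_gt0)[h0 h1]] := large_shift sgr x.
  exists (x + (N0 * t)%N%:R); split=> //; first by apply: umod_shift => //; exact: fN0M.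
  by rewrite opprD addrA subrr sub0r; apply: (modN hR) => //; exact: fN0M.
move=> r [rS r0 ri rs]; exists r; split.
  by move=> i; have [? ?] := r0 i; split=> //; apply: quot_in => //; exact: umod1.
split=> [i i' [h _]|x [Sx px]].
  by apply: ri; apply: umod_quot_congr h _ => //; case: (r0 i').
have [y [Sy y0 hy]] := quot_umod_rep Sx; have [i hi] := rs y Sy.
have [ri0 rip] := r0 i.
exists i; split; last exact: pos_div.
have -> : x / r i = (x / y) * (y / r i) by rewrite mulrA divfK.
by apply: (mgM onep_mgroup) => //; apply: umod_congr_quot.
Qed.

End Umod.

(** All sign patterns occur among elements 1 mod f: take y' in f with the wanted signs and form 1 +
    t y' for large t. *)
Lemma index_signs k (sig : 'I_k -> K -> algC) (O : kset K) : (forall i, real_emb (sig i)) ->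
  injective sig -> ksubset O (@OK K) -> (forall x, exists D, (0 < D)%N /\ O (D%:R * x)) ->
  qcard (quot onep) (fun x y => quot onep (x / y) /\ positive_at sig (x / y)) (2 ^ k).
Proof.
move=> sigr siginj OOK den.
have -> : (2 ^ k)%N = #|{: {ffun 'I_k -> bool}}| by rewrite card_ffun card_bool card_ord.
have gp := onep_mgroup.
have /choice[r hr] : forall s : {ffun 'I_k -> bool}, exists x,
    [/\ onep x, x != 0 & forall i, if s i then sig i x < 0 else 0 < sig i x].
  move=> s; have [y [y0 hy]] := sign_pattern sigr siginj s.
  have [D [D0 /OOK hD]] := den y.
  pose y' := N0%:R * (D%:R * y).
  have y0' : y' != 0 by rewrite !mulf_neq0 // natK_neq0.
  have fy' : f y' by apply: (modZr hf).
  (* Inverse absolute values are summed so that t above S forces t |y'| > 1 at each embedding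
     concerned, outweighing the summand 1. *)
  pose S : algC := `|emb (emb0 K) y'|^-1 + \sum_i `|sig i y'|^-1.
  have S0 : 0 <= S by rewrite addr_ge0 ?invr_ge0 // sumr_ge0 // => *; rewrite invr_ge0.
  pose t := Num.bound S; have tS : S < t%:R := archi_boundP S0.
  have big (z : algC) : z != 0 -> `|z|^-1 <= S -> 1 < t%:R * `|z|.
    move=> z0 zS; rewrite -ltr_pdivrMr ?normr_gt0 // div1r; exact: le_lt_trans zS tS.
  have sig0 i : sig i y' != 0.
    by have [g ->] := sgE sigr i; rewrite fmorph_eq0.
  exists (1 + t%:R * y'); split.
  - by rewrite /onep addrAC subrr add0r; apply: (modZ hf) => //; exact: OK_nat.
  - apply/eqP => /(congr1 (emb (emb0 K)))/eqP.
    rewrite rmorphD rmorph1 rmorphM rmorph_nat rmorph0 addrC addr_eq0 => /eqP e.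
    have : 1 < t%:R * `|emb (emb0 K) y'|.
      apply: big; first by rewrite fmorph_eq0.
      by rewrite lerDl sumr_ge0 // => *; rewrite invr_ge0.
    by rewrite -(normr_nat algC t) -normrM e normrN1 ltxx.
  move=> i; have hi : 1 < t%:R * `|sig i y'|.
    apply: big => //; rewrite /S (bigD1 i) //= addrCA lerDl.
    by rewrite addr_ge0 ?invr_ge0 // sumr_ge0 // => *; rewrite invr_ge0.
  have sy : if s i then sig i y' < 0 else 0 < sig i y'.
    have := hy i; have [g hg] := sgE sigr i; rewrite hg /y' !rmorphM !rmorph_nat.
    by case: ifP => _ h; rewrite ?pmulr_rlt0 ?ltr0n //; rewrite !mulr_gt0 ?ltr0n.
  have [g hg] := sgE sigr i; rewrite hg in hi sy *.
  rewrite rmorphD rmorph1 rmorphM rmorph_nat; case: ifP sy => _ sy.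
    move: hi; rewrite ltr0_norm // mulrN => hi.
    by rewrite -subr_lt0 in hi; rewrite opprK in hi.
  by rewrite addr_gt0 ?ltr01 // mulr_gt0 //; move: hi;
    rewrite gtr0_norm // => /(lt_trans ltr01); rewrite pmulr_lgt0.
apply: (@qcard_fin _ _ _ _ r).
- by move=> s; have [h1 h2 _] := hr s; apply: quot_in => //; exact: onep1.
- move=> s s' [_ h]; apply/ffunP => i; have := h i.
  have [_ _ /(_ i)] := hr s; have [_ _ /(_ i)] := hr s'; have [g hg] := sgE sigr i.
  rewrite hg fmorph_div; case: (s i); case: (s' i) => // h1 h2.
    by rewrite pmulr_lgt0 ?invr_gt0 // => /lt_trans/(_ h2); rewrite ltxx.
  by rewrite pmulr_rgt0 // invr_gt0 => /lt_trans/(_ h1); rewrite ltxx.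
move=> x qx; have x0 := mg_neq0 gp qx.
exists [ffun i => sig i x < 0].
have [h1 h2 h3] := hr [ffun i => sig i x < 0]; split.
  by apply: (mg_div gp) => //; apply: quot_in => //; exact: onep1.
move=> i; have := h3 i; rewrite ffunE; have xr := sg_Creal sigr i x.
have [g hg] := sgE sigr i; rewrite hg in xr *; rewrite fmorph_div.
case: (real_ltP xr (real0 _)) => [h|h] h4.
  by rewrite -mulrNN -invrN; apply: divr_gt0; rewrite oppr_gt0.
by apply: divr_gt0 => //; rewrite lt_def h fmorph_eq0 x0.
Qed.

End UnitsModulo.

(** * Ideals coprime to the modulus *)

Section Ideals.
Variable K : fieldExtType rat.
Notation n := (\dim (fullv : {vspace K})).
Variables (O : kset K) (b : 'I_n -> K).
Hypothesis hO : subring O.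
Hypothesis b_free : forall c : 'I_n -> rat, \sum_i c i *: b i = 0 -> forall i, c i = 0.
Hypothesis b_span : forall x, O x <-> exists z : 'I_n -> int, x = \sum_i (z i)%:~R * b i.
Variables (f m : kset K) (N0 : nat).
Hypothesis hf : is_Omodule (@OK K) f.
Hypothesis hm : is_Omodule O m.
Hypothesis mO : ksubset m O.
Hypothesis fm : ksubset f m.
Hypothesis N0_gt0 : (0 < N0)%N.
Hypothesis fN0 : f N0%:R.
Variables (k : nat) (sig : 'I_k -> K -> algC).
Hypothesis sig_real : forall i, real_emb (sig i).

Let hR := OK_subring K.
Let OsubOK := O_sub_OK hO b_free b_span.
Let fO : ksubset f O. Proof. by move=> x /fm/mO. Qed.
Let fOK : ksubset f (@OK K). Proof. by move=> x /fO/OsubOK. Qed.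
Let hfO : is_Omodule O f.
Proof. by case: hf => h0 [hD hZ]; split=> //; split=> // a x /OsubOK; exact: hZ. Qed.

Lemma OK_module_O (A : kset K) : is_Omodule (@OK K) A -> is_Omodule O A.
Proof. by case=> h0 [hD hZ]; split=> //; split=> // a x /OsubOK; exact: hZ. Qed.

Lemma finquot_OK : finquot (@OK K) f.
Proof.
have [I [col hcol]] := OK_quotient_color hO b_free b_span N0_gt0.
exists I, col => x y hx hy e; have [w [/OsubOK hw ->]] := hcol x y hx hy e.
exact: (modZr hf).
Qed.


Lemma one_mem_inv (R A A' : kset K) : subring R -> is_Omodule R A -> is_Omodule R A' ->
  ksubset A R -> prodset A A' = R -> A' 1.
Proof.
move=> hRR hA hA' AR e.
rewrite -(prod_1l hRR hA') -(colon_prod hRR (mod_self hRR) hA hA' e) => y hy.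
by rewrite mul1r; apply: AR.
Qed.

(** Refines [moving]: as D lies in A, multiples of N0 D lie in f A, and adding a large one makes a
    nonzero and positive while preserving both congruences. *)
Lemma moving_pos (R A A' M : kset K) a0 c0 : subring R -> ksubset O R -> ksubset R (@OK K) ->
  is_Omodule R M -> ksubset f M ->
  is_Omodule R A -> is_Omodule R A' -> prodset A A' = R ->
  A a0 -> A' c0 -> M (a0 * c0 - 1) ->
  exists a c, [/\ a != 0, positive_at sig a, A a, A' c & prodset M A (a - a0) /\ f (a * c - 1)].
Proof.
move=> hRR OR ROK hM fM hA hA' e Aa0 Ac0 m0.
have hfR : is_Omodule R f.
  by case: hf => h0 [hD hZ]; split=> //; split=> // a x /ROK; exact: hZ.
have fR : ksubset f R by move=> x /fO/OR.
have fin : finquot R f.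
  by have [I [col hcol]] := finquot_OK; exists I, col => x y /ROK hx /ROK hy; apply: hcol.
have [a [c [Aa Ac pa fac]]] := moving hRR (conj hfR fR) fin hA hA' e hM Aa0 Ac0 m0.
have [[_ [[al [Aal /eqP al0]] _]] _] := invertibleI hRR hA hA' e.
have [D [D0 hD]] := clear_den b_free b_span al^-1.
have AD : A D%:R by rewrite -(divfK al0 D%:R); apply: (modZ hA) => //; exact: OR.
have fAN t : prodset f A (N0 * D * t)%N%:R.
  rewrite -mulnA natrM natrM mulrA.
  have hfA := @prod_mod K R f A hfR.
  by apply: (modZr hfA); [exact: (sr_nat hRR)|exact: prod_mem].
have [t /(_ (N0 * D)%N)[|h0 h1]] := large_shift sig_real a.
  by rewrite muln_gt0 N0_gt0.
exists (a + (N0 * D * t)%N%:R), c; split=> //.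
  by apply: (modD hA) => //; apply: (prod_le hA _ (fAN t)) => u v /fR; exact: (modZ hA).
split.
  rewrite addrAC; apply: prod_D => //; exact: (prod_sub fM (fun x h => h) (fAN t)).
rewrite mulrDl addrAC; apply: (modD hf) => //.
have : prodset (prodset f A) A' ((N0 * D * t)%N%:R * c) by exact: prod_mem.
by rewrite -prodA e (prod_1r hRR).
Qed.

(** Coprimality is recorded by an element 1 mod f. [nonzero] is a separate clause because the zero
    ideal would pass the congruence when f is all of O_K. *)
Definition coprime_ideal (B : kset K) := [/\ is_Omodule (@OK K) B, ksubset B (@OK K),
  nonzero B & exists x, B x /\ f (x - 1)].
Definition contraction (B : kset K) : kset K := fun x => B x /\ O x.

Lemma coprime_ideal_frac B : coprime_ideal B -> frac_ideal (@OK K) B.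
Proof.
move=> [hB BO nz _]; split=> //; split=> //; exists 1; split; first by apply/eqP; rewrite oner_eq0.
by move=> x; rewrite mul1r; apply: BO.
Qed.
Lemma coprime_ideal_mod B : coprime_ideal B -> is_Omodule (@OK K) B. Proof. by case. Qed.

Lemma onep_O x : f (x - 1) -> O x.
Proof. by move=> /fO h; rewrite -(subrK 1 x); apply: (srD hO) => //; exact: sr1. Qed.

Lemma contraction_one B : coprime_ideal B -> exists x, contraction B x /\ f (x - 1).
Proof. by move=> [_ _ _ [x [Bx fx]]]; exists x; split=> //; split=> //; exact: onep_O. Qed.

Lemma f_onem x : f (x - 1) -> f (1 - x).
Proof. by move=> h; rewrite -opprB; apply: (modN hR). Qed.

Lemma coprime_ideal_one_neq0 B : coprime_ideal B -> exists x, [/\ B x, x != 0 & f (x - 1)].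
Proof.
move=> [hB BO [y [By /eqP y0]] [x [Bx fx]]].
have [x0|x0] := eqVneq x 0; last by exists x.
exists y; split=> //; have : f 1.
  by have := f_onem fx; rewrite x0 subr0.
by move=> f1; rewrite -[y - 1]mulr1; apply: (modZ hf) => //; apply: OKB; [exact: BO|exact: OK1].
Qed.

Lemma contraction_mod B : coprime_ideal B -> is_Omodule O (contraction B).
Proof.
move=> /coprime_ideal_mod/OK_module_O [h0 [hD hZ]]; split; first by split=> //; exact: sr0.
split=> [x y [? ?] [? ?]|a x ? [? ?]].
  by split; [exact: hD|exact: (srD hO)].
by split; [exact: hZ|exact: (srM hO)].
Qed.

Lemma contraction_ext B : coprime_ideal B -> prodset (contraction B) (@OK K) = B.
Proof.
move=> XB; have [hB BO _ _] := XB; apply: kset_eq => y; split.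
  by apply: (prod_le hB) => u v [hu _] hv; apply: (modZr hB).
move=> By; have [x [Ax fx]] := contraction_one XB.
have -> : y = x * y + y * (1 - x) by ring.
apply: prod_D; first by apply: prod_mem => //; exact: BO.
rewrite -[_ * _]mulr1; apply: prod_mem; last exact: OK1.
have fy : f (y * (1 - x)) by apply: (modZ hf); [exact: BO|exact: f_onem].
split; last exact: fO.
by apply: (modZr hB) => //; apply/fOK/f_onem.
Qed.

Lemma coprime_ideal_OK : coprime_ideal (@OK K).
Proof.
split; [exact: (mod_self hR)|by []|by exists 1; split; [exact: OK1|apply/eqP; rewrite oner_eq0]|].
by exists 1; split; [exact: OK1|rewrite subrr; exact: (mod0 hf)].
Qed.

Lemma coprime_ideal_prod B B' : coprime_ideal B -> coprime_ideal B' -> coprime_ideal (prodset B B').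
Proof.
move=> XB XB'; have [hB BO [y [By y0]] [x [Bx fx]]] := XB.
have [hB' BO' [y' [By' y0']] [x' [Bx' fx']]] := XB'.
split; first exact: prod_mod.
- by apply: (prod_le (mod_self hR)) => u v /BO hu /BO' hv; apply: OKM.
- by exists (y * y'); split; [exact: prod_mem|apply/eqP/mulf_neq0; apply/eqP].
- exists (x * x'); split; first exact: prod_mem.
  have -> : x * x' - 1 = (x - 1) * x' + (x' - 1) by ring.
  by apply: (modD hf) => //; apply: (modZr hf) => //; exact: BO'.
Qed.

Lemma prod_f_ext A : prodset (prodset A (@OK K)) f = prodset A f.
Proof. by rewrite -prodA (prod_1l hR hf). Qed.

(** With x, x' in the contractions and 1 mod f, split y = y x x' + y (1 - x x'). The second term
    lies in B B' f, and since f absorbs O_K this equals the product of the two contractions with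
    f. *)
Lemma contraction_prod B B' : coprime_ideal B -> coprime_ideal B' ->
  prodset (contraction B) (contraction B') = contraction (prodset B B').
Proof.
move=> XB XB'; have hA := contraction_mod XB; have hA' := contraction_mod XB'.
have hAA' := @prod_mod K O _ (contraction B') hA.
apply: kset_eq => y; split.
  apply: (prod_le (contraction_mod (coprime_ideal_prod XB XB'))) => u v [hu hu'] [hv hv'].
  by split; [exact: prod_mem|exact: (srM hO)].
move=> [By Oy]; have [x [Ax fx]] := contraction_one XB; have [x' [Ax' fx']] := contraction_one XB'.
have -> : y = y * (x * x') + y * (1 - x * x') by ring.
apply: (modD hAA'); first by apply: (modZ hAA') => //; exact: prod_mem.
have fxx : f (1 - x * x').
  have -> : 1 - x * x' = (1 - x) * x' + (1 - x') by ring.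
  apply: (modD hf); last exact: f_onem.
  by apply: (modZr hf); [case: Ax' => _ /OsubOK|exact: f_onem].
have : prodset (prodset B B') f (y * (1 - x * x')) by exact: prod_mem.
have -> : prodset (prodset B B') f = prodset (prodset (contraction B) (contraction B')) f.
  rewrite -{1}(contraction_ext XB) -{1}(contraction_ext XB') prodACA -prodA.
  by rewrite (prod_1l hR (mod_self hR)) (prod_1l hR hf).
by apply: (prod_le hAA') => u v hu /fO hv; exact: (modZr hAA').
Qed.

Lemma coprime_ideal_scale B g : coprime_ideal B -> (exists g', OK g' /\ f (g * g' - 1)) ->
  g != 0 -> OK g -> coprime_ideal (scale g B).
Proof.
move=> [hB BO [y [By /eqP y0]] [x [Bx fx]]] [g' [hg' fg]] g0 hg.
split; first exact: scale_mod.
- by move=> _ [z [hz ->]]; apply: OKM => //; exact: BO.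
- by exists (g * y); split; [exists y|apply/eqP/mulf_neq0].
- exists (g * (g' * x)); split; first by exists (g' * x); split=> //; exact: (modZ hB).
  have -> : g * (g' * x) - 1 = (g * g' - 1) * x + (x - 1) by ring.
  by apply: (modD hf) => //; apply: (modZr hf) => //; exact: BO.
Qed.

Lemma coprime_ideal_power B i : coprime_ideal B -> coprime_ideal (ideal_power B i).
Proof. by move=> XB; elim: i => [|i IH]; [exact: coprime_ideal_OK|exact: coprime_ideal_prod]. Qed.

Lemma ideal_power_principal B N a P : coprime_ideal B -> ideal_power B N = scale a (@OK K) ->
  ideal_power B (P * N)%N = scale (a ^+ P) (@OK K).
Proof.
move=> XB e; elim: P => [|P IH]; first by rewrite scale1.
rewrite mulSn ideal_powerD //; last exact: coprime_ideal_frac.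
by rewrite e IH prod_scale prod_scaler scale_scale (prod_1l hR (mod_self hR)) exprS.
Qed.

Lemma contraction_invertible B : coprime_ideal B -> invertible O (contraction B).
Proof.
move=> XB; have [N [a [N1 a0 e]]] := power_principal hO b_free b_span (coprime_ideal_frac XB).
have Xa : coprime_ideal (scale a (@OK K)) by rewrite -e; apply: coprime_ideal_power.
have [_ aO _ [x [[o [Oo ex]] fx]]] := Xa.
have OKa : OK a by apply: aO; exists 1; rewrite mulr1; split=> //; exact: OK1.
have [P [P0 hP]] : exists P, (0 < P)%N /\ onep f (a ^+ P).
  by apply: (onep_power hf fOK OKa Oo _ finquot_OK); rewrite -ex.
set g := a ^+ P in hP; have g0 : g != 0 by rewrite expf_neq0.
have eg : ideal_power B (P * N)%N = scale g (@OK K) by exact: ideal_power_principal.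
have PN : (P * N = (P * N).-1.+1)%N by rewrite prednK // muln_gt0 P0.
set l := (P * N).-1 in PN.
have XC := coprime_ideal_power l XB.
have er : prodset (contraction B) (contraction (ideal_power B l)) = scale g O.
  rewrite contraction_prod // (_ : prodset B (ideal_power B l) = scale g (@OK K)); last
    by rewrite -eg PN.
  apply: kset_eq => y; split=> [[[z [hz ->]] Oy]|[z [Oz ->]]].
    (* The generator g is 1 mod f, so g z in O forces z in O; hence g O_K contracts to g O. *)
    exists z; split=> //; have -> : z = g * z + z * (1 - g) by ring.
    by apply: (srD hO) => //; apply: fO; apply: (modZ hf) => //; exact: f_onem.
  split; first by exists z; split=> //; exact: OsubOK.
  by apply: (srM hO) => //; exact: onep_O.
apply: (invertibleI hO (contraction_mod XB) (B := scale g^-1 (contraction (ideal_power B l)))).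
  by apply: scale_mod; exact: contraction_mod.
by rewrite prod_scaler er scaleVK.
Qed.

Lemma sumset_one A x : is_Omodule O A -> ksubset A O -> A x -> m (1 - x) ->
  kseteq (sumset A m) O.
Proof.
move=> hA AO Ax mx y; split=> [[u [v [/AO hu [/mO hv ->]]]]|Oy]; first exact: (srD hO).
exists (y * x), (y * (1 - x)); split; first exact: (modZ hA).
by split; [exact: (modZ hm)|ring].
Qed.

Lemma contraction_Jstar B : coprime_ideal B -> Jstar O m (contraction B).
Proof.
move=> XB; split; first exact: contraction_invertible.
have hA := contraction_mod XB.
exists (contraction B), O; split; first by split=> // x [].
split; first by split=> //; exact: (mod_self hO).
split; first exact: (invertible_1 hO).
have [x [Ax fx]] := contraction_one XB.
split; first by apply: (sumset_one hA _ Ax); [move=> y []|apply/fm/f_onem].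
split.
  apply: (sumset_one (mod_self hO) _ (sr1 hO)) => //.
  by rewrite subrr; exact: (mod0 hm).
have e := prod_1l hO (mod_self hO).
by rewrite (colon_prod hO hA (mod_self hO) (mod_self hO) e) (prod_1r hO hA).
Qed.

Definition onem : kset K := fun x => m (x - 1).
Lemma onem_O x : onem x -> O x.
Proof. by move=> /mO h; rewrite -(subrK 1 x); apply: (srD hO) => //; exact: sr1. Qed.
Lemma onem1 : onem 1. Proof. by rewrite /onem subrr; exact: (mod0 hm). Qed.
Lemma onemM x y : onem x -> onem y -> onem (x * y).
Proof.
move=> hx hy; rewrite /onem; have -> : x * y - 1 = (x - 1) * y + (y - 1) by ring.
by apply: (modD hm) => //; apply: (modZr hm) => //; exact: onem_O.
Qed.

Lemma SmP s : Sm O m s <-> O s /\ exists o, O o /\ m (s * o - 1).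
Proof.
split=> [[Os h]|[Os [o [Oo mo]]]].
  split=> //; have /h [u [v [[o [Oo ->]] [mv e]]]] := sr1 hO.
  exists o; split=> //; have -> : s * o - 1 = - v by rewrite e; ring.
  exact: (modN hO).
split=> //; apply: (sumset_one (x := s * o)).
- split; first by exists 0; rewrite mulr0; split=> //; exact: sr0.
  split=> [_ _ [u [hu ->]] [v [hv ->]]|a _ ha [u [hu ->]]].
    by exists (u + v); rewrite mulrDr; split=> //; exact: (srD hO).
  by exists (a * u); rewrite mulrCA; split=> //; exact: (srM hO).
- by move=> _ [u [hu ->]]; exact: (srM hO).
- by exists o.
- by rewrite -opprB; apply: (modN hO).
Qed.

(* In locS a denominator s = 0 can occur only when m = O; the quotient is then 0. *)
Lemma prod_locS z : prodset m (locS O m) z ->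
  exists s, [/\ s != 0, O s, exists o, O o /\ m (s * o - 1) & m (z * s)].
Proof.
have one : exists s, [/\ s != 0, O s, exists o, O o /\ m (s * o - 1) & m (0 * s)].
  exists 1; rewrite oner_neq0 mul0r; split=> //; [exact: sr1| |exact: (mod0 hm)].
  by exists 1; rewrite mulr1 subrr; split; [exact: sr1|exact: (mod0 hm)].
move: z; apply: prod_ind => //.
  move=> x y [s [s0 Os [o [Oo mo]] mx]] [t [t0 Ot [p [Op mp]] my]].
  exists (s * t); split; first exact: mulf_neq0; first exact: (srM hO).
    exists (o * p); split; first exact: (srM hO).
    have -> : s * t * (o * p) - 1 = (s * o - 1) * (t * p) + (t * p - 1) by ring.
    by apply: (modD hm) => //; apply: (modZr hm) => //; exact: (srM hO).
  have -> : (x + y) * (s * t) = t * (x * s) + s * (y * t) by ring.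
  by apply: (modD hm); exact: (modZ hm).
move=> mu _ hmu [o [s [Oo [/SmP[Os hs] ->]]]].
have [->|s0] := eqVneq s 0; first by rewrite invr0 !mulr0.
exists s; split=> //; rewrite mulrA divfK //; exact: (modZr hm).
Qed.

(** Removes the localization: if (a - 1) s lies in m and s o = 1 mod m, then a = (a s o) / (s o),
    with numerator and denominator 1 mod m. *)
Lemma PgenP a : Pgen O m sig a <-> quot onem a /\ positive_at sig a.
Proof.
split=> [[/eqP a0 [/prod_locS[s [s0 Os [o [Oo mo]] ms]] pa]]|[[x [y [mx my x0 y0 e]]] pa]].
  split=> //.
  have as0 : a * s = s + (a - 1) * s by ring.
  (* o = 0 is possible only for m = O, where all congruences are void and s itself is a
     denominator. *)
  have [o0|o0] := eqVneq o 0.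
    have m1 : m 1.
      by rewrite o0 mulr0 sub0r in mo; rewrite -[1]opprK; exact: (modN hO).
    have all1 u : O u -> onem u.
      by move=> hu; rewrite -[u]mulr1; rewrite /onem -[Y in m Y]mulr1; apply: (modZ hm) => //;
        apply: (srB hO) => //; [rewrite mulr1|exact: sr1].
    exists (a * s), s; split; rewrite ?mulf_neq0 ?mulfK //; last exact: all1.
    by apply: all1; rewrite as0; apply: (srD hO) => //; exact: mO.
  exists (a * s * o), (s * o); split; rewrite ?mulf_neq0 //; last first.
    by field; rewrite s0 o0.
  rewrite /onem; have -> : a * s * o - 1 = (a - 1) * s * o + (s * o - 1) by ring.
  by apply: (modD hm) => //; apply: (modZr hm).
split; first by apply/eqP; rewrite e mulf_neq0 ?invr_eq0.
split=> //; have -> : a - 1 = (x - y) * (1 / y) by rewrite e; field.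
apply: prod_mem.
  by have -> : x - y = (x - 1) - (y - 1) by [ring]; exact: (modB hO).
exists 1, y; split; first exact: sr1.
split=> //; apply/SmP; split; first exact: onem_O.
by exists 1; split; [exact: sr1|rewrite mulr1].
Qed.

Lemma Pgen_mgroup : mgroup (Pgen O m sig).
Proof.
rewrite (_ : Pgen O m sig = fun a => quot onem a /\ positive_at sig a); last exact/kset_eq/PgenP.
by apply: pos_mgroup => //; apply: quot_mgroup; [exact: onem1|exact: onemM].
Qed.

Lemma ray_equivE A C : is_Omodule O C ->
  ray_equiv O m sig A C <-> exists a, Pgen O m sig a /\ A = scale a C.
Proof.
move=> hC; split=> [[a [pa /kset_eq]]|[a [pa ->]]].
  by rewrite (prod_principal hO _ hC) => ->; exists a.
by exists a; split=> //; rewrite (prod_principal hO _ hC).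
Qed.

Lemma ray_erel : erel (Jstar O m) (ray_equiv O m sig).
Proof.
have hP := Pgen_mgroup.
have mod A : Jstar O m A -> is_Omodule O A by move=> [/invertible_mod].
split; [|split].
- by move=> A /mod hA; apply/(ray_equivE _ hA); exists 1; rewrite scale1; split=> //; exact: mg1.
- move=> A C /mod hA /mod hC /(ray_equivE _ hC)[a [pa ->]].
  apply/ray_equivE; first exact: scale_mod.
  by exists a^-1; rewrite scaleVK ?(mg_neq0 hP) //; split=> //; exact: mgV.
- move=> A C D _ /mod hC /mod hD /(ray_equivE _ hC)[a [pa ->]] /(ray_equivE _ hD)[c [pc ->]].
  by apply/(ray_equivE _ hD); exists (a * c); rewrite scale_scale; split=> //; exact: mgM.
Qed.

Lemma coprime_element A1 : is_Omodule O A1 -> ksubset A1 O -> nonzero A1 ->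
  kseteq (sumset A1 m) O ->
  exists x, [/\ A1 x, x != 0 & onem x].
Proof.
move=> hA AO [y [Ay /eqP y0]] h; have /h[u [v [Au [mv e]]]] := sr1 hO.
have mu : m (u - 1) by have -> : u - 1 = - v by [rewrite e; ring]; exact: (modN hO).
have [u0|u0] := eqVneq u 0; last by exists u.
exists y; split=> //; rewrite /onem -[y - 1]mulr1; apply: (modZ hm).
  by apply: (srB hO); [exact: AO|exact: sr1].
by rewrite u0 sub0r in mu; rewrite -[1]opprK; exact: (modN hO).
Qed.

(** Write A as A1 times the inverse of B1. Scaling A1 by a near 1 in its inverse, and the inverse of
    B1 by [be] near 1 in B1, makes both factors integral with elements inverse to the scalars modulo
    f. Their product then contains an element 1 mod f. *)
Lemma Jstar_rep A : Jstar O m A ->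
  exists a B, [/\ Pgen O m sig a, coprime_ideal B & scale a A = contraction B].
Proof.
move=> [iA [A1 [B1 [[hA1 A1O] [[hB1 B1O] [iB1 [cA1 [cB1 /kset_eq eA]]]]]]]].
have [B1' [hB1' eB1]] := invertibleE iB1.
rewrite (colon_prod hO hA1 hB1 hB1' eB1) in eA.
have iA1 : invertible O A1.
  have -> : A1 = prodset A B1 by rewrite eA -prodA (prodC B1') eB1 (prod_1r hO hA1).
  exact: invertible_prod.
have nzI C : invertible O C -> nonzero C by move=> [[_ []]].
have [A1' [hA1' eA1]] := invertibleE iA1.
have [a1 [Aa1 a10 ma1]] := coprime_element hA1 A1O (nzI _ iA1) cA1.
have [b1 [Bb1 b10 mb1]] := coprime_element hB1 B1O (nzI _ iB1) cB1.
have A1'1 := one_mem_inv hO hA1 hA1' A1O eA1.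
have B1'1 := one_mem_inv hO hB1 hB1' B1O eB1.
have eA1' : prodset A1' A1 = O by rewrite prodC.
have [|a [c [a0 pa Aa Ac [pra fac]]]] :=
  moving_pos hO (fun x h => h) OsubOK hm fm hA1' hA1 eA1' A1'1 Aa1.
  by rewrite mul1r.
have [|be [d [be0 pb Bb Bd [prb fbd]]]] :=
  moving_pos hO (fun x h => h) OsubOK hm fm hB1 hB1' eB1 Bb1 B1'1.
  by rewrite mulr1.
have qb : quot onem be.
  apply: quot_in => //; first exact: onem1.
  have -> : be = (be - b1) + b1 by rewrite subrK.
  rewrite /onem -addrA; apply: (modD hm) => //.
  by apply: (prod_le hm _ prb) => u v hu /B1O hv; exact: (modZr hm).
(* a need not lie in O, but a a1 and a1 are both 1 mod m. *)
have qa : quot onem a.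
  exists (a * a1), a1; split; rewrite ?mulf_neq0 ?mulfK //.
  rewrite /onem; have -> : a * a1 - 1 = (a - 1) * a1 + (a1 - 1) by ring.
  apply: (modD hm) => //.
  have : prodset (prodset m A1') A1 ((a - 1) * a1) by exact: prod_mem.
  by rewrite -prodA eA1' (prod_1r hO hm).
have pg : Pgen O m sig (a * be).
  by apply: (mgM Pgen_mgroup); apply/PgenP.
set A2 := scale (a * be) A.
have eA2 : A2 = prodset (scale a A1) (scale be B1').
  by rewrite /A2 eA prod_scale prod_scaler scale_scale.
have iA2 : invertible O A2 by apply: (invertible_scale hO) => //; exact: mulf_neq0.
have hA2 := invertible_mod iA2.
have A2O : ksubset A2 O.
  rewrite eA2; apply: (prod_le (mod_self hO)) => _ _ [u [hu ->]] [v [hv ->]].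
  by apply: (srM hO); [rewrite -eA1'|rewrite -eB1]; exact: prod_mem.
have A2e : A2 (a * c * (be * d)) by rewrite eA2; apply: prod_mem; [exists c|exists d].
set e := a * c * (be * d) in A2e.
have fe : f (e - 1).
  have -> : e - 1 = (a * c - 1) * (be * d) + (be * d - 1) by rewrite /e; ring.
  apply: (modD hf) => //; apply: (modZr hfO) => //; exact: onep_O.
exists (a * be), (prodset A2 (@OK K)); split=> //.
  split.
  - by rewrite prodC; apply: prod_mod; exact: (mod_self hR).
  - by apply: (prod_le (mod_self hR)) => u v /A2O/OsubOK hu hv; exact: OKM.
  - have [y [Ay y0]] := nzI _ iA2; exists y; split=> //; rewrite -[y]mulr1.
    by apply: prod_mem => //; exact: OK1.
  - by exists e; split=> //; rewrite -[e]mulr1; apply: prod_mem => //; exact: OK1.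
rewrite -/A2; apply: kset_eq => y; split=> [Ay|[By Oy]].
  by split; [rewrite -[y]mulr1; apply: prod_mem => //; exact: OK1|exact: A2O].
(* An integral O-ideal containing e = 1 mod f is the contraction of its extension: y (1 - e) lies in
   A2 O_K f = A2 f, inside A2. *)
have -> : y = y * e + y * (1 - e) by ring.
apply: (modD hA2); first exact: (modZ hA2).
have : prodset (prodset A2 (@OK K)) f (y * (1 - e)) by apply: prod_mem => //; exact: f_onem.
rewrite prod_f_ext; apply: (prod_le hA2) => u v hu /fO hv; exact: (modZr hA2).
Qed.

Definition onem_umod := umod f O m.
Definition congr_group : kset K := fun x => quot onem_umod x /\ positive_at sig x.

Lemma congr_group_Pgen x : congr_group x -> Pgen O m sig x.
Proof.
move=> [q p]; apply/PgenP; split=> //; apply: quot_sub q => y [_ [_]] //.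
Qed.

Lemma quot_onem_umod_denominator x : quot onem_umod x -> exists z w, [/\ onem_umod z,
  f (w - 1) & x * w = z].
Proof.
move=> [z [w [Uz Uw z0 w0 ->]]].
have [w' [Uw' w0' hw]] := umod_inv hf N0_gt0 fN0 hO OsubOK hm fm mO Uw.
exists (z * w'), (w * w'); split=> //; last by field.
exact: umodM.
Qed.

(** Write c w = z with z in O and w = 1 mod f; then c y = z y + c y (1 - w) is in O. Applied to a
    and its inverse, this yields both inclusions. *)
Lemma contraction_scale_congr B B' a : coprime_ideal B -> coprime_ideal B' ->
  B = scale a B' -> congr_group a -> contraction B = scale a (contraction B').
Proof.
move=> XB XB' e [qa pa].
have sub C C' c : coprime_ideal C -> coprime_ideal C' -> C = scale c C' -> quot onem_umod c ->
    ksubset (scale c (contraction C')) (contraction C).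
  move=> [_ CO _ _] [_ CO' _ _] eC qc x [y [[Cy Oy] ex]].
  have Cx : C x by rewrite eC; exists y.
  split=> //; have [z [w [[Oz _] fw ew]]] := quot_onem_umod_denominator qc.
  have -> : x = z * y + x * (1 - w) by rewrite ex -ew; ring.
  apply: (srD hO); first exact: (srM hO).
  by apply: fO; apply: (modZ hf); [exact: CO|exact: f_onem].
have hU := quot_umod_mgroup hf hO OsubOK hm fm mO.
have a0 := mg_neq0 hU qa.
apply: kset_eq => x; split; last exact: sub.
move=> hx; apply/(scaleP _ _ a0).
by apply: (sub B' B a^-1) => //; [rewrite e scaleVK|exact: (mgV hU)|exists x].
Qed.

(** Choose c in B' and d = a d' in the contraction of B, both 1 mod f. Then a = (a c) / c, and a c
    is a unit mod f because (a c) d' = d c. *)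
Lemma contraction_scale_Pgen B B' a : coprime_ideal B -> coprime_ideal B' -> Pgen O m sig a ->
  contraction B = scale a (contraction B') -> B = scale a B' /\ congr_group a.
Proof.
move=> XB XB' pa e; have a0 := mg_neq0 Pgen_mgroup pa.
split; first by rewrite -(contraction_ext XB) e prod_scale (contraction_ext XB').
have [[x [y [mx my x0 y0 ea]]] posa] := (PgenP a).1 pa.
have [c [Bc c0 fc]] := coprime_ideal_one_neq0 XB'; have Oc := onep_O fc.
have [d [Ad fd]] := contraction_one XB.
have Aac : contraction B (a * c) by rewrite e; exists c; split.
have [d' [[Bd' Od'] ed]] : scale a (contraction B') d by rewrite -e.
have Oac : O (a * c) by case: Aac.
split=> //; exists (a * c), c; split; rewrite ?mulf_neq0 ?mulfK //; last first.
  exact: (onep_umod hO fm mO).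
split=> //; split.
  exists d'; split=> //; have -> : a * c * d' - 1 = (d - 1) * c + (c - 1) by rewrite ed; ring.
  by apply: (modD hf) => //; apply: (modZr hfO).
have -> : a * c - 1 = (x * c - 1) - (a * c) * (y - 1).
  by rewrite ea; field.
apply: (modB hO) => //; last exact: (modZ hm).
by apply: onemM => //; exact: fm.
Qed.

End Ideals.

(** * The class number formula *)

Section Count.
Variable K : fieldExtType rat.
Notation n := (\dim (fullv : {vspace K})).
Variables (O : kset K) (b : 'I_n -> K).
Hypothesis hO : subring O.
Hypothesis b_free : forall c : 'I_n -> rat, \sum_i c i *: b i = 0 -> forall i, c i = 0.
Hypothesis b_span : forall x, O x <-> exists z : 'I_n -> int, x = \sum_i (z i)%:~R * b i.
Variables (f m : kset K) (N0 : nat).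
Hypothesis hf : is_Omodule (@OK K) f.
Hypothesis hm : is_Omodule O m.
Hypothesis mO : ksubset m O.
Hypothesis fm : ksubset f m.
Hypothesis N0_gt0 : (0 < N0)%N.
Hypothesis fN0 : f N0%:R.
Variables (k : nat) (sig : 'I_k -> K -> algC).
Hypothesis sig_real : forall i, real_emb (sig i).
Hypothesis sig_inj : injective sig.

Let hR := OK_subring K.
Let OsubOK := O_sub_OK hO b_free b_span.
Let fO : ksubset f O. Proof. by move=> x /fm/mO. Qed.
Let fOK : ksubset f (@OK K). Proof. by move=> x /fO/OsubOK. Qed.
Let OKself := mod_self hR.
Let OKid : ksubset (@OK K) (@OK K). Proof. by []. Qed.

Let rayE A C (hC : is_Omodule O C) :
  ray_equiv O m sig A C <-> exists a, Pgen O m sig a /\ A = scale a C.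
Proof. exact: ray_equivE. Qed.

Notation V := (umod f (@OK K) (@OK K)).
Notation G := (quot V).
Notation H := (congr_group O f m sig).
Notation U := (units (@OK K)).
Notation K1 := (fun x => quot (onep f) x /\ positive_at sig x).

Definition congr_units : kset K := fun x => exists h e, [/\ H h, U e & x = h * e].

Lemma congr_group_mgroup : mgroup H.
Proof. by apply: (pos_mgroup sig_real); exact: (quot_umod_mgroup hf hO OsubOK hm fm mO). Qed.
Lemma G_mgroup : mgroup G. Proof. exact: (quot_umod_mgroup hf hR OKid OKself fOK). Qed.
Lemma U_mgroup : mgroup U.
Proof.
split; first exact: units_neq0; split; first exact: units1.
by move=> x y hx hy; apply: unitsM => //; exact: unitsV.
Qed.
Lemma onep_pos_mgroup : mgroup K1.
Proof. by apply: (pos_mgroup sig_real); exact: (onep_mgroup hf fOK). Qed.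

Lemma congr_units_mgroup : mgroup congr_units.
Proof.
have hH := congr_group_mgroup; have hU := U_mgroup.
split; [|split].
- by move=> x [h [e [hh he ->]]]; rewrite mulf_neq0 ?(mg_neq0 hH hh) ?(mg_neq0 hU he).
- by exists 1, 1; rewrite mulr1; split=> //; [exact: mg1|exact: units1].
- move=> x y [h [e [hh he ->]]] [h' [e' [hh' he' ->]]].
  exists (h / h'), (e / e'); split; [exact: mg_div|exact: mg_div|].
  by rewrite mulf_div.
Qed.

Lemma onep_pos_sub : ksubset K1 H.
Proof. by move=> x [q p]; split=> //; exact: (quot_onep_sub hO fm mO q). Qed.

Lemma onem_umod_sub : ksubset (onem_umod O f m) V.
Proof.
move=> x [/OsubOK Ox [[y [/OsubOK Oy h]] _]]; split=> //; split; first by exists y.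
by apply: OKB => //; exact: OK1.
Qed.

Lemma congr_group_sub : ksubset H congr_units.
Proof. by move=> x hx; exists x, 1; rewrite mulr1; split=> //; exact: units1. Qed.

Lemma congr_units_sub : ksubset congr_units G.
Proof.
move=> _ [h [e [[qh _] ue ->]]]; apply: (mgM G_mgroup); first exact: quot_sub onem_umod_sub _ qh.
have [Oe [_ Oe']] := ue; have e0 := units_neq0 ue.
apply: quot_in => //; first exact: (umod1 hf hR fOK OKid).
split=> //; split; last by apply: OKB => //; exact: OK1.
by exists e^-1; rewrite mulfV // subrr; split=> //; exact: (mod0 hf).
Qed.

(** Identifies E intersected with H. Writing y w = z as a fraction with w = 1 mod f gives y - 1 = (z
    - 1) - y (w - 1) in m; the inverse needs the same argument in order to lie in O. *)
Lemma UmsigE x : Umsig O m sig x <-> U x /\ H x.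
Proof.
have hH := congr_group_mgroup.
split=> [[[Ox [/eqP x0 Ox']] [mx px]]|[ux hx]].
  split; first by split; [exact: OsubOK|split; [exact/eqP|exact: OsubOK]].
  split=> //; apply: quot_in => //; first exact: (umod1 hf hO fm mO).
  split=> //; split=> //; exists x^-1; rewrite mulfV // subrr; split=> //; exact: (mod0 hf).
have key y : U y -> H y -> m (y - 1).
  move=> [Oy _] [qy _].
  have [z [w [[Oz [_ mz]] fw e]]] :=
    quot_onem_umod_denominator hO b_free b_span hf hm mO fm N0_gt0 fN0 qy.
  have -> : y - 1 = (z - 1) - y * (w - 1) by rewrite -e; ring.
  by apply: (modB hO) => //; apply: fm; exact: (modZ hf).
have mx := key x ux hx; have mx' := key _ (unitsV ux) (mgV hH hx).
have x0 := units_neq0 ux.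
by split; [split; [exact: (onem_O hO mO)|split; [exact/eqP|exact: (onem_O hO mO)]]|case: hx].
Qed.

(** P achieves the congruence modulo f and the extra factor 2 the signs. This carries the rank over
    from O_K to O. *)
Lemma unit_power_Umsig u : U u -> exists N, (0 < N)%N /\ Umsig O m sig (u ^+ N).
Proof.
move=> uu; have u0 := units_neq0 uu; have [Ou [_ Ou']] := uu.
have fin := finquot_OK hO b_free b_span hf N0_gt0 fN0.
have [P [P0 hP]] : exists P, (0 < P)%N /\ onep f (u ^+ P).
  have h1 : f (u * u^-1 - 1) by rewrite mulfV // subrr; exact: (mod0 hf).
  exact: (onep_power hf fOK Ou Ou' h1 fin).
exists (P * 2)%N; rewrite muln_gt0 P0; split=> //; apply/UmsigE; split; first exact: unitsX.
apply: onep_pos_sub; rewrite exprM; split; last by apply: (pos_sqr sig_real); rewrite expf_neq0.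
apply: quot_in; [exact: (onep1 hf)|exact: (onepM hf fOK)|by rewrite !expf_neq0].
Qed.

(** The second isomorphism theorem: H E / H and E / (E intersected with H) share representatives. *)
Lemma units_index idx : qcard U (fun x y => Umsig O m sig (x / y)) idx ->
  qcard congr_units (fun x y => H (x / y)) idx.
Proof.
move=> [r [rU [ri rs]]]; exists r; split.
  by move=> i; exists 1, (r i); rewrite mul1r; split=> //; exact: (mg1 congr_group_mgroup).
split=> [i j h|_ [h [e [hh he ->]]]].
  by apply: ri; apply/UmsigE; split=> //; exact: (mg_div U_mgroup).
have [i /UmsigE[_ hi]] := rs e he; exists i.
by rewrite -mulrA; exact: (mgM congr_group_mgroup).
Qed.

(** The denominator is replaced by its power w^(2 P), which is 1 mod f and positive, so it belongs
    to H. *)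
Lemma quot_umod_positive_rep x : G x -> exists y, [/\ V y, y != 0 & H (x / y)].
Proof.
move=> [z [w [Vz Vw z0 w0 ->]]]; have [Ow [[w' [Ow' fw]] _]] := Vw.
have fin := finquot_OK hO b_free b_span hf N0_gt0 fN0.
have [P [P0 hP]] := onep_power hf fOK Ow Ow' fw fin.
pose l := (P * 2).-1; have l1 : (P * 2 = l.+1)%N by rewrite /l prednK // muln_gt0 P0.
have VX i : V (w ^+ i).
  elim: i => [|i IH]; first exact: (umod1 hf hR fOK OKid).
  by rewrite exprS; exact: (umodM hf hR OKid OKself).
exists (z * w ^+ l); split; [exact: (umodM hf hR OKid OKself)|by rewrite mulf_neq0 // expf_neq0|].
have -> : z / w / (z * w ^+ l) = (w ^+ (P * 2))^-1.
  by rewrite l1 exprS; field; rewrite w0 z0 expf_neq0.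
apply: (mgV congr_group_mgroup); apply: onep_pos_sub; rewrite exprM.
split; last by apply: (pos_sqr sig_real); rewrite expf_neq0.
apply: quot_in; [exact: (onep1 hf)|exact: (onepM hf fOK)|by rewrite !expf_neq0].
Qed.

Lemma coprime_ideal_class_rep A : invertible (@OK K) A -> exists B,
  [/\ invertible (@OK K) B, coprime_ideal f B & class_equiv (@OK K) A B].
Proof.
move=> iA; have hA := invertible_mod iA; have [A' [hA' e]] := invertibleE iA.
have e' : prodset A' A = @OK K by rewrite prodC.
(* The side congruence is taken modulo O_K and so is void; 0 and 0 can start the approximation. *)
have [|a [c [a0 _ A'a Ac [_ fac]]]] := moving_pos hO b_free b_span hf mO fm N0_gt0 fN0 sig_real
  hR OsubOK OKid OKself fOK hA' hA e' (mod0 hA') (mod0 hA).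
  by rewrite mulr0 sub0r; apply: OKN; exact: OK1.
have iB : invertible (@OK K) (scale a A) by exact: (invertible_scale hR).
exists (scale a A); split=> //.
  split; [exact: scale_mod| |by case: iB => [[_ []]]|].
    by move=> _ [y [hy ->]]; rewrite -e'; exact: prod_mem.
  by exists (a * c); split=> //; exists c.
apply/class_equivE; first exact: scale_mod.
by exists a^-1; rewrite invr_eq0 scaleVK.
Qed.

Lemma invertible_unit B e : invertible (@OK K) B -> scale e B = B -> OK e.
Proof.
move=> /invertibleE[B' [hB' eB]] h.
have : scale e (@OK K) = @OK K by rewrite -eB -prod_scale h.
by move=> <-; exists 1; rewrite mulr1; split=> //; exact: OK1.
Qed.

(** Representatives are the contractions of g_j B_i, with B_i coprime to f in each ideal class and
    g_j in O_K representing G modulo H E. The unit part of H E appears because a scalar is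
    determined by its action on B_i only up to units. *)
Lemma Jstar_count h q :
  qcard (invertible (@OK K)) (class_equiv (@OK K)) h ->
  qcard G (fun x y => congr_units (x / y)) q ->
  qcard (Jstar O m) (ray_equiv O m sig) (h * q).
Proof.
move=> hh hq.
have hP := Pgen_mgroup hO hm mO sig_real.
have [B [iB XB Bi Bs]] := qcard_adjust (class_erel K) hh coprime_ideal_class_rep.
have Gerel := mgroup_erel (mg_neq0 G_mgroup) congr_units_mgroup.
have Grep x : G x -> exists y, [/\ G y, V y /\ y != 0 & congr_units (x / y)].
  move=> /quot_umod_positive_rep[y [Vy y0 hy]]; exists y; split=> //; last exact: congr_group_sub.
  exact: (quot_in (umod1 hf hR fOK OKid)).
have [g [gG gV gi gs]] := qcard_adjust Gerel hq Grep.
have g0 j : g j != 0 by case: (gV j).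
have Xg i j : coprime_ideal f (scale (g j) (B i)).
  have [[Og [gi' _]] _] := gV j.
  exact: (coprime_ideal_scale hf (XB i) gi').
have rm i j := contraction_mod hO b_free b_span (Xg i j).
have -> : (h * q)%N = #|{: 'I_h * 'I_q}| by rewrite card_prod !card_ord.
apply: (@qcard_fin _ _ _ _ (fun ij : 'I_h * 'I_q => contraction O (scale (g ij.2) (B ij.1)))) => /=.
- by move=> [i j]; exact: (contraction_Jstar hO b_free b_span hf hm mO fm N0_gt0 fN0).
- move=> [i j] [i' j'] /= /(rayE _ (rm i' j'))[a [pa e]].
  have [eB ha] :=
    contraction_scale_Pgen hO b_free b_span hf hm mO fm sig_real (Xg i j) (Xg i' j') pa e.
  have a0 := mg_neq0 hP pa.
  have eB' : B i = scale (a * g j' / g j) (B i').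
    by rewrite mulrC -scale_scale -(scale_scale a) -eB scaleVK.
  have ii : i = i'.
    apply: Bi; apply/class_equivE; first exact: (invertible_mod (iB i')).
    by exists (a * g j' / g j); rewrite !mulf_neq0 ?invr_eq0.
  rewrite -ii in eB' *; congr pair; apply: gi.
  (* e1 maps B_i onto itself, so it is a unit, and g_j / g_j' = a e1 lies in H E. *)
  pose e1 := g j / (a * g j').
  have e10 : e1 != 0 by rewrite mulf_neq0 ?invr_eq0 ?mulf_neq0.
  have ee : e1^-1 = a * g j' / g j by rewrite invf_div.
  exists a, e1; split=> //; last by rewrite /e1; field; rewrite a0 g0.
  split; last first.
    split; first exact/eqP.
    by apply: (invertible_unit (iB i)); rewrite ee -eB'.
  by apply: (invertible_unit (iB i)); rewrite {1}eB' -ee scale_scale mulfV // scale1.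
move=> A JA.
have hA : is_Omodule O A by case: JA => /invertible_mod.
have [a [C [pa XC eA]]] := Jstar_rep hO b_free b_span hf hm mO fm N0_gt0 fN0 sig_real JA.
have a0 := mg_neq0 hP pa.
have iC := frac_ideal_invertible hO b_free b_span (coprime_ideal_frac XC).
have [i /class_equivE[|al [al0 eC]]] := Bs C iC; first exact: (invertible_mod (iB i)).
(* Both C and B_i contain elements 1 mod f, which makes the scalar between them a quotient of units
   mod f. *)
have Gal : G al.
  have [x [Bx x0 fx]] := coprime_ideal_one_neq0 hf (XB i).
  have [hC CO _ [y [Cy fy]]] := XC; have [_ BO _ _] := XB i.
  exists (al * x), x; split; rewrite ?mulf_neq0 ?mulfK //; last exact: (onep_umod hR fOK OKid).
  have Oax : OK (al * x) by apply: CO; rewrite eC; exists x.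
  split=> //; split; last by apply: OKB => //; exact: OK1.
  have : scale al (B i) y by rewrite -eC.
  move=> [z [Bz ey]]; exists z; split; first exact: BO.
  have -> : al * x * z - 1 = (x - 1) * y + (y - 1) by rewrite ey; ring.
  by apply: (modD hf) => //; apply: (modZr hf) => //; exact: CO.
have [j [hx [e [hhx ue eal]]]] := gs _ Gal.
exists (i, j) => /=; apply/(rayE _ (rm i j)).
have Be : scale e (B i) = B i.
  have hBi := invertible_mod (iB i); have [Oe [_ Oe']] := ue; have e0 := units_neq0 ue.
  apply: kset_eq => y; rewrite (scaleP _ _ e0); split=> h'.
    by rewrite -[y](mulVKf e0); exact: (modZ hBi).
  exact: (modZ hBi).
have eC' : C = scale hx (scale (g j) (B i)).
  by rewrite eC -[al](divfK (g0 j)) eal -mulrA (mulrC e) mulrA -!scale_scale Be.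
have rC := contraction_scale_congr hO b_free b_span hf hm mO fm N0_gt0 fN0 XC (Xg i j) eC' hhx.
exists (a^-1 * hx); split.
  by apply: (mgM hP); [exact: mgV|exact: (congr_group_Pgen hO hm mO hhx)].
by rewrite -scale_scale -rC -eA scaleVK.
Qed.

Lemma congr_count : exists a, qcard V (fun x y => f (x - y)) a.
Proof.
have [I [col hcol]] := finquot_OK hO b_free b_span hf N0_gt0 fN0.
apply: (@qcard_color _ _ _ I (fun x i => col x = i) (congr_erel hf _ _))
  => [x _|x y i [Ox _] [Oy _] <- e].
  by exists (col x).
by apply: hcol.
Qed.

Lemma quot_umod_index a : qcard V (fun x y => f (x - y)) a ->
  qcard G (fun x y => K1 (x / y)) (a * 2 ^ k).
Proof.
move=> ha; have emb0r (i : 'I_0) : real_emb ((fun _ => emb (emb0 K)) i) by case: i.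
have h1 := index_onep hf fOK N0_gt0 fN0 hR OKid OKself fOK OKid emb0r ha.
have tr (S : kset K) : (fun x => S x /\ positive_at (fun _ : 'I_0 => emb (emb0 K)) x) = S.
  by apply: kset_eq => x; split=> [[]//|hx]; split=> // [[]].
rewrite tr in h1.
have h2 : qcard G (fun x y => quot (onep f) (x / y)) a.
  move: h1; rewrite (_ : (fun x y => _ /\ _) = (fun x y => quot (onep f) (x / y))) //.
  apply: funext => x; apply: funext => y; apply: propext.
  by split=> [[]//|hx]; split=> // [[]].
have den := clear_den b_free b_span.
have h3 := index_signs hf fOK N0_gt0 fN0 sig_real sig_inj OsubOK den.
apply: (qcard_tower G_mgroup (onep_mgroup hf fOK) onep_pos_mgroup _ _ h2 h3).
  exact: (quot_onep_sub hR fOK OKid).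
by move=> x [].
Qed.

Lemma congr_group_index c : qcard (onem_umod O f m) (fun x y => f (x - y)) c ->
  qcard H (fun x y => K1 (x / y)) c.
Proof. exact: (index_onep hf fOK N0_gt0 fN0 hO OsubOK hm fm mO sig_real). Qed.


Lemma Umsig_erel : erel U (fun x y => Umsig O m sig (x / y)).
Proof.
apply: mgroup_erel; first exact: units_neq0.
split; first by move=> x /UmsigE[/units_neq0].
split; first by apply/UmsigE; split; [exact: units1|exact: (mg1 congr_group_mgroup)].
move=> x y /UmsigE[ux hx] /UmsigE[uy hy]; apply/UmsigE.
by split; [exact: (mg_div U_mgroup)|exact: (mg_div congr_group_mgroup)].
Qed.

(** E lies in G, and units congruent modulo K1 are congruent modulo U_(m,Sigma)(O), so finiteness of
    [G : K1] suffices. *)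
Lemma unit_index_finite : exists idx, qcard U (fun x y => Umsig O m sig (x / y)) idx.
Proof.
have [a /quot_umod_index h] := congr_count.
apply: (qcard_coarsen (mgroup_erel (mg_neq0 G_mgroup) onep_pos_mgroup) Umsig_erel h).
  move=> x ux; apply: congr_units_sub; exists 1, x; rewrite mul1r; split=> //;
    exact: (mg1 congr_group_mgroup).
move=> x y ux uy /onep_pos_sub hh; apply/UmsigE; split=> //; exact: (mg_div U_mgroup).
Qed.

Lemma congr_units_index_finite : exists q, qcard G (fun x y => congr_units (x / y)) q.
Proof.
have [a /quot_umod_index h] := congr_count.
have G0 := mg_neq0 G_mgroup.
apply: (qcard_coarsen (mgroup_erel G0 onep_pos_mgroup) (mgroup_erel G0 congr_units_mgroup) h) => //.
by move=> x y _ _ /onep_pos_sub/congr_group_sub.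
Qed.

Lemma Jstar_finite : exists c, qcard (Jstar O m) (ray_equiv O m sig) c.
Proof.
have [h hh] := class_number_finite hO b_free b_span; have [q hq] := congr_units_index_finite.
by exists (h * q)%N; exact: Jstar_count.
Qed.

Lemma ray_class_formula h idx c a d :
  qcard (invertible (@OK K)) (class_equiv (@OK K)) h ->
  qcard U (fun x y => Umsig O m sig (x / y)) idx ->
  qcard (Jstar O m) (ray_equiv O m sig) c ->
  qcard V (fun x y => f (x - y)) a ->
  qcard (onem_umod O f m) (fun x y => f (x - y)) d ->
  (c%:R : rat) = h%:R / idx%:R * ((2 ^ k * a)%:R / d%:R).
Proof.
move=> hh hi hc ha hd; have [q hq] := congr_units_index_finite.
have ec : c = (h * q)%N.
  exact: (qcard_uniq (ray_erel hO hm mO sig_real) hc (Jstar_count hh hq)).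
have G0 := mg_neq0 G_mgroup.
(* The index [G : K1] evaluated along both chains. *)
have e : (a * 2 ^ k = q * (idx * d))%N.
  apply: (qcard_uniq (mgroup_erel G0 onep_pos_mgroup) (quot_umod_index ha)).
  have t1 := qcard_tower congr_units_mgroup congr_group_mgroup onep_pos_mgroup
    congr_group_sub onep_pos_sub (units_index hi) (congr_group_index hd).
  apply: (qcard_tower G_mgroup congr_units_mgroup onep_pos_mgroup congr_units_sub _ hq t1).
  by move=> x /onep_pos_sub/congr_group_sub.
have pos (T : Type) (P : T -> Prop) E x N : P x -> qcard P E N -> (0 < N)%N.
  by move=> Px [r [_ [_ rs]]]; have [[i Hi] _] := rs x Px; exact: leq_ltn_trans Hi.
have idx0 : (idx%:R : rat) != 0 by rewrite pnatr_eq0 -lt0n (pos _ _ _ 1 _ _ hi) //; exact: units1.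
have d0 : (d%:R : rat) != 0.
  by rewrite pnatr_eq0 -lt0n (pos _ _ _ 1 _ _ hd) //; exact: (umod1 hf hO fm mO).
rewrite ec [(2 ^ k * a)%N]mulnC e !natrM; field.
by rewrite idx0 d0.
Qed.

End Count.

Lemma mult_indep_powers (K : fieldExtType rat) (N : nat) (u : 'I_N -> K) (e : 'I_N -> nat) :
  (forall i, 0 < e i)%N -> mult_indep u -> mult_indep (fun i => u i ^+ e i).
Proof.
move=> e0 hu c h i; have := hu (fun i => (e i)%:Z * c i).
have -> : \prod_i u i ^ ((e i)%:Z * c i) = \prod_i (u i ^+ e i) ^ c i.
  by apply: eq_bigr => l _; rewrite -exprz_exp.
by move=> /(_ h i)/eqP; rewrite mulf_eq0 eqz_nat eqn0Ngt e0 /= => /eqP.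
Qed.

Theorem theorem6p9 (K : fieldExtType rat) (r s : nat)
  (O m : K -> Prop) (k : nat) (sig : 'I_k -> K -> algC)
  (hr : qcard (@real_emb K) (fun f g => f = g) r)
  (hs : qcard (@nonreal_emb K) (fun f g => f = g) (2 * s))
  (hO : is_order O) (hm : integral_ideal O m) (hm0 : nonzero m)
  (hsig_real : forall i, real_emb (sig i)) (hsig_inj : injective sig) :
  (exists idx, qcard (units (@OK K)) (fun x y => Umsig O m sig (x / y)) idx) /\
  (exists c, qcard (Jstar O m) (ray_equiv O m sig) c) /\
  (forall h idx c a b,
     qcard (invertible (@OK K)) (class_equiv (@OK K)) h ->
     qcard (units (@OK K)) (fun x y => Umsig O m sig (x / y)) idx ->
     qcard (Jstar O m) (ray_equiv O m sig) c ->
     qcard (fun x => OK x /\ exists y, OK y /\ colon m (@OK K) (x * y - 1))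
           (fun x y => colon m (@OK K) (x - y)) a ->
     qcard (fun x => O x /\ (exists y, O y /\ colon m (@OK K) (x * y - 1)) /\
                     sumset m (colon m (@OK K)) (x - 1))
           (fun x y => colon m (@OK K) (x - y)) b ->
     (c%:R : rat) = h%:R / idx%:R * ((2 ^ k * a)%:R / b%:R)) /\
  group_rank (Umsig O m sig) (r + s - 1) /\
  group_rank (units (@OK K)) (r + s - 1).
Proof.
have [sO [b [b_free b_span]]] := hO; have [mM mO] := hm.
pose f := colon m (@OK K).
have OsubOK := O_sub_OK sO b_free b_span.
have fm : ksubset f m by move=> x /(_ _ (@OK1 K)); rewrite mulr1.
have hf : is_Omodule (@OK K) f.
  split; first by move=> y _; rewrite mul0r; exact: (mod0 mM).
  split=> [x y hx hy z hz|c x hc hx z hz].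
    by rewrite mulrDl; apply: (modD mM); [exact: hx|exact: hy].
  by have -> : c * x * z = x * (c * z) by [ring]; apply: hx; exact: OKM.
(* For mu nonzero in m, D / mu lies in O and D' O_K inside O; hence D D' O_K is contained in mu O,
   so in m. *)
have [N0 [N0_gt0 fN0]] : exists N0, (0 < N0)%N /\ f N0%:R.
  have [mu [hmu /eqP mu0]] := hm0.
  have [D [D0 hD]] := clear_den b_free b_span mu^-1.
  have [D' [D0' hD']] := order_index sO b_free b_span.
  exists (D * D')%N; rewrite muln_gt0 D0 D0'; split=> // x /hD' hx.
  have -> : (D * D')%:R * x = mu * ((D%:R * mu^-1) * (D'%:R * x)) by rewrite natrM; field.
  by apply: (modZr mM) => //; exact: (srM sO).
have fin := unit_index_finite sO b_free b_span hf mM mO fm N0_gt0 fN0 hsig_real hsig_inj.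
have card_pl := card_places hr hs.
have U_sub x : Umsig O m sig x -> units (@OK K) x.
  by move=> [[hx [x0 hx']] _]; split; [exact: OsubOK|split=> //; exact: OsubOK].
have upper N (u : 'I_N -> K) : (forall i, units (@OK K) (u i)) -> mult_indep u ->
  (N <= r + s - 1)%N.
  by rewrite -card_pl; exact: (units_rank_upper sO b_free b_span).
have [u [hu ind]] : exists u : 'I_(r + s - 1) -> K, (forall i, units (@OK K) (u i)) /\ mult_indep u.
  by rewrite -card_pl; exact: (units_rank_lower sO b_free b_span).
split=> //; split.
  exact: (Jstar_finite sO b_free b_span hf mM mO fm N0_gt0 fN0 hsig_real hsig_inj).
split.
  move=> h idx c a d hh hi hc ha hd.
  apply: (ray_class_formula sO b_free b_span hf mM mO fm N0_gt0 fN0 hsig_real hsig_inj hh hi hc).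
    rewrite (_ : umod f _ _ = (fun x => OK x /\ exists y, OK y /\ f (x * y - 1))) //.
    apply: kset_eq => x; split=> [[h1 [h2 _]]|[h1 h2]] //.
    by split=> //; split=> //; apply: OKB => //; exact: OK1.
  (* Since f lies in m, being 1 modulo the image of m in O/f is the same as being 1 mod m. *)
  rewrite (_ : onem_umod O f m = (fun x => O x /\ (exists y,
    O y /\ f (x * y - 1)) /\ sumset m f (x - 1))) //.
  apply: kset_eq => x; split=> [[h1 [h2 h3]]|[h1 [h2 [y [z [hy [hz e]]]]]]].
    split=> //; split=> //; exists (x - 1), 0; rewrite addr0; split=> //.
    by split=> //; exact: (mod0 hf).
  by split=> //; split=> //; rewrite e; apply: (modD mM) => //; exact: fm.
split; split.
- have /choice[e he] : forall i, exists N, (0 < N)%N /\ Umsig O m sig (u i ^+ N).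
    by move=> i; exact: (unit_power_Umsig sO b_free b_span hf mM mO fm N0_gt0 fN0 hsig_real).
  exists (fun i => u i ^+ e i); split=> [i|]; first by case: (he i).
  by apply: mult_indep_powers => // i; case: (he i).
- by move=> N v hv; apply: upper => i; exact: U_sub.
- by exists u.
- by move=> N v; exact: upper.
Qed.
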